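(* Let $n>2$ be an odd integer, let $m\ge1$, and let $T$ be the operator and $C$ the matrix defined in the context. Suppose that the matrix $C$ has a real eigenvalue $\mu_j$ of odd multiplicity $m_j$. Then the spectrum $\sigma(T)$ contains the set $(-\infty,-H]\cup[H,\infty)$ for some $H\ge0$.
   Context: Let $P_k=(p_{k,i,j})$, $k=2,\dots,n$, be $m\times m$ matrix functions with complex-valued PT-symmetric periodic entries: $p_{k,i,j}(x+1)=p_{k,i,j}(x)$, $p_{k,i,j}(-x)=\overline{p_{k,i,j}(x)}$, $p_{k,i,j}\in L_2[0,1]$. $T$ is the operator generated in $L_2^m(-\infty,\infty)$ (the $L_2$ space of $\mathbb{C}^m$-valued functions on $\mathbb{R}$) by the differential expression $$(-i)^ny^{(n)}+(-i)^{n-2}P_2y^{(n-2)}+(-i)^{n-3}P_3y^{(n-3)}+\dots+P_ny$$ (domain: $y\in L_2^m(-\infty,\infty)$ with $y^{(n-1)}$ locally absolutely continuous and the expression in $L_2^m(-\infty,\infty)$). It is well known that $\sigma(T)=\bigcup_{t\in[0,2\pi)}\sigma(T_t)$, where $T_t$ is generated in $L_2^m[0,1]$ by the same expression and the boundary conditions $y^{(\nu)}(1)=e^{it}y^{(\nu)}(0)$, $\nu=0,\dots,n-1$, and has a spectrum consisting of eigenvalues. $C=\int_0^1P_2(x)\,dx$ (a matrix with real entries). Multiplicity of an eigenvalue of $C$ means algebraic multiplicity. *)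

(* Defs.v *)
From HB Require Import structures.
From mathcomp Require Export all_boot all_order all_algebra.
From mathcomp Require Export complex.
From mathcomp Require Export all_classical all_reals all_analysis.
Export Order.TTheory GRing.Theory Num.Theory.
Export numFieldNormedType.Exports.

Set Implicit Arguments.
Unset Strict Implicit.
Unset Printing Implicit Defensive.

Local Open Scope classical_set_scope.
Local Open Scope ring_scope.

Section defs.
Variable R : realType.
Local Notation C := (R[i]).
Local Notation leb := (@lebesgue_measure R).
Local Notation normc := ComplexField.Normc.normc.

(* Elements of L_2 are handled through representatives; equality in L_2 is
   equality almost everywhere. *)
Definition L2 (D : set R) (f : R -> C) : Prop :=
  [/\ measurable_fun D (fun x => complex.Re (f x)),
      measurable_fun D (fun x => complex.Im (f x)) &
      (\int[leb]_(x in D) (normc (f x) ^+ 2)%:E < +oo)%E].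

Definition L2m (m : nat) (y : R -> 'cV[C]_m) : Prop :=
  forall j, L2 setT (fun x => y x j 0).

(* Only meaningful when L2m y holds: Rintegral is 0 on infinite integrals. *)
Definition L2norm (m : nat) (y : R -> 'cV[C]_m) : R :=
  Num.sqrt (\int[leb]_x (\sum_j normc (y x j 0) ^+ 2)).

Definition abs_continuous_on (a b : R) (f : R -> R) : Prop :=
  forall e : R, 0 < e -> exists2 d : R, 0 < d &
    forall (N : nat) (u v : 'I_N -> R),
      (forall i, [/\ a <= u i, u i <= v i & v i <= b]) ->
      trivIset setT (fun i => `]u i, v i[%classic) ->
      \sum_i (v i - u i) < d -> \sum_i `|f (v i) - f (u i)| < e.

Definition loc_abs_continuous (f : R -> R) : Prop :=
  forall a b : R, abs_continuous_on a b f.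

Definition reC m (y : R -> 'cV[C]_m) (j : 'I_m) : R -> R :=
  fun x => complex.Re (y x j 0).
Definition imC m (y : R -> 'cV[C]_m) (j : 'I_m) : R -> R :=
  fun x => complex.Im (y x j 0).

Definition vderiv m (k : nat) (y : R -> 'cV[C]_m) : R -> 'cV[C]_m :=
  fun x => \col_j (derive1n k (reC y j) x +i* derive1n k (imC y j) x)%C.

(* f^(k) exists everywhere for k <= n - 1 and f^(n-1) is locally absolutely
   continuous, hence f^(n) exists almost everywhere. *)
Definition smooth_loc_AC (n : nat) (f : R -> R) : Prop :=
  (forall (k : nat) (x : R), (k < n.-1)%N -> derivable (derive1n k f) x 1) /\
  loc_abs_continuous (derive1n n.-1 f).

(* Sum over k of (-i)^(n-k) P_k y^(n-k), without a k = 1 term; the values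
   P 0 and P 1 are not used. *)
Definition diff_expr (n m : nat) (P : nat -> R -> 'M[C]_m)
    (y : R -> 'cV[C]_m) (x : R) : 'cV[C]_m :=
  (- 'i%C) ^+ n *: vderiv n y x +
  \sum_(2 <= k < n.+1)
     (- 'i%C) ^+ (n - k) *: (P k x *m vderiv (n - k) y x).

(* An operator in L_2^m is given by its graph: A y g means that y belongs to
   the domain and that g represents the image of y. *)
Definition L2_operator (m : nat) : Type :=
  (R -> 'cV[C]_m) -> (R -> 'cV[C]_m) -> Prop.

Definition opT (n m : nat) (P : nat -> R -> 'M[C]_m) : L2_operator m :=
  fun y g =>
    [/\ L2m y,
        forall j, smooth_loc_AC n (reC y j) /\ smooth_loc_AC n (imC y j),
        L2m g &
        {ae leb, forall x, g x = diff_expr n P y x}].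

(* A - lambda maps the domain of A bijectively onto L_2^m and its inverse is
   bounded. *)
Definition resolvent_set (m : nat) (A : L2_operator m) : set C :=
  [set lambda |
    [/\ forall y g, A y g -> {ae leb, forall x, g x - lambda *: y x = 0} ->
          {ae leb, forall x, y x = 0},
        forall f, L2m f -> exists y g,
          A y g /\ {ae leb, forall x, g x - lambda *: y x = f x} &
        exists K : R, forall y g, A y g ->
          L2norm y <= K * L2norm (fun x => g x - lambda *: y x)]].

Definition spectrum (m : nat) (A : L2_operator m) : set C :=
  ~` resolvent_set A.

Definition cint01 (f : R -> C) : C :=
  ((\int[leb]_(x in `[0%R, 1%R]) complex.Re (f x))
     +i* (\int[leb]_(x in `[0%R, 1%R]) complex.Im (f x)))%C.

Definition Cmatrix (m : nat) (P : nat -> R -> 'M[C]_m) : 'M[C]_m :=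
  \matrix_(i, j) cint01 (fun x => P 2%N x i j).

(* p is an element of L_2[0,1] extended to R, so periodicity and PT-symmetry are
   equalities almost everywhere. *)
Definition PT_periodic_L2 (p : R -> C) : Prop :=
  [/\ L2 `[0, 1] p,
      {ae leb, forall x, p (x + 1) = p x} &
      {ae leb, forall x, p (- x) = ((p x)^*)%C}].

End defs.

(* Main.v *)
Require Import Defs.
From mathcomp Require cyclic separable cyclotomic.
From mathcomp Require Import perm zify measurable_realfun ring lra.

Set Implicit Arguments.
Unset Strict Implicit.
Unset Printing Implicit Defensive.

Local Open Scope classical_set_scope.
Local Open Scope ring_scope.

(** Since n is odd, a real spectral parameter is lambda = kappa^n with kappa
    real. Let w be a primitive n-th root of unity. Without lower-order terms the
    solutions are the exponentials exp(i kappa w^l x), of which only l = 0 is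
    bounded, the roots w^l with 0 < l < n being non-real. For every large real
    kappa the full equation has a bounded solution exp(i z x) u(x) with u
    periodic and z real, whose modulus stays away from 0 in one component
    ([bloch_wave]). Multiplied by a cutoff of width N it gives functions in the
    domain of T with norms of order sqrt N, on which T - lambda is bounded: the
    derivatives of the cutoff are O(1/N). So T - lambda has no bounded inverse
    ([bloch_in_spectrum]).

    The bounded solution is found by variation of constants. Set
    z = kappa - s / (n kappa), where s is a real unknown, and
    y^(q) = sum_l (i kappa w^l)^q exp(i z x) u_l. The amplitudes then satisfy
    u_l' = i kappa (w^l - 1) u_l + (i / kappa) (A u)_l with an integrable matrix
    A, and they have to be periodic. For l <> 0 and large kappa the rates have
    real parts bounded away from 0, so the periodic Green kernel is bounded; for
    l = 0 the rate is 0 and one prescribes instead a constant source in C^m.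
    Everything else is O(1 / kappa), and a contraction gives a solution U_b for
    each basis vector b of C^m ([fredholm_solution]). Its components are
    periodic except those with l = 0, whose jumps are i / kappa times the
    integrals of the same components of A U_b over a period ([mean]).

    Multiplied by n, these integrals form a matrix N(s) that is Lipschitz in s
    and equals s - C + O(1 / kappa) ([mean_close]). It is real: the
    PT-symmetry of the coefficients makes U_b invariant under the reflection
    x -> 1 - x combined with complex conjugation, which permutes the roots of
    unity and fixes l = 0 ([mean_real]). Near an eigenvalue of C of odd
    multiplicity the real function det (s - C) changes sign, hence so does
    det N(s), which therefore vanishes for some s
    ([odd_eigenvalue_persists], [singular_parameter]). A kernel vector c of N(s)
    cancels the jumps of sum_b c_b U_b, whose components are the amplitudes of
    the Bloch wave. *)

(** * Complex numbers and complex-valued integrals *)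

Notation cRe := complex.Re.
Notation cIm := complex.Im.
Notation normc := ComplexField.Normc.normc.

Section complex_algebra.
Variable R : realType.
Local Notation C := R[i].
Implicit Types z w : C.

Lemma cReD z w : cRe (z + w) = cRe z + cRe w. Proof. by case: z; case: w. Qed.
Lemma cImD z w : cIm (z + w) = cIm z + cIm w. Proof. by case: z; case: w. Qed.
Lemma cReN z : cRe (- z) = - cRe z. Proof. by case: z. Qed.
Lemma cImN z : cIm (- z) = - cIm z. Proof. by case: z. Qed.
Lemma cReM z w : cRe (z * w) = cRe z * cRe w - cIm z * cIm w.
Proof. by case: z; case: w. Qed.
Lemma cImM z w : cIm (z * w) = cRe z * cIm w + cIm z * cRe w.
Proof. by case: z => a b; case: w. Qed.
Lemma cRe_sum I (r : seq I) (P : pred I) (F : I -> C) :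
  cRe (\sum_(i <- r | P i) F i) = \sum_(i <- r | P i) cRe (F i).
Proof. by elim/big_rec2: _ => //= i x y _ <-; rewrite cReD. Qed.
Lemma cIm_sum I (r : seq I) (P : pred I) (F : I -> C) :
  cIm (\sum_(i <- r | P i) F i) = \sum_(i <- r | P i) cIm (F i).
Proof. by elim/big_rec2: _ => //= i x y _ <-; rewrite cImD. Qed.
Lemma ceqP z w : cRe z = cRe w -> cIm z = cIm w -> z = w.
Proof. by case: z w => a b [c d] /= -> ->. Qed.

Lemma normc_ge0 z : 0 <= normc z. Proof. by case: z => a b; exact: sqrtr_ge0. Qed.
Lemma normcD z w : normc (z + w) <= normc z + normc w.
Proof. exact: (le_normcD (z : Rcomplex R) w). Qed.
Lemma normc_opp z : normc (- z) = normc z.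
Proof. exact: (normcN (z : Rcomplex R)). Qed.
Lemma normcB z w : normc (z - w) <= normc z + normc w.
Proof. by rewrite (le_trans (normcD _ _))// normc_opp. Qed.
Lemma normc_distC z w : normc (z - w) = normc (w - z).
Proof. by rewrite -normc_opp opprB. Qed.
Lemma ler_normc_sum I (r : seq I) (P : pred I) (F : I -> C) :
  normc (\sum_(i <- r | P i) F i) <= \sum_(i <- r | P i) normc (F i).
Proof.
elim/big_rec2: _ => [|i x y _ h]; first by rewrite ComplexField.Normc.normc0.
by rewrite (le_trans (normcD _ _))// lerD2l.
Qed.
Lemma normcX z k : normc (z ^+ k) = normc z ^+ k.
Proof.
elim: k => [|k ih]; first by rewrite !expr0 ComplexField.Normc.normc1.
by rewrite !exprS ComplexField.Normc.normcM ih.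
Qed.
Lemma normc_real (a : R) : normc (a%:C)%C = `|a|.
Proof. by rewrite /= expr0n/= addr0 sqrtr_sqr. Qed.
Lemma normc_conj z : normc (z^*)%C = normc z.
Proof. by case: z => a b /=; rewrite sqrrN. Qed.
Lemma normc_i : normc ('i%C : C) = 1.
Proof. by rewrite /= expr0n/= add0r expr1n sqrtr1. Qed.
Lemma normc_Re z : `|cRe z| <= normc z.
Proof.
by case: z => a b /=; rewrite -sqrtr_sqr ler_sqrt ?lerDl ?sqr_ge0// addr_ge0// sqr_ge0.
Qed.
Lemma normc_Im z : `|cIm z| <= normc z.
Proof.
by case: z => a b /=; rewrite -sqrtr_sqr ler_sqrt ?lerDr ?sqr_ge0// addr_ge0// sqr_ge0.
Qed.
Lemma normc_le_ReIm z : normc z <= `|cRe z| + `|cIm z|.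
Proof.
case: z => a b /=; rewrite -[leRHS]ger0_norm ?addr_ge0// -sqrtr_sqr ler_wsqrtr//.
rewrite -(real_normK (num_real a)) -(real_normK (num_real b)) sqrrD.
by rewrite lerD2r lerDl mulrn_wge0// mulr_ge0.
Qed.
Lemma normc_sqr z : normc z ^+ 2 = cRe z ^+ 2 + cIm z ^+ 2.
Proof. by case: z => a b /=; rewrite sqr_sqrtr// addr_ge0// sqr_ge0. Qed.

End complex_algebra.

Section complex_integral.
Variable R : realType.
Local Notation C := R[i].
Local Notation mu := (@lebesgue_measure R).
Local Notation RT := (measurableTypeR R).
Implicit Types (D : set RT) (f g : R -> C) (k : R -> R) (z : C).

Definition cmeas D f :=
  measurable_fun D (fun x : RT => cRe (f x)) /\ measurable_fun D (fun x : RT => cIm (f x)).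

Local Notation rintegrable D k := (mu.-integrable D (EFin \o k)).

Definition cintegrable D f :=
  rintegrable D (fun x => cRe (f x)) /\ rintegrable D (fun x => cIm (f x)).

Definition cint D f : C :=
  ((\int[mu]_(x in D) cRe (f x)) +i* (\int[mu]_(x in D) cIm (f x)))%C.

Lemma rintegrable_dom D k k' : measurable D -> measurable_fun D (k : RT -> R) ->
  rintegrable D k' -> (forall x, D x -> `|k x| <= k' x) -> rintegrable D k.
Proof.
move=> mD mk ik' h; apply: (le_integrable mD _ _ ik') => /=.
  exact/measurable_EFinP.
by move=> x Dx; rewrite lee_fin (le_trans (h x Dx))// ler_norm.
Qed.

Lemma rintegrable_meas D k : rintegrable D k -> measurable_fun D (k : RT -> R).
Proof. by move=> /integrableP[/measurable_EFinP]. Qed.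

Lemma rintegrableD D k k' : measurable D -> rintegrable D k -> rintegrable D k' ->
  rintegrable D (fun x => k x + k' x).
Proof. by move=> mD h h'; exact: (integrableD mD h h'). Qed.

Lemma rintegrableZ D k r : measurable D -> rintegrable D k ->
  rintegrable D (fun x => r * k x).
Proof. by move=> mD h; exact: (integrableZl mD r h). Qed.

Lemma rintegrable_sum D (I : Type) (s : seq I) (P : pred I) (F : I -> R -> R) :
  measurable D -> (forall i, P i -> rintegrable D (F i)) ->
  rintegrable D (fun x => \sum_(i <- s | P i) F i x).
Proof.
move=> mD h; elim: s => [|i s ih].
  rewrite (_ : (fun _ => _) = fun=> 0); first exact: integrable0.
  by apply/funext => x; rewrite big_nil.
case Pi : (P i); last first.
  by rewrite (_ : (fun _ => _) = (fun x => \sum_(i <- s | P i) F i x))//;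
     apply/funext => x; rewrite big_cons Pi.
rewrite (_ : (fun _ => _) = (fun x => F i x + \sum_(i <- s | P i) F i x)).
  by apply: rintegrableD => //; exact: h.
by apply/funext => x; rewrite big_cons Pi.
Qed.

Lemma Rintegral_sum D (I : Type) (s : seq I) (P : pred I) (F : I -> R -> R) :
  measurable D -> (forall i, P i -> rintegrable D (F i)) ->
  \int[mu]_(x in D) (\sum_(i <- s | P i) F i x) =
  \sum_(i <- s | P i) \int[mu]_(x in D) F i x.
Proof.
move=> mD h; elim: s => [|i s ih].
  rewrite big_nil (_ : (fun x => _) = fun=> 0); first by rewrite Rintegral_cst// mul0r.
  by apply/funext => x; rewrite big_nil.
rewrite big_cons; case: ifP => Pi; last first.
  by rewrite -ih; congr Rintegral; apply/funext => x; rewrite big_cons Pi.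
rewrite -ih -RintegralD//; last 2 first.
- exact: h.
- exact: rintegrable_sum.
by congr Rintegral; apply/funext => x; rewrite big_cons Pi.
Qed.

Lemma rintegrable_cst (a b r : R) : rintegrable `[a, b] (fun=> r).
Proof.
apply: (measurable_bounded_integrable (mu := mu) (f := fun=> r)) => //.
- exact: (compact_finite_measure (@segment_compact _ a b)).
- exact: bounded_cst.
Qed.

Lemma rintegrableS D D' k : measurable D -> measurable D' -> D' `<=` D ->
  rintegrable D k -> rintegrable D' k.
Proof. by move=> mD mD' h; exact: integrableS. Qed.

Lemma cmeas_dom D f k : measurable D -> cmeas D f -> rintegrable D k ->
  (forall x, D x -> normc (f x) <= k x) -> cintegrable D f.
Proof.
move=> mD [mr mi] ik h; split.
  by apply: (rintegrable_dom mD mr ik) => x /h; exact/le_trans/normc_Re.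
by apply: (rintegrable_dom mD mi ik) => x /h; exact/le_trans/normc_Im.
Qed.

Lemma cintegrable_meas D f : cintegrable D f -> cmeas D f.
Proof. by case=> /rintegrable_meas ? /rintegrable_meas. Qed.

Lemma cmeas_normc D f : cmeas D f -> measurable_fun D (fun x : RT => normc (f x)).
Proof.
move=> [mr mi].
rewrite (_ : (fun _ => _) = (fun x => (cRe (f x) ^+ 2 + cIm (f x) ^+ 2) `^ 2^-1)); last first.
  apply/funext => x; rewrite powR12_sqrt ?addr_ge0 ?sqr_ge0//.
  by case: (f x).
apply: (@measurableT_comp _ _ _ _ _ _ (fun x : R => x `^ 2^-1)); first exact: measurable_powR.
by apply: measurable_funD; exact: measurable_funX.
Qed.

Lemma cintegrable_normc D f : measurable D -> cintegrable D f ->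
  rintegrable D (fun x => normc (f x)).
Proof.
move=> mD fi; have [ir ii] := fi.
apply: (@rintegrable_dom _ _ (fun x => `|cRe (f x)| + `|cIm (f x)|)) => //.
- by apply: cmeas_normc; exact: cintegrable_meas.
- by apply: rintegrableD => //; exact: integrable_norm.
- by move=> x _; rewrite ger0_norm ?normc_ge0// normc_le_ReIm.
Qed.

Lemma cmeasD D f g : cmeas D f -> cmeas D g -> cmeas D (fun x => f x + g x).
Proof.
move=> [fr fi] [gr gi]; split.
  by under eq_fun do rewrite cReD; exact: measurable_funD.
by under eq_fun do rewrite cImD; exact: measurable_funD.
Qed.

Lemma cmeasM D f g : cmeas D f -> cmeas D g -> cmeas D (fun x => f x * g x).
Proof.
move=> [fr fi] [gr gi]; split.
  under eq_fun do rewrite cReM.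
  by apply: measurable_funB; exact: measurable_funM.
under eq_fun do rewrite cImM.
by apply: measurable_funD; exact: measurable_funM.
Qed.

Lemma cmeas_cst D z : cmeas D (fun=> z).
Proof. by split; exact: measurable_cst. Qed.

Lemma cmeasZ D z f : cmeas D f -> cmeas D (fun x => z * f x).
Proof. by move=> mf; apply: cmeasM => //; exact: cmeas_cst. Qed.

Lemma cmeasN D f : cmeas D f -> cmeas D (fun x => - f x).
Proof.
move=> mf; rewrite (_ : (fun _ => _) = (fun x => (-1) * f x)); first exact: cmeasZ.
by apply/funext => x; rewrite mulN1r.
Qed.

Lemma cmeasJ D f : cmeas D f -> cmeas D (fun x => (f x)^*%C).
Proof.
move=> [mr mi]; split.
  by rewrite (_ : (fun _ => _) = (fun x => cRe (f x)))//; apply/funext => x; case: (f x).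
rewrite (_ : (fun _ => _) = (fun x => - cIm (f x))); first exact: measurable_funN.
by apply/funext => x; case: (f x).
Qed.

Lemma cmeas_sum D (I : Type) (s : seq I) (P : pred I) (F : I -> R -> C) :
  (forall i, P i -> cmeas D (F i)) -> cmeas D (fun x => \sum_(i <- s | P i) F i x).
Proof.
move=> h; elim: s => [|i s ih].
  by under eq_fun do rewrite big_nil; exact: cmeas_cst.
case Pi : (P i); under eq_fun do rewrite big_cons Pi; last by [].
by apply: cmeasD => //; exact: h.
Qed.

Lemma cmeasS D D' f : measurable D -> D' `<=` D -> cmeas D f -> cmeas D' f.
Proof. by move=> mD h [mr mi]; split; exact: measurable_funS mr || exact: measurable_funS mi. Qed.

Lemma cintegrableD D f g : measurable D -> cintegrable D f -> cintegrable D g ->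
  cintegrable D (fun x => f x + g x).
Proof.
move=> mD [fr fi] [gr gi]; split.
  by under eq_fun do rewrite cReD; exact: rintegrableD.
by under eq_fun do rewrite cImD; exact: rintegrableD.
Qed.

Lemma cintegrableZ D z f : measurable D -> cintegrable D f ->
  cintegrable D (fun x => z * f x).
Proof.
move=> mD fi; apply: (@cmeas_dom _ _ (fun x => normc z * normc (f x))) => //.
- exact/cmeasZ/cintegrable_meas.
- exact/rintegrableZ/cintegrable_normc.
- by move=> x _; rewrite ComplexField.Normc.normcM.
Qed.

Lemma cintegrable_cst (a b : R) z : cintegrable `[a, b] (fun=> z).
Proof. by split; exact: rintegrable_cst. Qed.

Lemma cintegrable_sum D (I : Type) (s : seq I) (P : pred I) (F : I -> R -> C) :
  measurable D -> (forall i, P i -> cintegrable D (F i)) ->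
  cintegrable D (fun x => \sum_(i <- s | P i) F i x).
Proof.
move=> mD h; split.
  under eq_fun do rewrite cRe_sum.
  by apply: rintegrable_sum => // i /h[].
under eq_fun do rewrite cIm_sum.
by apply: rintegrable_sum => // i /h[].
Qed.

Lemma cintegrableS D D' f : measurable D -> measurable D' -> D' `<=` D ->
  cintegrable D f -> cintegrable D' f.
Proof. by move=> mD mD' h [fr fi]; split; [exact: rintegrableS fr|exact: rintegrableS fi]. Qed.

Lemma cintegrableM_bounded D f g (M : R) : measurable D -> cmeas D f ->
  (forall x, D x -> normc (f x) <= M) -> cintegrable D g ->
  cintegrable D (fun x => f x * g x).
Proof.
move=> mD mf bf ig; apply: (@cmeas_dom _ _ (fun x => M * normc (g x))) => //.
- by apply: cmeasM => //; exact: cintegrable_meas.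
- exact/rintegrableZ/cintegrable_normc.
- by move=> x Dx; rewrite ComplexField.Normc.normcM ler_wpM2r ?normc_ge0// bf.
Qed.

Lemma eq_cint D f g : (forall x, D x -> f x = g x) -> cint D f = cint D g.
Proof.
by move=> h; rewrite /cint; congr Complex; apply: eq_Rintegral => x; rewrite inE => /h ->.
Qed.

Lemma cintD D f g : measurable D -> cintegrable D f -> cintegrable D g ->
  cint D (fun x => f x + g x) = cint D f + cint D g.
Proof.
move=> mD [fr fi] [gr gi]; apply: ceqP => /=.
  by under eq_Rintegral do rewrite cReD; rewrite RintegralD.
by under eq_Rintegral do rewrite cImD; rewrite RintegralD.
Qed.

Lemma cintZ D z f : measurable D -> cintegrable D f ->
  cint D (fun x => z * f x) = z * cint D f.
Proof.
move=> mD [fr fi]; apply: ceqP; rewrite ?cReM ?cImM /=.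
  under eq_Rintegral do rewrite cReM.
  by rewrite RintegralB ?RintegralZl//; exact: rintegrableZ.
under eq_Rintegral do rewrite cImM.
by rewrite RintegralD ?RintegralZl//; exact: rintegrableZ.
Qed.

Lemma cintB D f g : measurable D -> cintegrable D f -> cintegrable D g ->
  cint D (fun x => f x - g x) = cint D f - cint D g.
Proof.
move=> mD hf hg; rewrite -[in RHS]mulN1r -cintZ// -cintD//; last exact: cintegrableZ.
by apply: eq_cint => x _; rewrite mulN1r.
Qed.

Lemma cint_sum D (I : Type) (s : seq I) (P : pred I) (F : I -> R -> C) :
  measurable D -> (forall i, P i -> cintegrable D (F i)) ->
  cint D (fun x => \sum_(i <- s | P i) F i x) = \sum_(i <- s | P i) cint D (F i).
Proof.
move=> mD h; apply: ceqP; rewrite ?cRe_sum ?cIm_sum /=.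
  under eq_Rintegral do rewrite cRe_sum.
  by rewrite Rintegral_sum// => i /h[].
under eq_Rintegral do rewrite cIm_sum.
by rewrite Rintegral_sum// => i /h[].
Qed.

Lemma cintJ D f : measurable D -> cintegrable D f ->
  cint D (fun x => (f x)^*%C) = ((cint D f)^*)%C.
Proof.
move=> mD [fr fi]; rewrite /cint; congr Complex.
  by apply: eq_Rintegral => x _; case: (f x).
rewrite -mulN1r -RintegralZl//.
by apply: eq_Rintegral => x _; rewrite mulN1r; case: (f x).
Qed.

(** The real and imaginary parts are bounded separately, whence the factor 2. *)
Lemma cint_bound D f k : measurable D -> cintegrable D f -> rintegrable D k ->
  (forall x, D x -> normc (f x) <= k x) ->
  normc (cint D f) <= 2 * \int[mu]_(x in D) k x.
Proof.
move=> mD [fr fi] ik h; rewrite (le_trans (normc_le_ReIm _))//= mulr_natl mulr2n lerD//.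
  rewrite (le_trans (le_normr_Rintegral mD fr))// le_Rintegral//; first exact: integrable_norm.
  by move=> x /h; exact/le_trans/normc_Re.
rewrite (le_trans (le_normr_Rintegral mD fi))// le_Rintegral//; first exact: integrable_norm.
by move=> x /h; exact/le_trans/normc_Im.
Qed.

Lemma Rintegral_split (a b c : R) k : a <= b -> b <= c -> rintegrable `[a, c] k ->
  \int[mu]_(x in `[a, c]) k x =
  \int[mu]_(x in `[a, b]) k x + \int[mu]_(x in `[b, c]) k x.
Proof.
move=> ab bc ik.
have h := Rintegral_itvB (a := BLeft a) (b := BRight c) (x := b) ik.
rewrite !bnd_simp in h; have {h} := h ab bc.
move/eqP; rewrite subr_eq => /eqP ->; rewrite addrC; congr (_ + _).
rewrite Rintegral_itv_obnd_cbnd//.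
apply: integrableS ik => //; apply: subset_itvr; rewrite bnd_simp; exact: ab.
Qed.

Lemma cint_split (a b c : R) f : a <= b -> b <= c -> cintegrable `[a, c] f ->
  cint `[a, c] f = cint `[a, b] f + cint `[b, c] f.
Proof.
by move=> ab bc [fr fi]; apply: ceqP; rewrite ?cReD ?cImD /= -Rintegral_split.
Qed.

Lemma cint_set1 (a : R) f : cint `[a, a] f = 0.
Proof. by rewrite /cint set_itv1 !Rintegral_set1. Qed.

End complex_integral.

(** * Null sets and measure-preserving maps *)

Section almost_everywhere.
Variable R : realType.
Local Notation mu := (@lebesgue_measure R).
Implicit Types P Q S : R -> Prop.

Lemma ae_imp P Q : (forall x, P x -> Q x) ->
  {ae mu, forall x, P x} -> {ae mu, forall x, Q x}.
Proof. by move=> PQ; apply: (@filterS _ _ (ae_filter_ringOfSetsType mu)). Qed.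

Lemma ae_imp2 P Q S : (forall x, P x -> Q x -> S x) ->
  {ae mu, forall x, P x} -> {ae mu, forall x, Q x} -> {ae mu, forall x, S x}.
Proof. by move=> PQS; apply: (@filterS2 _ _ (ae_filter_ringOfSetsType mu)). Qed.

Lemma ae_forall_fin (J : finType) (P : J -> R -> Prop) :
  (forall j, {ae mu, forall x, P j x}) -> {ae mu, forall x, forall j, P j x}.
Proof.
move=> h; have : {ae mu, forall x, forall j, j \in enum J -> P j x}.
  elim: (enum J) => [|a s ih]; first by apply: aeW => x j.
  apply: ae_imp2 (h a) ih => x h1 h2 j.
  by rewrite in_cons => /orP[/eqP ->|/h2].
by apply: ae_imp => x hx j; apply: hx; rewrite mem_enum.
Qed.

End almost_everywhere.

Section measure_preserving.
Variable R : realType.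
Local Notation C := R[i].
Local Notation mu := (@lebesgue_measure R).
Local Notation RT := (measurableTypeR R).
Local Notation rintegrable D k := (mu.-integrable D (EFin \o k)).
Implicit Types (D A : set RT) (f g : R -> C) (k : R -> R) (z : C) (phi : RT -> RT).

Definition mpres phi := measurable_fun [set: RT] phi /\
  forall A, measurable A -> mu (phi @^-1` A) = mu A.

(** Lebesgue measure is determined by its values on half-open intervals. *)
Lemma mpres_itv phi : measurable_fun [set: RT] phi ->
  (forall a b : R, a < b -> mu (phi @^-1` `]a, b]) = (b - a)%:E) -> mpres phi.
Proof.
move=> mphi h; split => // A mA.
have mA' := lebesgue_measure_unique (mu := pushforward mu phi).
rewrite -[LHS]/(pushforward mu phi A) -mA'// => X /ocitvP[->|[[a b] /= ab ->]].
  by rewrite !measure0.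
have e := lebesgue_measure_itv (R := R) `]a, b].
by rewrite {}e /= lte_fin ab /pushforward h// EFinB.
Qed.

Lemma mpres_shift (c : R) : mpres (fun x : R => x + c).
Proof.
apply: mpres_itv.
  by apply: (@measurable_funD _ RT R setT id (cst c)) => //; exact: measurable_cst.
move=> a b ab; rewrite (_ : _ @^-1` _ = `]a - c, b - c]%classic); last first.
  by apply/seteqP; split=> x; rewrite /= !in_itv/= ltrBlDr lerBrDr.
have e := lebesgue_measure_itv (R := R) `]a - c, b - c].
rewrite {}e /= lte_fin ltrD2r ab -EFinB; congr EFin; lra.
Qed.

Lemma mpres_refl (c : R) : mpres (fun x : R => c - x).
Proof.
apply: mpres_itv.
  by apply: (@measurable_funB _ RT R setT (cst c) id) => //; exact: measurable_cst.
move=> a b ab; rewrite (_ : _ @^-1` _ = `[c - b, c - a[%classic); last first.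
  apply/seteqP; split=> x; rewrite /= !in_itv/= => /andP[h1 h2]; apply/andP; split; lra.
have e := lebesgue_measure_itv (R := R) `[c - b, c - a[.
rewrite {}e /= lte_fin ltrD2l ltrN2 ab -EFinB; congr EFin; lra.
Qed.

Lemma mpres_measurable_set phi A : mpres phi -> measurable A -> measurable (phi @^-1` A).
Proof. by case=> mphi _ mA; rewrite -[X in measurable X]setTI; exact: mphi. Qed.

Lemma mpres_measurable phi D (k : RT -> R) : mpres phi -> measurable D ->
  measurable_fun D k -> measurable_fun (phi @^-1` D) (k \o phi).
Proof.
move=> mp mD mk _ Y mY; rewrite (_ : _ `&` _ = phi @^-1` (D `&` k @^-1` Y))//.
by apply: mpres_measurable_set => //; exact: mk.
Qed.

Lemma mpres_integral phi D (F : RT -> \bar R) : mpres phi -> measurable D ->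
  measurable_fun D F ->
  (\int[mu]_(x in D) F x = \int[mu]_(x in phi @^-1` D) (F \o phi) x)%E.
Proof.
move=> [mphi hphi] mD mF.
have e (G : RT -> \bar R) : (\int[mu]_(x in D) G x = \int[pushforward mu phi]_(x in D) G x)%E.
  by apply: eq_measure_integral => A mA _; rewrite /= /pushforward hphi.
rewrite integralE [RHS]integralE !e; congr (_ - _)%E.
  rewrite ge0_integral_pushforward//; last exact: measurable_funepos.
  by apply: eq_integral => x _; rewrite /= !funeposE.
rewrite ge0_integral_pushforward//; last exact: measurable_funeneg.
by apply: eq_integral => x _; rewrite /= !funenegE.
Qed.

Lemma mpres_rintegrable phi D k : mpres phi -> measurable D ->
  rintegrable D k -> rintegrable (phi @^-1` D) (k \o phi).
Proof.
move=> mp mD /integrableP[mk ik]; apply/integrableP; split.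
  apply/measurable_EFinP; apply: mpres_measurable => //.
  exact/measurable_EFinP.
rewrite (mpres_integral mp mD) in ik => //.
exact: measurableT_comp.
Qed.

Lemma mpres_Rintegral phi D k : mpres phi -> measurable D -> rintegrable D k ->
  \int[mu]_(x in D) k x = \int[mu]_(x in phi @^-1` D) k (phi x).
Proof.
move=> mp mD /integrableP[mk _]; rewrite /Rintegral (mpres_integral mp mD)//.
Qed.

Lemma mpres_cintegrable phi D f : mpres phi -> measurable D ->
  cintegrable D f -> cintegrable (phi @^-1` D) (f \o phi).
Proof.
by move=> mp mD [fr fi]; split; [have := mpres_rintegrable mp mD fr|have := mpres_rintegrable mp mD fi].
Qed.

Lemma mpres_cint phi D f : mpres phi -> measurable D -> cintegrable D f ->
  cint D f = cint (phi @^-1` D) (f \o phi).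
Proof.
by move=> mp mD [fr fi]; rewrite /cint (mpres_Rintegral mp mD fr) (mpres_Rintegral mp mD fi).
Qed.

Lemma mpres_ae phi (Q : R -> Prop) : mpres phi ->
  {ae mu, forall x, Q x} -> {ae mu, forall x, Q (phi x)}.
Proof.
move=> mp [A [mA A0 QA]]; exists (phi @^-1` A); split.
- exact: mpres_measurable_set.
- by rewrite mp.2.
- by move=> x /= nQ; exact: QA.
Qed.

Lemma cint_shift (a b c : R) f : cintegrable `[a, b] f ->
  cintegrable `[a + c, b + c] (fun x => f (x - c)) /\
  cint `[a + c, b + c] (fun x => f (x - c)) = cint `[a, b] f.
Proof.
move=> fi; have mp := mpres_shift (- c).
have e : (fun x : R => x + - c) @^-1` `[a, b] = `[a + c, b + c]%classic.
  by apply/seteqP; split=> x; rewrite /= !in_itv/= lerBrDr lerBlDr.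
split; first by rewrite -e; exact: mpres_cintegrable.
by rewrite (mpres_cint mp _ fi)//= e.
Qed.

Lemma cint_refl (a b c : R) f : cintegrable `[a, b] f ->
  cintegrable `[c - b, c - a] (fun x => f (c - x)) /\
  cint `[c - b, c - a] (fun x => f (c - x)) = cint `[a, b] f.
Proof.
move=> fi; have mp := mpres_refl c.
have e : (fun x : R => c - x) @^-1` `[a, b] = `[c - b, c - a]%classic.
  apply/seteqP; split=> x; rewrite /= !in_itv/= => /andP[h1 h2]; apply/andP; split; lra.
split; first by rewrite -e; exact: mpres_cintegrable.
by rewrite (mpres_cint mp _ fi)//= e.
Qed.

Lemma ae_eq_cint D f g : measurable D -> cmeas D f -> cmeas D g ->
  {ae mu, forall x, D x -> f x = g x} -> cint D f = cint D g.
Proof.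
move=> mD [fr fi] [gr gi] h; rewrite /cint; congr Complex; congr fine; apply: ae_eq_integral => //.
- exact/measurable_EFinP.
- exact/measurable_EFinP.
- by apply: filterS h => x h Dx; rewrite h.
- exact/measurable_EFinP.
- exact/measurable_EFinP.
- by apply: filterS h => x h Dx; rewrite h.
Qed.

End measure_preserving.

(** * Primitives of integrable functions *)

Section primitives.
Variable R : realType.
Local Notation C := R[i].
Local Notation mu := (@lebesgue_measure R).
Local Notation RT := (measurableTypeR R).
Local Notation rintegrable D k := (mu.-integrable D (EFin \o k)).
Implicit Types (f g F G : R -> C) (k : R -> R) (z : C).

(** Absolute continuity of F with derivative f, in integrated form: the
    coefficients being merely integrable, solutions of the differential equations
    below have no pointwise derivatives. *)
Definition primitive (b : R) F f :=
  cintegrable `[0, b] f /\ forall x, 0 <= x <= b -> F x = F 0 + cint `[0, x] f.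

Lemma subitv (a b c d : R) : c <= a -> b <= d -> `[a, b] `<=` `[c, d].
Proof. by move=> ca bd; apply: subset_itv; rewrite bnd_simp. Qed.

Lemma rintegrable_sub (a b c d : R) k : c <= a -> b <= d ->
  rintegrable `[c, d] k -> rintegrable `[a, b] k.
Proof. by move=> ca bd; apply: integrableS => //; exact: subitv. Qed.

Lemma cintegrable_sub (a b c d : R) f : c <= a -> b <= d ->
  cintegrable `[c, d] f -> cintegrable `[a, b] f.
Proof. by move=> ca bd [fr fi]; split; exact: rintegrable_sub fr || exact: rintegrable_sub fi. Qed.

Lemma Rint_cst (a b r : R) : a <= b -> \int[mu]_(x in `[a, b]) r = r * (b - a).
Proof.
move=> ab; rewrite Rintegral_cst//; congr (_ * _).
apply: (etrans (congr1 fine (lebesgue_measure_itv `[a, b]))).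
rewrite /= lte_fin; case: ltP => //= ba.
by apply/esym/eqP; rewrite subr_eq0 eq_le ba ab.
Qed.

Lemma primitiveB b F f x y : primitive b F f -> 0 <= x -> x <= y -> y <= b ->
  F y - F x = cint `[x, y] f.
Proof.
move=> [fi h] x0 xy yb; rewrite (h y) ?(h x) ?x0 ?(le_trans xy) ?(le_trans x0)//.
rewrite (cint_split x0 xy); first by rewrite opprD addrACA subrr add0r addrC addKr.
exact: cintegrable_sub fi.
Qed.

Lemma primitiveD b F f G g : primitive b F f -> primitive b G g ->
  primitive b (fun x => F x + G x) (fun x => f x + g x).
Proof.
move=> [fi hF] [gi hG]; split; first exact: cintegrableD.
move=> x xb; have /andP[x0 x1] := xb; rewrite hF// hG// cintD//; last 2 first.
- exact: cintegrable_sub fi.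
- exact: cintegrable_sub gi.
by rewrite addrACA.
Qed.

Lemma primitiveZ b F f z : primitive b F f ->
  primitive b (fun x => z * F x) (fun x => z * f x).
Proof.
move=> [fi hF]; split; first exact: cintegrableZ.
move=> x xb; have /andP[x0 x1] := xb; rewrite hF// cintZ ?mulrDr//.
exact: cintegrable_sub fi.
Qed.

Lemma primitive_cst b z : primitive b (fun=> z) (fun=> 0).
Proof.
split=> [|x _]; first exact: cintegrable_cst.
by rewrite /cint Rintegral_cst//= mul0r addr0.
Qed.

Lemma primitive_sum b (I : Type) (s : seq I) (P : pred I) (F f : I -> R -> C) :
  (forall i, P i -> primitive b (F i) (f i)) ->
  primitive b (fun x => \sum_(i <- s | P i) F i x) (fun x => \sum_(i <- s | P i) f i x).
Proof.
move=> h; elim: s => [|i s ih].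
  by under eq_fun do rewrite big_nil; under [X in primitive _ _ X]eq_fun do rewrite big_nil;
     exact: primitive_cst.
case Pi : (P i); under eq_fun do rewrite big_cons Pi;
  under [X in primitive _ _ X]eq_fun do rewrite big_cons Pi; last by [].
by apply: primitiveD => //; exact: h.
Qed.

Lemma eq_primitive b F f G g : 0 <= b ->
  (forall x, 0 <= x <= b -> F x = G x) -> (forall x, 0 <= x <= b -> f x = g x) ->
  primitive b F f -> primitive b G g.
Proof.
move=> b0 FG fg [fi h].
have cg : cintegrable `[0, b] g.
  case: fi => fr fi; split.
    by apply: eq_integrable fr => // x; rewrite inE /= in_itv/= => xb; rewrite /= fg.
  by apply: eq_integrable fi => // x; rewrite inE /= in_itv/= => xb; rewrite /= fg.
split=> // x xb; rewrite -FG// -FG ?lexx// h//; congr (_ + _).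
apply: eq_cint => y; rewrite /= in_itv/= => /andP[y0 yx]; apply: fg.
by rewrite y0 (le_trans yx)//; case/andP: xb.
Qed.

Lemma primitive_bounded b F f x : primitive b F f -> 0 <= x <= b ->
  normc (F x) <= normc (F 0) + 2 * \int[mu]_(t in `[0, b]) normc (f t).
Proof.
move=> [fi h] xb; have /andP[x0 x1] := xb; rewrite h// (le_trans (normcD _ _))// lerD2l.
have fn := cintegrable_normc (measurable_itv _) fi.
have fix_ := cintegrable_sub (lexx 0) x1 fi.
rewrite (le_trans (cint_bound (measurable_itv _) fix_ (cintegrable_normc (measurable_itv _) fix_) _))//.
rewrite ler_wpM2l// (Rintegral_split x0 x1 fn) lerDl Rintegral_ge0// => t _.
exact: normc_ge0.
Qed.

(** Over a subdivision into M steps the increments of Delta add up to O(1/M),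
    because the increments of k telescope. *)
Lemma flat_increments (b : R) (Delta : R -> C) k : 0 <= b ->
  (forall x y, 0 <= x -> x <= y -> y <= b ->
     normc (Delta y - Delta x) <= (y - x) * (k y - k x)) ->
  Delta b = Delta 0.
Proof.
move=> b0 h.
have key (M : nat) : normc (Delta b - Delta 0) <= (b * (k b - k 0)) / M.+1%:R.
  pose t (i : nat) : R := b * i%:R / M.+1%:R.
  have t0 : t 0 = 0 by rewrite /t mulr0 mul0r.
  have tM : t M.+1 = b by rewrite /t mulfK// pnatr_eq0.
  have tS i : t i.+1 - t i = b / M.+1%:R.
    by rewrite /t -mulrBl -mulrBr -natrB// subSnn mulr1.
  have tge i : 0 <= t i by rewrite /t !mulr_ge0// invr_ge0.
  have tle i : t i <= t i.+1 by rewrite -subr_ge0 tS mulr_ge0// invr_ge0.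
  have tb i : (i <= M.+1)%N -> t i <= b.
    by move=> iM; rewrite -[leRHS]tM /t ler_wpM2r ?invr_ge0// ler_wpM2l// ler_nat.
  have H i : (i <= M.+1)%N ->
      normc (Delta (t i) - Delta 0) <= b / M.+1%:R * (k (t i) - k 0).
    elim: i => [_|i ih iM].
      by rewrite t0 !subrr mulr0 ComplexField.Normc.normc0.
    rewrite -(subrK (Delta (t i)) (Delta (t i.+1))) -addrA.
    rewrite (le_trans (normcD _ _))//.
    rewrite (_ : k (t i.+1) - k 0 = (k (t i.+1) - k (t i)) + (k (t i) - k 0)); last lra.
    rewrite mulrDr lerD// ?ih 1?ltnW// -(tS i); apply: h => //; exact: tb.
  by have := H M.+1 (leqnn _); rewrite tM mulrAC.
apply/eqP; rewrite -subr_eq0; apply/eqP/ComplexField.Normc.eq0_normc/eqP.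
rewrite eq_le normc_ge0 andbT leNgt; apply/negP => p.
set K := b * (k b - k 0) in key.
have [M hM] : exists M : nat, K / normc (Delta b - Delta 0) < M%:R.
  have := archi_boundP (normr_ge0 (K / normc (Delta b - Delta 0))) => hM.
  by exists (Num.bound (`|K / normc (Delta b - Delta 0)|)); exact: le_lt_trans (ler_norm _) hM.
have := key M; apply/negP; rewrite -ltNge ltr_pdivrMr ?ltr0n// -ltr_pdivrMl// mulrC.
by rewrite (lt_trans hM)// ltr_nat.
Qed.

Lemma cmeas_primitive b F f : 0 <= b -> primitive b F f -> cmeas `[0, b] F.
Proof.
move=> b0 [[fr fi] h].
have hr : measurable_fun `[0, b] (fun x : RT => \int[mu]_(t in `[0, x]) cRe (f t)).
  apply: subspace_continuous_measurable_fun => //.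
  exact: (parameterized_integral_continuous b0 fr).
have hi : measurable_fun `[0, b] (fun x : RT => \int[mu]_(t in `[0, x]) cIm (f t)).
  apply: subspace_continuous_measurable_fun => //.
  exact: (parameterized_integral_continuous b0 fi).
split.
  apply: (@eq_measurable_fun _ _ _ _ _ (fun x : RT => cRe (F 0) + \int[mu]_(t in `[0, x]) cRe (f t))).
    by move=> x; rewrite inE /= in_itv/= => xb; rewrite [in RHS]h// cReD.
  by apply: measurable_funD => //; exact: measurable_cst.
apply: (@eq_measurable_fun _ _ _ _ _ (fun x : RT => cIm (F 0) + \int[mu]_(t in `[0, x]) cIm (f t))).
  by move=> x; rewrite inE /= in_itv/= => xb; rewrite [in RHS]h// cImD.
by apply: measurable_funD => //; exact: measurable_cst.
Qed.

Lemma cintegrable_primitive_mul b F f G g : 0 <= b -> primitive b F f -> cintegrable `[0, b] g ->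
  cintegrable `[0, b] (fun x => F x * g x).
Proof.
move=> b0 pF ig; have mF := cmeas_primitive b0 pF.
apply: (cintegrableM_bounded (M := normc (F 0) + 2 * \int[mu]_(t in `[0, b]) normc (f t))) => //.
by move=> x; rewrite /= in_itv/=; exact: primitive_bounded pF.
Qed.

(** The defect Delta of the product formula has increments
    O((v - u) \int_u^v |g|), so it is constant by [flat_increments]. *)
Lemma primitiveM b F f G g (L : R) : 0 <= b ->
  (forall x, 0 <= x <= b -> normc (f x) <= L) ->
  primitive b F f -> primitive b G g ->
  primitive b (fun x => F x * G x) (fun x => f x * G x + F x * g x).
Proof.
move=> b0 bf pF pG; have [fi hF] := pF; have [gi hG] := pG.
have gn := cintegrable_normc (measurable_itv `[0, b]) gi.
have i1 : cintegrable `[0, b] (fun x => f x * G x).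
  rewrite (_ : (fun _ => _) = (fun x => G x * f x)); last by apply/funext => x; rewrite mulrC.
  exact: cintegrable_primitive_mul pG fi.
have i2 : cintegrable `[0, b] (fun x => F x * g x) by exact: cintegrable_primitive_mul pF gi.
have i12 := cintegrableD (measurable_itv `[0, b]) i1 i2.
split=> // x xb.
pose Delta x := F x * G x - cint `[0, x] (fun x => f x * G x + F x * g x).
(* The integrals of f (G v - G) and (F u - F) g contribute 4 L each. *)
pose k x := 8 * L * \int[mu]_(t in `[0, x]) normc (g t).
suff : Delta x = Delta 0.
  rewrite /Delta cint_set1 subr0 => /eqP; rewrite subr_eq => /eqP ->.
  by rewrite addrC.
have /andP[x0 xb'] := xb.
apply: (flat_increments (k := k)) => // u v u0 uv vx.
have vb := le_trans vx xb'; have ub := le_trans uv vb; have v0 := le_trans u0 uv.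
have iuv h : cintegrable `[0, b] h -> cintegrable `[u, v] h by exact: cintegrable_sub.
have -> : Delta v - Delta u =
    cint `[u, v] (fun s => f s * (G v - G s) + (F u - F s) * g s).
  have -> : Delta v - Delta u = F v * G v - F u * G u - cint `[u, v] (fun x => f x * G x + F x * g x).
    rewrite /Delta (cint_split u0 uv); last exact: cintegrable_sub i12.
    by ring.
  have -> : F v * G v - F u * G u = (F v - F u) * G v + F u * (G v - G u) by ring.
  rewrite (primitiveB pF u0 uv vb) (primitiveB pG u0 uv vb) mulrC -!cintZ//; try exact: iuv.
  rewrite -cintD//; try (by apply: cintegrableZ => //; exact: iuv).
  rewrite -cintB//; last 2 first.
  - by apply: cintegrableD => //; apply: cintegrableZ => //; exact: iuv.
  - exact: iuv.
  by apply: eq_cint => s _; ring.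
set K := \int[mu]_(t in `[u, v]) normc (g t).
have gnuv : rintegrable `[u, v] (fun t => normc (g t)) by exact: rintegrable_sub gn.
have kE : k v - k u = 8 * L * K.
  rewrite /k (Rintegral_split u0 uv); first by rewrite /K; ring.
  exact: rintegrable_sub gn.
have L0 : 0 <= L by rewrite (le_trans (normc_ge0 (f 0)))// bf// lexx.
have K0 : 0 <= K by rewrite Rintegral_ge0// => t _; exact: normc_ge0.
have bG s : u <= s <= v -> normc (G v - G s) <= 2 * K.
  move=> /andP[us sv]; rewrite (primitiveB pG (le_trans u0 us) sv vb).
  have gsv : cintegrable `[s, v] g by apply: cintegrable_sub gi => //; exact: le_trans us.
  rewrite (le_trans (cint_bound (measurable_itv _) gsv (cintegrable_normc (measurable_itv _) gsv) _))//.
  by rewrite ler_wpM2l// /K (Rintegral_split us sv gnuv) lerDr Rintegral_ge0// => t _; exact: normc_ge0.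
have bF s : u <= s <= v -> normc (F u - F s) <= 2 * (L * (v - u)).
  move=> /andP[us sv]; rewrite normc_distC (primitiveB pF u0 us (le_trans sv vb)).
  have fus : cintegrable `[u, s] f by apply: cintegrable_sub fi => //; exact: le_trans vb.
  have ic := rintegrable_cst u s L.
  rewrite (le_trans (cint_bound (measurable_itv _) fus ic _))//.
    move=> t; rewrite /= in_itv/= => /andP[ut ts]; apply: bf.
    by rewrite (le_trans u0 ut) (le_trans ts)// (le_trans sv).
  by rewrite ler_wpM2l// Rint_cst// ler_wpM2l// lerD2r.
rewrite kE.
pose kk s := L * (2 * K) + 2 * (L * (v - u)) * normc (g s).
have ikk : rintegrable `[u, v] kk.
  apply: (rintegrableD (k := fun=> L * (2 * K))) => //; first exact: rintegrable_cst.
  exact: (rintegrableZ (2 * (L * (v - u))) (measurable_itv _) gnuv).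
have ii : cintegrable `[u, v] (fun s => f s * (G v - G s) + (F u - F s) * g s).
  apply: (@cmeas_dom _ _ _ kk) => //.
    have [mf mg] : cmeas `[u, v] f /\ cmeas `[u, v] g by split; apply/cintegrable_meas; exact: iuv.
    have [mF mG] : cmeas `[u, v] F /\ cmeas `[u, v] G.
      split; apply: cmeasS (cmeas_primitive b0 _) => //; try exact: subitv.
        exact: pF.
      exact: pG.
    apply: cmeasD; apply: cmeasM => //; apply: cmeasD; try exact: cmeas_cst; exact: cmeasN.
  move=> s; rewrite /= in_itv/= => suv; have /andP[us sv] := suv.
  rewrite (le_trans (normcD _ _))// !ComplexField.Normc.normcM lerD//.
    by rewrite ler_pM ?normc_ge0 ?bG// bf// (le_trans u0 us) (le_trans sv).
  by rewrite ler_wpM2r ?normc_ge0// bF.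
rewrite (le_trans (cint_bound (measurable_itv _) ii ikk _))//.
  move=> s; rewrite /= in_itv/= => suv; have /andP[us sv] := suv.
  rewrite (le_trans (normcD _ _))// !ComplexField.Normc.normcM lerD//.
    by rewrite ler_pM ?normc_ge0 ?bG// bf// (le_trans u0 us) (le_trans sv).
  by rewrite ler_wpM2r ?normc_ge0// bF.
rewrite /kk RintegralD//; last 2 first.
- exact: rintegrable_cst.
- exact: (rintegrableZ (2 * (L * (v - u))) (measurable_itv _) gnuv).
have -> : \int[mu]_(x in `[u, v]) (L * (2 * K)) = L * (2 * K) * (v - u) by exact: Rint_cst.
rewrite RintegralZl// -/K.
lra.
Qed.

End primitives.

(** * The complex exponential *)

Section cexp.
Variable R : realType.
Local Notation C := R[i].
Local Notation mu := (@lebesgue_measure R).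
Local Notation rintegrable D k := (mu.-integrable D (EFin \o k)).

Definition cexp (z : C) : C := (expR (cRe z) * cos (cIm z) +i* (expR (cRe z) * sin (cIm z)))%C.

Lemma cexp0 : cexp 0 = 1.
Proof. by rewrite /cexp /= expR0 cos0 sin0 mulr1 mulr0. Qed.

Lemma cexpD z w : cexp (z + w) = cexp z * cexp w.
Proof.
apply: ceqP; rewrite ?cReM ?cImM /= cReD cImD expRD ?cosD ?sinD; ring.
Qed.

Lemma cexpNK z : cexp (- z) * cexp z = 1.
Proof. by rewrite -cexpD addNr cexp0. Qed.

Lemma normc_cexp z : normc (cexp z) = expR (cRe z).
Proof.
by rewrite /cexp /= !exprMn -mulrDr cos2Dsin2 mulr1 sqrtr_sqr ger0_norm// expR_ge0.
Qed.

Lemma cexpJ z : ((cexp z)^*)%C = cexp (z^*)%C.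
Proof. by case: z => a b; rewrite /cexp /= cosN sinN mulrN. Qed.

Lemma cexp_neq0 z : cexp z != 0.
Proof.
apply/eqP => h; have := cexpNK z; rewrite h mulr0 => /eqP.
by rewrite eq_sym oner_eq0.
Qed.

Lemma rFTC (b : R) (F f : R -> R) : 0 <= b -> continuous f ->
  (forall x, is_derive x (1 : R) F (f x)) ->
  rintegrable `[0, b] f /\ F b = F 0 + \int[mu]_(x in `[0, b]) f x.
Proof.
move=> b0 cf dF.
have wf : {within `[0, b], continuous f} by exact: continuous_subspaceT.
split; first by apply: continuous_compact_integrable => //; exact: segment_compact.
have [b0'|] := ltP 0 b; last first.
  by move=> b0'; have -> : b = 0 by [apply/eqP; rewrite eq_le b0 b0'];
     rewrite set_itv1 Rintegral_set1 addr0.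
have cF : continuous F.
  move=> x; apply: differentiable_continuous; apply/derivable1_diffP.
  by have [] := dF x.
rewrite /Rintegral (continuous_FTC2 b0' wf (F := F)).
- by rewrite -EFinB /=; ring.
- apply: And3; first by move=> x _; have [] := dF x.
  + by apply: cvg_at_right_filter; exact: cF.
  + by apply: cvg_at_left_filter; exact: cF.
- by move=> x _; rewrite derive1E; have [_ ->] := dF x.
Qed.

Lemma primitive_smooth (b : R) (F f : R -> C) : 0 <= b ->
  continuous (fun x => cRe (f x)) -> continuous (fun x => cIm (f x)) ->
  (forall x, is_derive x (1 : R) (fun x => cRe (F x)) (cRe (f x))) ->
  (forall x, is_derive x (1 : R) (fun x => cIm (F x)) (cIm (f x))) ->
  primitive b F f.
Proof.
move=> b0 cr ci dr di; split.
  by split; [have [] := rFTC b0 cr dr|have [] := rFTC b0 ci di].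
move=> x /andP[x0 _]; apply: ceqP; rewrite ?cReD ?cImD /=.
  by have [] := rFTC x0 cr dr.
by have [] := rFTC x0 ci di.
Qed.

Lemma continuous_expsin (a c : R) : continuous (fun x : R => expR (a * x) * sin (c * x)).
Proof.
move=> x; apply: cvgM.
  by apply: (@continuous_comp _ _ _ (fun x : R => a * x) expR); [exact: mulrl_continuous|exact: continuous_expR].
by apply: (@continuous_comp _ _ _ (fun x : R => c * x) sin); [exact: mulrl_continuous|exact: continuous_sin].
Qed.

Lemma continuous_expcos (a c : R) : continuous (fun x : R => expR (a * x) * cos (c * x)).
Proof.
move=> x; apply: cvgM.
  by apply: (@continuous_comp _ _ _ (fun x : R => a * x) expR); [exact: mulrl_continuous|exact: continuous_expR].
by apply: (@continuous_comp _ _ _ (fun x : R => c * x) cos); [exact: mulrl_continuous|exact: continuous_cos].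
Qed.

Lemma cRe_cexpl (z : C) x : cRe (cexp (z * x%:C)%C) = expR (cRe z * x) * cos (cIm z * x).
Proof. by rewrite /cexp cReM cImM /= !mulr0 subr0 add0r. Qed.
Lemma cIm_cexpl (z : C) x : cIm (cexp (z * x%:C)%C) = expR (cRe z * x) * sin (cIm z * x).
Proof. by rewrite /cexp cReM cImM /= !mulr0 subr0 add0r. Qed.

Lemma primitive_cexp (b : R) (z : C) : 0 <= b ->
  primitive b (fun x => cexp (z * x%:C)%C) (fun x => z * cexp (z * x%:C)%C).
Proof.
move=> b0; apply: primitive_smooth => //.
- under eq_fun do rewrite cReM cRe_cexpl cIm_cexpl.
  move=> x; apply: cvgB; apply: cvgMr; [exact: continuous_expcos|exact: continuous_expsin].
- under eq_fun do rewrite cImM cRe_cexpl cIm_cexpl.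
  move=> x; apply: cvgD; apply: cvgMr; [exact: continuous_expsin|exact: continuous_expcos].
- move=> x; under eq_fun do rewrite cRe_cexpl; rewrite cReM cRe_cexpl cIm_cexpl.
  apply: is_derive_eq; rewrite /GRing.scale /=; ring.
- move=> x; under eq_fun do rewrite cIm_cexpl; rewrite cImM cRe_cexpl cIm_cexpl.
  apply: is_derive_eq; rewrite /GRing.scale /=; ring.
Qed.

Lemma primitive_poly (b : R) (p : {poly R}) : 0 <= b ->
  primitive b (fun x => (p.[x])%:C%C) (fun x => (p^`().[x])%:C%C).
Proof.
move=> b0; apply: primitive_smooth => //=.
- by move=> x; exact: continuous_horner.
- by move=> x; exact: cst_continuous.
- by move=> x; exact: is_derive_poly.
- by move=> x; exact: is_derive_cst.
Qed.

End cexp.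

(** * Fixed points of contractions *)

Section contraction.
Variable R : realType.
Local Notation C := R[i].
Implicit Types (c d x : R).

Lemma halving_gt c d : 0 < d -> exists k : nat, c / 2 ^+ k < d.
Proof.
move=> d0; exists (Num.bound (`|c / d|)).
rewrite ltr_pdivrMr ?exprn_gt0// mulrC -ltr_pdivrMr//.
rewrite (le_lt_trans (ler_norm _))// (lt_trans (archi_boundP (normr_ge0 _)))//.
by rewrite -natrX ltr_nat ltn_expl.
Qed.

Lemma halving_le x c d : (forall k : nat, x <= c + d / 2 ^+ k) -> x <= c.
Proof.
move=> h; rewrite leNgt; apply/negP => cx.
have [k hk] : exists k : nat, d / 2 ^+ k < x - c by apply: halving_gt; rewrite subr_gt0.
by have := h k; lra.
Qed.

Lemma halving_cvg (a : nat -> R) c :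
  (forall k p, `|a (k + p)%N - a k| <= c / 2 ^+ k) ->
  exists l, forall k, `|a k - l| <= c / 2 ^+ k.
Proof.
move=> h; pose E := [set a k - c / 2 ^+ k | k in [set: nat]].
have ubE p : ubound E (a p + c / 2 ^+ p).
  move=> _ [k _ <-]; have [kp|pk] := leqP k p.
    have := h k (p - k)%N; rewrite subnKC// ler_norml => /andP[h1 _].
    have := h p 0%N; rewrite addn0 subrr normr0 => h2; lra.
  have := h p (k - p)%N; rewrite subnKC 1?ltnW// ler_norml => /andP[_ h1].
  have := h k 0%N; rewrite addn0 subrr normr0 => h2; lra.
exists (sup E) => k; rewrite ler_distlC; apply/andP; split.
  by apply: ub_le_sup; [exists (a 0%N + c / 2 ^+ 0); exact: ubE|exists k].
by apply: ge_sup; [exists (a 0%N - c / 2 ^+ 0), 0%N|exact: ubE].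
Qed.

(** Iterating e -> e / 2 + d leads from any bound e0 to its fixed point 2 d. *)
Lemma halving_stable (T : Type) (D : T -> Prop) (f : T -> R) d e0 :
  (forall t, D t -> f t <= e0) ->
  (forall e, (forall t, D t -> f t <= e) -> forall t, D t -> f t <= e / 2 + d) ->
  forall t, D t -> f t <= 2 * d.
Proof.
move=> h0 hS t Dt; apply: (@halving_le _ _ (e0 - 2 * d)) => k.
have : forall t, D t -> f t <= 2 * d + (e0 - 2 * d) / 2 ^+ k; last exact.
elim: k => [|k ih]; first by move=> u Du; rewrite expr0 divr1 (le_trans (h0 u Du))//; lra.
move=> u Du; rewrite (le_trans (hS _ ih u Du))// exprS invfM.
lra.
Qed.

(** Banach's fixed-point theorem for the supremum norm over [0, 1]. The iterates
    are Cauchy at rate 2^-k at every point, uniformly, so their limit can be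
    taken pointwise. *)
Lemma sup_norm_fixpoint (J : Type) (B : (J -> R -> C) -> Prop)
    (Phi : (J -> R -> C) -> J -> R -> C) (M : R) :
  B (fun _ _ => 0) -> (forall U, B U -> B (Phi U)) ->
  (forall U V e, B U -> B V ->
     (forall j x, 0 <= x <= 1 -> normc (U j x - V j x) <= e) ->
     forall j x, 0 <= x <= 1 -> normc (Phi U j x - Phi V j x) <= e / 2) ->
  (forall j x, 0 <= x <= 1 -> normc (Phi (fun _ _ => 0) j x) <= M) ->
  (forall (S : nat -> J -> R -> C) U, (forall k, B (S k)) ->
     (forall k j x, 0 <= x <= 1 -> normc (S k j x - U j x) <= (4 * M) / 2 ^+ k) -> B U) ->
  exists U, [/\ B U, (forall j x, 0 <= x <= 1 -> U j x = Phi U j x) &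
    (forall j x, 0 <= x <= 1 -> normc (U j x) <= 4 * M)].
Proof.
move=> B0 BPhi contr M0 Bcl.
pose S k := iter k Phi (fun _ _ => 0).
have BS k : B (S k) by elim: k => //= k; exact: BPhi.
have S1 k j x : 0 <= x <= 1 -> normc (S k.+1 j x - S k j x) <= M / 2 ^+ k.
  elim: k j x => [j x xb|k ih j x xb]; first by rewrite subr0 expr0 divr1; exact: M0.
  have := contr _ _ _ (BS k.+1) (BS k) ih j x xb.
  by rewrite exprS invfM => /le_trans; apply; lra.
have Mx x : 0 <= x <= 1 -> forall j : J, 0 <= M.
  by move=> xb j; exact: le_trans (normc_ge0 _) (M0 j x xb).
have Sp k p j x : 0 <= x <= 1 -> normc (S (k + p)%N j x - S k j x) <= 2 * M / 2 ^+ k.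
  move=> xb; suff : normc (S (k + p)%N j x - S k j x) <= 2 * M / 2 ^+ k - 2 * M / 2 ^+ (k + p).
    move=> /le_trans; apply; rewrite gerBl mulr_ge0 ?invr_ge0 ?exprn_ge0// mulr_ge0//.
    exact: Mx xb j.
  elim: p => [|p ih]; first by rewrite addn0 !subrr ComplexField.Normc.normc0.
  rewrite addnS -(subrK (S (k + p)%N j x) (S (k + p).+1 j x)) -addrA.
  rewrite (le_trans (normcD _ _))// (le_trans (lerD (S1 _ _ _ xb) ih))//.
  by rewrite exprS invfM; lra.
have lim j x : {l : C | 0 <= x <= 1 -> forall k, normc (S k j x - l) <= 4 * M / 2 ^+ k}.
  apply: cid; case: (boolP (0 <= x <= 1)) => xb; last by exists 0.
  have [a ha] := @halving_cvg (fun k => cRe (S k j x)) (2 * M) (fun k p =>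
     le_trans (eq_ind _ (fun z => `|z| <= _) (normc_Re (S (k + p)%N j x - S k j x)) _
       (etrans (cReD _ _) (congr1 (fun t => _ + t) (cReN _)))) (Sp k p j x xb)).
  have [b hb] := @halving_cvg (fun k => cIm (S k j x)) (2 * M) (fun k p =>
     le_trans (eq_ind _ (fun z => `|z| <= _) (normc_Im (S (k + p)%N j x - S k j x)) _
       (etrans (cImD _ _) (congr1 (fun t => _ + t) (cImN _)))) (Sp k p j x xb)).
  exists (a +i* b)%C => _ k; rewrite (le_trans (normc_le_ReIm _))//.
  rewrite cReD cReN cImD cImN /= (le_trans (lerD (ha k) (hb k)))//; lra.
pose U j x := sval (lim j x).
have HU k j x : 0 <= x <= 1 -> normc (S k j x - U j x) <= 4 * M / 2 ^+ k.
  by move=> xb; exact: (svalP (lim j x)).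
have BU : B U by exact: Bcl BS HU.
exists U; split=> // j x xb.
  apply/eqP; rewrite -subr_eq0; apply/eqP/ComplexField.Normc.eq0_normc/eqP.
  rewrite eq_le normc_ge0 andbT; apply: (@halving_le _ _ (4 * M)) => k.
  rewrite add0r -(subrK (S k.+1 j x) (U j x)) -addrA (le_trans (normcD _ _))//.
  rewrite normc_distC.
  have h1 := HU k.+1 j x xb.
  have h2 := contr _ _ _ (BS k) BU (HU k) j x xb.
  rewrite (le_trans (lerD h1 h2))// exprS invfM; lra.
by have := HU 0%N j x xb; rewrite sub0r normc_opp expr0 divr1.
Qed.

End contraction.

(** * Linear systems with prescribed boundary behaviour *)

Lemma cconjM (R : realType) (z w : R[i]) : ((z * w)^*)%C = (z^*)%C * (w^*)%C.
Proof. exact: rmorphM. Qed.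

Section fredholm.
Variable R : realType.
Local Notation C := R[i].
Local Notation mu := (@lebesgue_measure R).
Local Notation RT := (measurableTypeR R).
Local Notation rintegrable D k := (mu.-integrable D (EFin \o k)).
Local Notation mI := (measurable_itv `[0 : R, 1]).

Variables (J : finType) (r th e : J -> C) (A : J -> J -> R -> C) (k : R -> R) (eps : R).
Implicit Types (U V : J -> R -> C) (j : J) (x : R) (M : R).

Definition admissible U := (forall j, cmeas `[0, 1] (U j)) /\
  exists M, forall j x, 0 <= x <= 1 -> normc (U j x) <= M.

Definition rhs U j s : C := \sum_j' A j j' s * U j' s.

(** The solution of y' = r y + g, for g = rhs U, with boundary values
    y 0 = th I and y 1 = exp r (1 + th) I, where I is the integral of
    exp (- r s) g s over [0, 1]. It is periodic for th = exp r / (1 - exp r).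
    When r = 0 periodicity amounts to I = 0, and th = - 1/2 makes the formula
    symmetric under x -> 1 - x. *)
Definition green U j x : C :=
  (1 + th j) * cint `[0, x] (fun s => cexp (r j * (x - s)%:C)%C * rhs U j s) +
  th j * cint `[x, 1] (fun s => cexp (r j * (x - s)%:C)%C * rhs U j s).

Definition Phi U j x : C := e j + 'i%C * eps%:C%C * green U j x.

Hypothesis Ameas : forall j j', cmeas `[0, 1] (A j j').
Hypothesis kint : rintegrable `[0, 1] k.
Hypothesis Ak : forall j j' x, 0 <= x <= 1 -> normc (A j j' x) <= k x.

Lemma rhs_bound U j x M : 0 <= x <= 1 -> (forall j x, 0 <= x <= 1 -> normc (U j x) <= M) ->
  normc (rhs U j x) <= #|J|%:R * M * k x.
Proof.
move=> xb UM; rewrite (le_trans (ler_normc_sum _ _ _))//.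
rewrite mulrAC -mulrA mulr_natl -sumr_const ler_sum// => j' _.
by rewrite ComplexField.Normc.normcM ler_pM ?normc_ge0 ?Ak ?UM.
Qed.

Lemma rhs_meas U j : (forall j, cmeas `[0, 1] (U j)) -> cmeas `[0, 1] (rhs U j).
Proof. by move=> mU; apply: cmeas_sum => j' _; exact: cmeasM. Qed.

Lemma rhs_integrable U j : admissible U -> cintegrable `[0, 1] (rhs U j).
Proof.
move=> [mU [M UM]]; apply: (@cmeas_dom _ _ _ (fun x => #|J|%:R * M * k x)) => //.
- exact: rhs_meas.
- exact: (rintegrableZ (#|J|%:R * M) mI kint).
- by move=> x; rewrite /= in_itv/= => xb; exact: rhs_bound.
Qed.

Lemma cexp_shift_meas (z : C) x : cmeas `[0, 1] (fun s => cexp (z * (x - s)%:C)%C).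
Proof.
rewrite (_ : (fun s => _) = (fun s => cexp (z * x%:C)%C * cexp (- z * s%:C)%C)); last first.
  apply/funext => s; rewrite -cexpD; congr cexp.
  by rewrite rmorphB mulrBr mulNr.
exact: cmeasZ (cmeas_primitive ler01 (primitive_cexp _ ler01)).
Qed.

Lemma cexp_bounded (z : C) : exists M, forall x, -1 <= x <= 1 ->
  normc (cexp (z * x%:C)%C) <= M.
Proof.
exists (expR `|cRe z|) => x xb; rewrite normc_cexp ler_expR cReM /= mulr0 subr0.
by rewrite (le_trans (ler_norm _))// normrM ler_piMr// ler_norml.
Qed.

Lemma kernel_integrable U j x : admissible U -> 0 <= x <= 1 ->
  cintegrable `[0, 1] (fun s => cexp (r j * (x - s)%:C)%C * rhs U j s).
Proof.
move=> aU xb; have /andP[x0 x1] := xb; have [M HM] := cexp_bounded (r j).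
apply: (cintegrableM_bounded (M := M)) => //.
- exact: cexp_shift_meas.
- by move=> s; rewrite /= in_itv/= => sb; apply: HM; lra.
- exact: rhs_integrable.
Qed.

Lemma kernel0_integrable U j : admissible U ->
  cintegrable `[0, 1] (fun s => cexp (- r j * s%:C)%C * rhs U j s).
Proof.
move=> aU; have [M HM] := cexp_bounded (- r j).
apply: (cintegrableM_bounded (M := M)) => //.
- exact: cmeas_primitive ler01 (primitive_cexp _ ler01).
- by move=> s; rewrite /= in_itv/= => sb; apply: HM; lra.
- exact: rhs_integrable.
Qed.

Lemma greenE U j x : admissible U -> 0 <= x <= 1 ->
  green U j x = cexp (r j * x%:C)%C * (cint `[0, x] (fun s => cexp (- r j * s%:C)%C * rhs U j s)
     + th j * cint `[0, 1] (fun s => cexp (- r j * s%:C)%C * rhs U j s)).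
Proof.
move=> aU xb; have /andP[x0 x1] := xb.
have ci : cintegrable `[0, 1] (fun s => cexp (- r j * s%:C)%C * rhs U j s).
  exact: kernel0_integrable.
have E (a b : R) : 0 <= a -> b <= 1 ->
    cint `[a, b] (fun s => cexp (r j * (x - s)%:C)%C * rhs U j s) =
    cexp (r j * x%:C)%C * cint `[a, b] (fun s => cexp (- r j * s%:C)%C * rhs U j s).
  move=> a0 b1; rewrite -cintZ//; last exact: cintegrable_sub ci.
  apply: eq_cint => s _; rewrite mulrA -cexpD; congr (cexp _ * _).
  by rewrite rmorphB mulrBr mulNr.
by rewrite /green !E// (cint_split x0 x1 ci); ring.
Qed.

(** By [greenE], exp (r x) can be factored out of the kernel, leaving a
    primitive: this is variation of constants. *)
Lemma Phi_primitive U j : admissible U ->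
  primitive 1 (Phi U j) (fun x => r j * (Phi U j x - e j) + 'i%C * eps%:C%C * rhs U j x).
Proof.
move=> aU; pose g s := cexp (- r j * s%:C)%C * rhs U j s.
have ci : cintegrable `[0, 1] g.
  exact: kernel0_integrable.
pose G x := cint `[0, x] g + th j * cint `[0, 1] g.
have pG : primitive 1 G g.
  split=> // x xb; rewrite /G cint_set1 add0r addrC; congr (_ + _).
have [M HM] := cexp_bounded (r j).
have pEG := @primitiveM _ 1 (fun x => cexp (r j * x%:C)%C) (fun x => r j * cexp (r j * x%:C)%C)
  G g (normc (r j) * M) ler01 _ (primitive_cexp _ ler01) pG.
have {}pEG := primitiveZ ('i%C * eps%:C%C) (pEG _).
apply: (eq_primitive ler01 _ _ (primitiveD (primitive_cst 1 (e j)) (pEG _))).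
- by move=> x xb; rewrite /Phi greenE.
- move=> x xb; rewrite /Phi greenE// add0r -/g -/(G x).
  rewrite (_ : cexp (r j * x%:C)%C * g x = rhs U j x); last first.
    by rewrite /g mulrA mulNr mulrC [cexp _ * cexp _]mulrC cexpNK mulr1.
  by rewrite /G; ring.
- move=> x xb; rewrite ComplexField.Normc.normcM ler_wpM2l ?normc_ge0//.
  apply: HM; lra.
Qed.

Lemma Phi_left U j : admissible U ->
  Phi U j 0 = e j + 'i%C * eps%:C%C * (th j * cint `[0, 1] (fun s => cexp (- r j * s%:C)%C * rhs U j s)).
Proof.
by move=> aU; rewrite /Phi greenE ?lexx ?ler01// cint_set1 add0r mulr0 cexp0 mul1r.
Qed.

Lemma Phi_right U j : admissible U ->
  Phi U j 1 = e j + 'i%C * eps%:C%C *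
    (cexp (r j) * (1 + th j) * cint `[0, 1] (fun s => cexp (- r j * s%:C)%C * rhs U j s)).
Proof.
by move=> aU; rewrite /Phi greenE ?lexx ?ler01// mulr1; ring.
Qed.

(* The exponentials alone may be huge: K1 and K2 bound the Green kernel on both
   sides of the diagonal. *)
Hypothesis K1 : forall j t, 0 <= t <= 1 -> normc ((1 + th j) * cexp (r j * t%:C)%C) <= 2.
Hypothesis K2 : forall j t, 0 <= t <= 1 -> normc (th j * cexp (- r j * t%:C)%C) <= 2.

Let K := \int[mu]_(x in `[0, 1]) k x.

Lemma green_bound U j x M : admissible U ->
  (forall j x, 0 <= x <= 1 -> normc (U j x) <= M) -> 0 <= x <= 1 ->
  normc (green U j x) <= 4 * #|J|%:R * M * K.
Proof.
move=> aU UM xb; have /andP[x0 x1] := xb; have ki := kernel_integrable j aU xb.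
have kk : rintegrable `[0, 1] (fun s => 2 * (#|J|%:R * M) * k s).
  exact: (rintegrableZ (2 * (#|J|%:R * M)) mI kint).
rewrite /green -!cintZ//; try exact: cintegrable_sub ki.
have i1 : cintegrable `[0, x] (fun s => (1 + th j) * (cexp (r j * (x - s)%:C)%C * rhs U j s)).
  by apply: cintegrableZ => //; exact: cintegrable_sub ki.
have i2 : cintegrable `[x, 1] (fun s => th j * (cexp (r j * (x - s)%:C)%C * rhs U j s)).
  by apply: cintegrableZ => //; exact: cintegrable_sub ki.
have k1 := rintegrable_sub (lexx 0) x1 kk; have k2 := rintegrable_sub x0 (lexx 1) kk.
rewrite (le_trans (normcD _ _))//.
have h1 := cint_bound (measurable_itv `[0, x]) i1 k1 _.
have h2 := cint_bound (measurable_itv `[x, 1]) i2 k2 _.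
rewrite (le_trans (lerD (h1 _) (h2 _)))//.
- move=> s; rewrite /= in_itv/= => /andP[s0 sx]; rewrite mulrA ComplexField.Normc.normcM.
  rewrite -mulrA ler_pM ?normc_ge0//; last by apply: rhs_bound => //; rewrite s0 (le_trans sx).
  by apply: K1; lra.
- move=> s; rewrite /= in_itv/= => /andP[xs s1]; rewrite mulrA ComplexField.Normc.normcM.
  rewrite -mulrA ler_pM ?normc_ge0//; last by apply: rhs_bound => //; rewrite s1 (le_trans x0).
  rewrite -opprB rmorphN mulrN -mulNr.
  by apply: K2; lra.
rewrite -mulrDr -(Rintegral_split x0 x1 kk) RintegralZl// -/K; lra.
Qed.

Lemma Phi_bound U j x M : admissible U ->
  (forall j x, 0 <= x <= 1 -> normc (U j x) <= M) -> 0 <= x <= 1 ->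
  normc (Phi U j x - e j) <= `|eps| * (4 * #|J|%:R * K) * M.
Proof.
move=> aU UM xb; rewrite /Phi addrAC subrr add0r !ComplexField.Normc.normcM normc_i mul1r.
rewrite normc_real -mulrA ler_wpM2l//.
by rewrite (le_trans (green_bound _ aU UM xb))//; lra.
Qed.

Lemma admissibleB U V : admissible U -> admissible V -> admissible (fun j x => U j x - V j x).
Proof.
move=> [mU [M UM]] [mV [N VN]]; split.
  by move=> j; apply: cmeasD => //; exact: cmeasN.
exists (M + N) => j x xb; rewrite (le_trans (normcB _ _))// lerD ?UM ?VN//.
Qed.

Lemma PhiB U V j x : admissible U -> admissible V -> 0 <= x <= 1 ->
  Phi U j x - Phi V j x = Phi (fun j x => U j x - V j x) j x - e j.
Proof.
move=> aU aV xb; have /andP[x0 x1] := xb.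
have iU := kernel_integrable j aU xb; have iV := kernel_integrable j aV xb.
have rE s : rhs (fun j x => U j x - V j x) j s = rhs U j s - rhs V j s.
  by rewrite /rhs -sumrB; apply: eq_bigr => j' _; rewrite mulrBr.
rewrite /Phi /green.
under [in RHS]eq_cint do rewrite rE mulrBr.
under [X in _ = _ + _ * (_ + _ * X) - _]eq_cint do rewrite rE mulrBr.
rewrite !cintB//; try exact: cintegrable_sub iU; try exact: cintegrable_sub iV.
ring.
Qed.

Lemma Phi_admissible U : admissible U -> admissible (Phi U).
Proof.
move=> aU; split=> [j|].
  exact: cmeas_primitive ler01 (Phi_primitive j aU).
have [_ [M UM]] := aU.
exists (\sum_j normc (e j) + `|eps| * (4 * #|J|%:R * K) * M) => j x xb.
rewrite -(subrK (e j) (Phi U j x)) addrC (le_trans (normcD _ _))// lerD//.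
  by rewrite (bigD1 j)//= lerDl sumr_ge0// => i _; exact: normc_ge0.
exact: Phi_bound.
Qed.

Lemma admissible0 : admissible (fun _ _ => 0).
Proof.
split=> [j|]; first exact: cmeas_cst.
by exists 0 => j x _; rewrite ComplexField.Normc.normc0.
Qed.

Variable inv : J -> J.
Hypothesis r_inv : forall j, r (inv j) = - (r j)^*%C.
Hypothesis th_inv : forall j, th (inv j) = - 1 - (th j)^*%C.
Hypothesis e_inv : forall j, e (inv j) = (e j)^*%C.
Hypothesis inv_inj : injective inv.
Hypothesis A_inv : forall j j',
  {ae mu, forall x, `[0, 1]%classic x -> A (inv j) (inv j') x = (A j j' (1 - x))^*%C}.

(** PT-symmetry in the variables of the system: reflection of [0, 1], complex
    conjugation, and a permutation of the components. *)
Definition PTsym U := forall j x, 0 <= x <= 1 -> U (inv j) x = (U j (1 - x))^*%C.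

Lemma rhs_PT U j : PTsym U ->
  {ae mu, forall x, `[0, 1]%classic x -> rhs U (inv j) x = (rhs U j (1 - x))^*%C}.
Proof.
move=> sU; apply: ae_imp (ae_forall_fin (A_inv j)) => x h xb; rewrite /rhs rmorph_sum (reindex_inj inv_inj) /=.
by apply: eq_bigr => j' _; rewrite h// sU ?rmorphM.
Qed.

Lemma reflect_kernel U j x (a b : R) : admissible U -> PTsym U -> 0 <= x <= 1 -> 0 <= a -> b <= 1 ->
  cint `[a, b] (fun s => cexp (r (inv j) * (x - s)%:C)%C * rhs U (inv j) s) =
  ((cint `[1 - b, 1 - a] (fun s => cexp (r j * (1 - x - s)%:C)%C * rhs U j s))^*)%C.
Proof.
move=> aU sU xb a0 b1.
have xb' : 0 <= 1 - x <= 1 by lra.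
have ki := kernel_integrable j aU xb'.
have ki' := kernel_integrable (inv j) aU xb.
have kab : cintegrable `[1 - b, 1 - a] (fun s => cexp (r j * (1 - x - s)%:C)%C * rhs U j s).
  by apply: cintegrable_sub ki; lra.
have [kr <-] := cint_refl 1 kab.
have e1 : 1 - (1 - a) = a by lra.
have e2 : 1 - (1 - b) = b by lra.
rewrite e1 e2 in kr *; rewrite -cintJ; [|exact: measurable_itv|exact: kr].
apply: ae_eq_cint => //.
- by apply: cintegrable_meas; exact: cintegrable_sub ki'.
- by apply: cmeasJ; exact: cintegrable_meas.
apply: ae_imp (rhs_PT j sU) => s h; rewrite /= in_itv/= => /andP[as_ sb].
rewrite h; last by rewrite /= in_itv/= (le_trans a0 as_) (le_trans sb b1).
rewrite cconjM cexpJ; congr (cexp _ * _).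
rewrite r_inv cconjM mulNr -mulrN -rmorphN /=; congr (_ * _).
by apply: ceqP => /=; lra.
Qed.

(** The reflection exchanges the integrals to the left and to the right of x,
    and th_inv exchanges their weights 1 + th and th. *)
Lemma Phi_PT U : admissible U -> PTsym U -> PTsym (Phi U).
Proof.
move=> aU sU j x xb; have /andP[x0 x1] := xb.
rewrite /Phi /green (reflect_kernel j aU sU xb (lexx 0) x1) (reflect_kernel j aU sU xb x0 (lexx 1)) e_inv th_inv subrr subr0.
have ci z : complex_conjc__canonical__GRing_RMorphism R z = (z^*)%C by [].
rewrite !(rmorphD, rmorphM, rmorph1) !ci.
have -> : ('i%C^*)%C = - 'i%C :> C by apply: ceqP; rewrite /= ?oppr0.
have -> : ((eps%:C)^*)%C = eps%:C%C :> C by apply: ceqP; rewrite /= ?oppr0.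
ring.
Qed.

(** The fixed point is sought among the functions with the symmetry, which is
    preserved by Phi and by uniform limits. *)
Theorem fredholm_solution E : (forall j, normc (e j) <= E) ->
  `|eps| * (4 * #|J|%:R * K) <= 1 / 2 ->
  exists U, [/\ admissible U, PTsym U,
    forall j x, 0 <= x <= 1 -> U j x = Phi U j x &
    forall j x, 0 <= x <= 1 -> normc (U j x) <= 4 * E].
Proof.
move=> eE small.
have : exists U, [/\ admissible U /\ PTsym U,
    forall j x, 0 <= x <= 1 -> U j x = Phi U j x &
    forall j x, 0 <= x <= 1 -> normc (U j x) <= 4 * E].
  apply: (sup_norm_fixpoint (B := fun U => admissible U /\ PTsym U)).
  - split; first exact: admissible0.
    by move=> j x _; rewrite rmorph0.
  - by move=> U [aU sU]; split; [exact: Phi_admissible|exact: Phi_PT].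
  - move=> U V d [aU _] [aV _] UV j x xb; rewrite PhiB//.
    have d0 : 0 <= d := le_trans (normc_ge0 _) (UV j x xb).
    rewrite (le_trans (Phi_bound j (admissibleB aU aV) UV xb))//.
    by rewrite mulrC ler_wpM2l//; lra.
  - move=> j x xb; have h := @Phi_bound (fun _ _ => 0) j x 0 admissible0 _ xb.
    rewrite -(subrK (e j) (Phi _ j x)) (le_trans (normcD _ _))//.
    rewrite -[leRHS]add0r lerD// (le_trans (h _)) ?mulr0// => *.
    by rewrite ComplexField.Normc.normc0.
  - move=> S U BS SU; split; [split|].
    + have hc (u : nat -> R) (l : R) (c : R) : (forall q, `|u q - l| <= c / 2 ^+ q) -> u @ \oo --> l.
        move=> h; apply/cvgrPdist_lt => d d0.
        have [q hq] := halving_gt c d0; near=> p.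
        rewrite distrC (le_lt_trans (h p))// (le_lt_trans _ hq)//.
        have c0 : 0 <= c by have := le_trans (normr_ge0 _) (h 0%N); rewrite expr0 divr1.
        rewrite ler_wpM2l// lef_pV2 ?posrE ?exprn_gt0// ler_weXn2l//; first lra.
        by near: p; exists q.
      move=> j; split.
        apply: (@measurable_fun_cvg _ _ _ _ (fun q x => cRe (S q j x))).
          by move=> q; have [[/(_ j)[]]] := BS q.
        move=> x; rewrite /= in_itv/= => xb; apply: (hc _ _ (4 * E)) => q.
        by rewrite -cReN -cReD (le_trans (normc_Re _))// SU.
      apply: (@measurable_fun_cvg _ _ _ _ (fun q x => cIm (S q j x))).
        by move=> q; have [[/(_ j)[]]] := BS q.
      move=> x; rewrite /= in_itv/= => xb; apply: (hc _ _ (4 * E)) => q.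
      by rewrite -cImN -cImD (le_trans (normc_Im _))// SU.
    + have [[_ [M SM]] _] := BS 0%N; exists (M + 4 * E) => j x xb.
      rewrite -(subrK (S 0%N j x) (U j x)) addrC (le_trans (normcD _ _))// lerD ?SM//.
      by have := SU 0%N j x xb; rewrite expr0 divr1 normc_distC.
    + move=> j x xb; apply/eqP; rewrite -subr_eq0; apply/eqP/ComplexField.Normc.eq0_normc/eqP.
      rewrite eq_le normc_ge0 andbT; apply: (@halving_le _ _ _ (8 * E)) => q.
      have xb' : 0 <= 1 - x <= 1 by lra.
      have h1 := SU q (inv j) x xb; have h2 := SU q j _ xb'.
      rewrite add0r -(subrK (S q (inv j) x) (U (inv j) x)) -addrA (le_trans (normcD _ _))//.
      rewrite normc_distC; have [_ /(_ j x xb) eS] := BS q.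
      rewrite eS in h1 *; rewrite -rmorphB normc_conj (le_trans (lerD h1 h2))//; lra.
by case=> U [[? ?] ? ?]; exists U.
Unshelve. all: end_near. Qed.

End fredholm.

Lemma greenB_coef (R : realType) (J : finType) (r th : J -> R[i]) (A A' A'' : J -> J -> R -> R[i])
    (k : R -> R) (U : J -> R -> R[i]) (j : J) (x : R) :
  (@lebesgue_measure R).-integrable `[0, 1] (EFin \o k) ->
  (forall j j', cmeas `[0, 1] (A j j')) ->
  (forall j j' x, 0 <= x <= 1 -> normc (A j j' x) <= k x) ->
  (forall j j', cmeas `[0, 1] (A' j j')) ->
  (forall j j' x, 0 <= x <= 1 -> normc (A' j j' x) <= k x) ->
  (forall j j' x, A'' j j' x = A j j' x - A' j j' x) ->
  admissible U -> 0 <= x <= 1 ->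
  green r th A'' U j x = green r th A U j x - green r th A' U j x.
Proof.
move=> ki mA bA mA' bA' e aU xb; have /andP[x0 x1] := xb.
have i1 := kernel_integrable r mA ki bA j aU xb.
have i2 := kernel_integrable r mA' ki bA' j aU xb.
have rE s : rhs A'' U j s = rhs A U j s - rhs A' U j s.
  by rewrite /rhs -sumrB; apply: eq_bigr => j' _; rewrite e mulrBl.
have E (a b : R) : 0 <= a -> b <= 1 ->
    cint `[a, b] (fun s => cexp (r j * (x - s)%:C)%C * rhs A'' U j s) =
    cint `[a, b] (fun s => cexp (r j * (x - s)%:C)%C * rhs A U j s) -
    cint `[a, b] (fun s => cexp (r j * (x - s)%:C)%C * rhs A' U j s).
  move=> a0 b1; rewrite -cintB//; [|exact: cintegrable_sub i1|exact: cintegrable_sub i2].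
  by apply: eq_cint => s _; rewrite rE mulrBr.
by rewrite /green !E//; ring.
Qed.

(** * Roots of unity *)

Section roots_of_unity.
Variable R : realType.
Local Notation C := R[i].

Lemma exists_prim_root n : (0 < n)%N -> exists w : C, n.-primitive_root w.
Proof.
move=> n0; pose p : {poly C} := 'X^n - 1.
have [rs Dp] := closed_field_poly_normal p.
have lp : lead_coef p = 1 by apply/eqP; rewrite -monicE monicXnsubC.
rewrite lp scale1r in Dp.
have sz : size rs = n.
  by apply: succn_inj; rewrite -(size_prod_XsubC rs id) -Dp size_XnsubC.
have urs : uniq rs.
  rewrite -separable.separable_prod_XsubC -Dp; apply: cyclotomic.separable_Xn_sub_1.
  by rewrite pnatr_eq0 -lt0n.
have ars : all n.-unity_root rs.
  apply/allP => z; rewrite -root_prod_XsubC -Dp /root hornerD hornerN hornerXn hornerC.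
  by rewrite subr_eq0 unity_rootE.
have /hasP[w _ hw] : has n.-primitive_root rs by apply: cyclic.has_prim_root => //; rewrite sz.
by exists w.
Qed.

Variables (n : nat) (w : C).
Hypotheses (n0 : (0 < n)%N) (prim : n.-primitive_root w).

Lemma normc_root l : normc (w ^+ l) = 1.
Proof.
suff h : normc w = 1 by rewrite normcX h expr1n.
have := congr1 (@normc R) (prim_expr_order prim); rewrite normcX ComplexField.Normc.normc1 => /eqP.
by rewrite pexpr_eq1 ?normc_ge0// => /eqP.
Qed.

Lemma conj_root l : (l <= n)%N -> ((w ^+ l)^*)%C = w ^+ (n - l).
Proof.
move=> ln; have w0 : w ^+ l != 0.
  by apply/eqP => h; have := normc_root l; rewrite h ComplexField.Normc.normc0 => /eqP; rewrite eq_sym oner_eq0.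
apply: (mulfI w0); rewrite -exprD subnKC// (prim_expr_order prim).
have := normc_sqr (w ^+ l); rewrite normc_root expr1n => e.
by case: (w ^+ l) e => a b /= e; apply: ceqP => /=; nra.
Qed.

(** A real root of unity is 1 or -1, and -1 has no odd power equal to 1. *)
Lemma root_nonreal l : odd n -> (0 < l < n)%N -> cIm (w ^+ l) != 0.
Proof.
move=> oddn /andP[l0 ln]; apply/eqP => im0.
have := normc_sqr (w ^+ l); rewrite normc_root expr1n im0 expr0n addr0 => /esym/eqP.
have re : w ^+ l = (cRe (w ^+ l))%:C%C by apply: ceqP.
rewrite sqrf_eq1 => /orP[] /eqP e.
  have /eqP : w ^+ l = 1 by rewrite re e.
  by rewrite -(prim_order_dvd prim) => /(dvdn_leq l0); rewrite leqNgt ln.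
have h : w ^+ l = -1 by rewrite re e rmorphN.
have : (w ^+ l) ^+ n = 1 by rewrite -exprM mulnC exprM (prim_expr_order prim) expr1n.
rewrite h -signr_odd oddn expr1 => /eqP.
by rewrite eq_sym -subr_eq0 opprK -mulr2n pnatr_eq0.
Qed.

Lemma root_power_sum p : (0 < p < n)%N -> \sum_(l < n) (w ^+ l) ^+ p = 0.
Proof.
move=> /andP[p0 pn]; have wp : w ^+ p != 1.
  by rewrite -(prim_order_dvd prim); apply/negP => /(dvdn_leq p0); rewrite leqNgt pn.
have : (w ^+ p - 1) * (\sum_(l < n) (w ^+ l) ^+ p) = 0.
  rewrite (eq_bigr (fun l : 'I_n => (w ^+ p) ^+ l)); last by move=> l _; rewrite -!exprM mulnC.
  by rewrite -subrX1 -exprM mulnC exprM (prim_expr_order prim) expr1n subrr.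
by move/eqP; rewrite mulf_eq0 subr_eq0 (negbTE wp) => /eqP.
Qed.

Lemma root_power_sumn : \sum_(l < n) (w ^+ l) ^+ n = n%:R.
Proof.
rewrite (eq_bigr (fun=> 1)) ?sumr_const ?card_ord// => l _.
by rewrite -exprM mulnC exprM (prim_expr_order prim) expr1n.
Qed.

End roots_of_unity.

(** * Sign changes of the characteristic polynomial *)

Section determinants.
Variable R : realType.

Lemma prod_close (I : Type) (s : seq I) (f : I -> R) (e : R) : 0 < e ->
  exists2 d, 0 < d & forall g : I -> R, (forall i, `|g i - f i| <= d) ->
    `|\prod_(i <- s) g i - \prod_(i <- s) f i| < e.
Proof.
elim: s e => [|a s ih] e e0.
  by exists 1 => // g _; rewrite !big_nil subrr normr0.
pose F := \prod_(i <- s) f i.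
have fa : 0 < `|f a| + 1 by rewrite ltr_wpDl.
have Fp : 0 < `|F| + 1 by rewrite ltr_wpDl.
have [|d d0 hd] := ih (Num.min 1 (e / 2 / (`|f a| + 1))).
  by rewrite lt_min ltr01 !divr_gt0.
exists (Num.min d (e / 2 / (`|F| + 1))); first by rewrite lt_min d0 !divr_gt0.
move=> g hg; rewrite !big_cons -/F.
have /hd : forall i, `|g i - f i| <= d by move=> i; have := hg i; rewrite le_min => /andP[].
rewrite -/F lt_min => /andP[h1 h2].
have := hg a; rewrite le_min => /andP[_ h3].
set G := \prod_(i <- s) g i in h1 h2 *.
have -> : g a * G - f a * F = (g a - f a) * G + f a * (G - F) by ring.
rewrite (le_lt_trans (ler_normD _ _))// !normrM.
have GF : `|G| <= `|F| + 1.
  by rewrite -(subrK F G) addrC (le_trans (ler_normD _ _))// lerD2l ltW.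
rewrite (_ : e = e / 2 + e / 2); last lra.
apply: ler_ltD.
  rewrite (le_trans (ler_pM _ _ h3 GF))// divfK// gt_eqF//.
rewrite (le_lt_trans (y := (`|f a| + 1) * `|G - F|))//; last by rewrite mulrC -ltr_pdivlMr.
by rewrite ler_wpM2r// lerDl.
Qed.

Lemma sum_close (I K : Type) (s : seq K) (F : (I -> R) -> K -> R) f (e : R) :
  (forall (k : K) (e' : R), 0 < e' -> exists2 d, 0 < d & forall g, (forall i, `|g i - f i| <= d) ->
     `|F g k - F f k| < e') -> 0 < e ->
  exists2 d, 0 < d & forall g : I -> R, (forall i, `|g i - f i| <= d) ->
    `|\sum_(k <- s) F g k - \sum_(k <- s) F f k| < e.
Proof.
move=> h; elim: s e => [|a s ih] e e0.
  by exists 1 => // g _; rewrite !big_nil subrr normr0.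
have e2 : 0 < e / 2 by rewrite divr_gt0.
have [d1 d10 h1] := ih _ e2; have [d2 d20 h2] := h a _ e2.
exists (Num.min d1 d2); first by rewrite lt_min d10.
move=> g hg; rewrite !big_cons opprD addrACA (le_lt_trans (ler_normD _ _))//.
rewrite (_ : e = e / 2 + e / 2); last lra.
by apply: ltrD; [apply: h2|apply: h1] => i; have := hg i; rewrite le_min => /andP[].
Qed.

Lemma det_close m (Y : 'M[R]_m) (e : R) : 0 < e ->
  exists2 d, 0 < d & forall X : 'M[R]_m, (forall i j, `|X i j - Y i j| <= d) ->
    `|\det X - \det Y| < e.
Proof.
move=> e0; pose F (f : 'I_m * 'I_m -> R) (s : {perm 'I_m}) : R := (-1) ^+ s * \prod_(i <- enum 'I_m) f (i, s i).
have [|d d0 hd] := @sum_close _ _ (enum {: {perm 'I_m}}) F (fun p => Y p.1 p.2) e _ e0.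
  move=> s e' e'0.
  have [d d0 hd] := prod_close (enum 'I_m) (fun i => Y i (s i)) e'0.
  exists d => // g hg; rewrite /F -mulrBr normrM normr_sign mul1r.
  by apply: (hd (fun i => g (i, s i))) => i; exact: hg (i, s i).
exists d => // X hX.
have E (Z : 'M[R]_m) : \det Z = \sum_(s <- enum {: {perm 'I_m}}) F (fun p => Z p.1 p.2) s.
  by rewrite /determinant big_enum; apply: eq_bigr => s _; rewrite /F big_enum.
by rewrite !E; apply: hd => p; exact: hX.
Qed.

Lemma horner_char_poly m (A : 'M[R]_m) s : (char_poly A).[s] = \det (s%:M - A).
Proof.
rewrite -[LHS]/(horner_eval s (char_poly A)) -det_map_mx; congr (\det _).
apply/matrixP => i j; rewrite !mxE /= /horner_eval hornerD hornerN hornerMn hornerX hornerC.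
by [].
Qed.

(** An eigenvalue of odd multiplicity is a sign change of the characteristic
    polynomial, which a small perturbation cannot remove. *)
Lemma odd_eigenvalue_persists m (A : 'M[R]_m) (mu : R) :
  odd (mup mu (char_poly A)) ->
  exists2 eta, 0 < eta & forall N : R -> 'M[R]_m,
    (forall s i j, `|s - mu| <= 1 -> `|N s i j - (s%:M - A) i j| <= eta) ->
    (exists L, forall s s' i j, `|s - mu| <= 1 -> `|s' - mu| <= 1 ->
       `|N s i j - N s' i j| <= L * `|s - s'|) ->
    exists2 s, `|s - mu| <= 1 & \det (N s) = 0.
Proof.
move=> oddm; have p0 : char_poly A != 0 by rewrite monic_neq0 ?char_poly_monic.
have [k [q]] := multiplicity_XsubC (char_poly A) mu; rewrite p0 /= => nr pE.
have oddk : odd k.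
  by move: oddm; rewrite pE mupMr// mup_XsubCX eqxx.
have q0 : q.[mu] != 0 by [].
have [d /andP[d0 d1] hd] : exists2 d, 0 < d <= 1 & forall s, `|s - mu| <= d -> 0 < q.[s] * q.[mu].
  have cq : {for mu, continuous (horner q)} by exact: continuous_horner.
  have /cvgrPdist_lt /(_ _ (_ : 0 < `|q.[mu]|)) := cq; rewrite normr_gt0 => /(_ q0).
  move=> /nbhs_ballP[d /= d0 hd].
  exists (Num.min 1 (d / 2)); first by rewrite lt_min ltr01 divr_gt0//= ge_min lexx.
  move=> s; rewrite le_min => /andP[_ hs].
  have : `|q.[mu] - q.[s]| < `|q.[mu]|.
    by apply: hd; rewrite /ball /= distrC (le_lt_trans hs)// ltr_pdivrMr// ltr_pMr// ltr1n.
  have [qp|qn|qe] := ltgtP 0 q.[mu]; last by rewrite -qe eqxx in q0.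
    by rewrite (gtr0_norm qp) ltr_norml => /andP[_ h]; rewrite mulr_gt0//; lra.
  by rewrite (ltr0_norm qn) ltr_norml => /andP[h _]; rewrite nmulr_lgt0//; lra.
(* Multiplying by q.[mu] fixes the direction of the sign change. *)
have dE s : \det (s%:M - A) = q.[s] * (s - mu) ^+ k.
  by rewrite -horner_char_poly pE hornerM horner_exp hornerXsubC.
have P1 : 0 < \det ((mu + d)%:M - A) * q.[mu].
  rewrite dE mulrAC (_ : mu + d - mu = d); last lra.
  by rewrite mulr_gt0 ?exprn_gt0// hd//; rewrite (_ : mu + d - mu = d) ?gtr0_norm//; lra.
have P2 : \det ((mu - d)%:M - A) * q.[mu] < 0.
  rewrite dE mulrAC (_ : mu - d - mu = - d); last lra.
  rewrite exprNn -signr_odd oddk expr1 mulN1r mulrN oppr_lt0.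
  by rewrite mulr_gt0 ?exprn_gt0// hd//; rewrite (_ : mu - d - mu = - d) ?normrN ?gtr0_norm//; lra.
have nq : 0 < `|q.[mu]| by rewrite normr_gt0.
have [|eta1 eta10 he1] := @det_close m ((mu + d)%:M - A) (`|\det ((mu + d)%:M - A)|).
  by rewrite normr_gt0; apply: contraTneq P1 => ->; rewrite mul0r ltxx.
have [|eta2 eta20 he2] := @det_close m ((mu - d)%:M - A) (`|\det ((mu - d)%:M - A)|).
  by rewrite normr_gt0; apply: contraTneq P2 => ->; rewrite mul0r ltxx.
exists (Num.min eta1 eta2); first by rewrite lt_min eta10.
move=> N hN [L hL].
have sgn (z x y : R) : `|x - y| < `|y| -> (0 < y * z -> 0 < x * z) /\ (y * z < 0 -> x * z < 0).
  have [yp|yn|<-] := ltgtP 0 y; last by rewrite normr0 normr_lt0.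
    rewrite (gtr0_norm yp) ltr_norml => /andP[h _].
    have xp : 0 < x by lra.
    by rewrite !pmulr_rgt0// !pmulr_rlt0.
  rewrite (ltr0_norm yn) ltr_norml => /andP[_ h].
  have xp : x < 0 by lra.
  by rewrite !nmulr_rgt0// !nmulr_rlt0.
have b1 : `|mu + d - mu| <= 1 by rewrite (_ : mu + d - mu = d) ?gtr0_norm//; lra.
have b2 : `|mu - d - mu| <= 1 by rewrite (_ : mu - d - mu = - d) ?normrN ?gtr0_norm//; lra.
have /(sgn q.[mu])[/(_ P1) Q1 _] : `|\det (N (mu + d)) - \det ((mu + d)%:M - A)| < `|\det ((mu + d)%:M - A)|.
  by apply: he1 => i j; have := hN _ i j b1; rewrite le_min => /andP[].
have /(sgn q.[mu])[_ /(_ P2) Q2] : `|\det (N (mu - d)) - \det ((mu - d)%:M - A)| < `|\det ((mu - d)%:M - A)|.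
  by apply: he2 => i j; have := hN _ i j b2; rewrite le_min => /andP[].
pose f s := \det (N s) * q.[mu].
have cf : {within `[mu - d, mu + d], continuous f}.
  apply/continuous_within_itvP; first lra.
  have near_s s : `|s - mu| <= 1 -> forall e, 0 < e ->
      exists2 r, 0 < r & forall t, `|t - mu| <= 1 -> `|t - s| < r -> `|f s - f t| < e.
    move=> sb e e0.
    have [|r r0 hr] := @det_close m (N s) (e / `|q.[mu]|); first by rewrite divr_gt0.
    have L1 : 0 < `|L| + 1 by rewrite ltr_wpDl.
    exists (r / (`|L| + 1)); first by rewrite divr_gt0.
    move=> t tb ts; rewrite distrC /f -mulrBl normrM -ltr_pdivlMr//; apply: hr => i j.
    rewrite (le_trans (hL _ _ _ _ tb sb))//.
    rewrite (le_trans (y := (`|L| + 1) * `|t - s|))//.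
      by rewrite ler_wpM2r// (le_trans (ler_norm _))// lerDl.
    by rewrite mulrC -ler_pdivlMr// ltW.
  have inb t : mu - d <= t <= mu + d -> `|t - mu| <= 1 by rewrite ler_norml => /andP[? ?]; lra.
  split.
  - move=> s; rewrite in_itv/= => /andP[s1 s2].
    apply/cvgrPdist_lt => e e0; have [|r r0 hr] := near_s s _ e e0; first by apply: inb; lra.
    exists (Num.min r (Num.min (s - (mu - d)) (mu + d - s))).
      by rewrite /= !lt_min r0 /=; apply/andP; split; lra.
    move=> t; rewrite /= !lt_min => /and3P[t1 t2 t3]; apply: hr; last by rewrite distrC.
    by apply: inb; move: t2 t3; rewrite !ltr_norml; lra.
  - apply/cvgrPdist_lt => e e0; have [|r r0 hr] := near_s (mu - d) _ e e0; first by apply: inb; lra.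
    near=> t; have t1 : mu - d < t by near: t; exact: nbhs_right_gt.
    have t2 : t < mu - d + r by near: t; apply: nbhs_right_lt; rewrite ltrDl.
    have t3 : t < mu + d by near: t; apply: nbhs_right_lt; lra.
    by apply: hr; [apply: inb; lra|rewrite ltr_norml; lra].
  - apply/cvgrPdist_lt => e e0; have [|r r0 hr] := near_s (mu + d) _ e e0; first by apply: inb; lra.
    near=> t; have t1 : t < mu + d by near: t; exact: nbhs_left_lt.
    have t2 : mu + d - r < t by near: t; apply: nbhs_left_gt; rewrite ltrBlDr ltrDl.
    have t3 : mu - d < t by near: t; apply: nbhs_left_gt; lra.
    by apply: hr; [apply: inb; lra|rewrite ltr_norml; lra].
have [||s] := @IVT R f (mu - d) (mu + d) 0 _ cf; first lra.
  by rewrite ge_min le_max (ltW Q2) (ltW Q1) orbT.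
rewrite in_itv/= => /andP[s1 s2] /eqP; rewrite mulf_eq0 (negbTE q0) orbF => /eqP fs.
by exists s => //; rewrite ler_norml; lra.
Unshelve. all: end_near. Qed.

Lemma mup_map_real m (A : 'M[R]_m) (mu : R) :
  mup (mu%:C)%C (char_poly (map_mx (fun x : R => x%:C%C) A)) = mup mu (char_poly A).
Proof.
have p0 : char_poly A != 0 by rewrite monic_neq0 ?char_poly_monic.
have [k [q]] := multiplicity_XsubC (char_poly A) mu; rewrite p0 /= => nr pE.
have -> : char_poly (map_mx (fun x : R => x%:C%C) A) = map_poly (real_complex R) (char_poly A).
  by rewrite map_char_poly.
rewrite pE mupMr// mup_XsubCX eqxx rmorphM rmorphXn /= map_polyXsubC.
by rewrite mupMr ?fmorph_root// mup_XsubCX eqxx.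
Qed.

End determinants.

(** * Extension by zero of smooth functions *)

Section cut.
Variable R : realType.
Local Notation C := R[i].
Local Notation mu := (@lebesgue_measure R).
Local Notation RT := (measurableTypeR R).
Local Notation rintegrable D k := (mu.-integrable D (EFin \o k)).
Implicit Types (f g h z : R -> R) (x a b : R).

Lemma Rint_le (D : set RT) f g : measurable D -> rintegrable D f -> rintegrable D g ->
  (forall x, D x -> f x <= g x) -> \int[mu]_(x in D) f x <= \int[mu]_(x in D) g x.
Proof. by move=> *; apply: le_Rintegral. Qed.

Lemma sum_Rint_disjoint (M : nat) (u v : 'I_M -> R) h :
  trivIset setT (fun i => `]u i, v i[%classic) -> rintegrable setT h -> (forall x, 0 <= h x) ->
  \sum_i \int[mu]_(x in `]u i, v i[) h x <= \int[mu]_x h x.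
Proof.
move=> tI ih h0.
have ii i : rintegrable setT (h \_ `]u i, v i[).
  rewrite -restrict_EFin; apply/(integrable_mkcond (mu := mu) (D := `]u i, v i[)) => //.
  exact: integrableS ih.
under eq_bigr do rewrite Rintegral_mkcond.
rewrite -Rintegral_sum//; apply: Rint_le => //; first exact: rintegrable_sum.
move=> x _; have [[i xi]|nx] := pselect (exists i, `]u i, v i[%classic x).
  rewrite (bigD1 i)//= big1 ?addr0; last first.
    move=> j ji; rewrite patchE memNset// => xj.
    have /trivIsetP/(_ i j I I) := tI; rewrite eq_sym => /(_ ji) /seteqP[+ _].
    by move/(_ x); exact.
  by rewrite patchE mem_set.
rewrite big1 ?h0// => i _; rewrite patchE memNset// => xi; apply: nx.
by exists i.
Qed.

Section primitive_on_line.
Variables (g : R -> R).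
Hypotheses (ig : rintegrable setT g) (ig2 : rintegrable setT (fun x => g x ^+ 2)).
Let F x := \int[mu]_(t in `]-oo, x]) g t.

Lemma line_increment u v : u <= v -> F v - F u = \int[mu]_(t in `]u, v[) g t.
Proof.
move=> uv; have iv : rintegrable `]-oo, v] g by exact: integrableS ig.
rewrite /F (Rintegral_itvB (a := -oo%O) (b := BRight v) iv)//.
rewrite -Rintegral_itv_bndo_bndc//; exact: integrableS ig.
Qed.

(** Since |g| <= t g^2 / 2 + 1 / (2 t) for every t > 0, the integral of g^2
    controls the increments: t small, and then the intervals short, gives absolute
    continuity. *)
Lemma line_increment_le u v t : u <= v -> 0 < t ->
  `|F v - F u| <= t / 2 * (\int[mu]_(x in `]u, v[) g x ^+ 2) + (v - u) / (2 * t).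
Proof.
move=> uv t0; rewrite line_increment//.
have i1 : rintegrable `]u, v[ g by exact: integrableS ig.
have i2 : rintegrable `]u, v[ (fun x => g x ^+ 2) by exact: integrableS ig2.
have i3 : rintegrable `]u, v[ (fun x => t / 2 * g x ^+ 2) by exact: (rintegrableZ (t / 2) _ i2).
have i4 : rintegrable `]u, v[ (fun=> (2 * t)^-1).
  by apply: (integrableS _ _ _ (rintegrable_cst u v (2 * t)^-1)) => //; exact: subset_itv_oo_cc.
rewrite (le_trans (le_normr_Rintegral _ i1))//.
rewrite (le_trans (y := \int[mu]_(x in `]u, v[) (t / 2 * g x ^+ 2 + (2 * t)^-1)))//.
  apply: Rint_le => //; [exact: integrable_norm|exact: rintegrableD|].
  move=> x _; have : 0 <= (t * `|g x| - 1) ^+ 2 by exact: sqr_ge0.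
  rewrite -(real_normK (num_real (g x))).
  have -> : t / 2 * `|g x| ^+ 2 + (2 * t)^-1 = `|g x| + (t * `|g x| - 1) ^+ 2 / (2 * t).
    by field; rewrite gt_eqF.
  by move=> h; rewrite lerDl divr_ge0// mulr_ge0// ltW.
rewrite RintegralD// RintegralZl// lerD2l Rintegral_cst//.
have -> : fine (mu `]u, v[) = v - u; last by rewrite mulrC.
apply: (etrans (congr1 fine (lebesgue_measure_itv `]u, v[))).
rewrite /= lte_fin; case: ltP => //= ba.
by apply/esym/eqP; rewrite subr_eq0 eq_le ba uv.
Qed.

Lemma line_loc_AC : loc_abs_continuous F.
Proof.
move=> a b e e0; set G := \int[mu]_x g x ^+ 2.
have G0 : 0 <= G by rewrite Rintegral_ge0// => x _; exact: sqr_ge0.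
pose t := e / (G + 1); have t0 : 0 < t by rewrite divr_gt0// ltr_wpDl.
exists (e * t); first by rewrite mulr_gt0.
move=> M u v huv tI hs.
rewrite (le_lt_trans (y := \sum_i (t / 2 * (\int[mu]_(x in `]u i, v i[) g x ^+ 2) + (v i - u i) / (2 * t))))//.
  by apply: ler_sum => i _; apply: line_increment_le => //; have [] := huv i.
rewrite big_split /= -mulr_sumr -mulr_suml.
have h1 := sum_Rint_disjoint tI ig2 (fun x => sqr_ge0 (g x)).
rewrite (le_lt_trans (y := t / 2 * G + (\sum_i (v i - u i)) / (2 * t)))//.
  by rewrite lerD2r ler_wpM2l// divr_ge0// ltW.
have tG : t * G <= e.
  by rewrite /t mulrAC ler_pdivrMr ?ltr_wpDl// ler_wpM2l ?ltW// ltrDl.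
have : (\sum_i (v i - u i)) / (2 * t) < e / 2.
  rewrite (_ : e / 2 = e * t / (2 * t)); last by field; rewrite gt_eqF.
  by rewrite ltr_pM2r// invr_gt0 mulr_gt0.
lra.
Qed.

Lemma line_continuous : continuous F.
Proof.
move=> x; apply/cvgrPdist_lt => e e0.
have [d d0 hd] := line_loc_AC (x - 1) (x + 1) e0.
exists (Num.min d 1); first by rewrite /= lt_min d0 ltr01.
move=> y /=; rewrite lt_min => /andP[xyd xy1].
have tI (a b : R) : trivIset setT (fun i : 'I_1 => `]a, b[%classic).
  by apply/trivIsetP => i j _ _; rewrite !ord1.
have [xy|yx] := leP x y.
  have := hd 1%N (fun=> x) (fun=> y) _ (tI x y); rewrite !big_ord1 distrC; apply.
    by move=> _; move: xy1; rewrite ltr_norml => ?; split; lra.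
  by rewrite -(ger0_norm (_ : 0 <= y - x)) ?subr_ge0// distrC.
have := hd 1%N (fun=> y) (fun=> x) _ (tI y x); rewrite !big_ord1; apply.
  by move=> _; move: xy1; rewrite ltr_norml => ?; split; lra.
by rewrite -(gtr0_norm (_ : 0 < x - y)) ?subr_gt0.
Qed.

Lemma line_derive x : continuous g -> derivable F x 1 /\ derive1 F x = g x.
Proof.
move=> cg; apply: (@continuous_FTC1 _ g -oo%O x (x + 1)) => //.
- by rewrite ltrDl.
- exact: integrableS ig.
- by rewrite ltNyr.
- exact: cg.
Qed.

Lemma line_derive_ae : {ae mu, forall x, derive1 F x = g x}.
Proof.
have h1 y : rintegrable `]-oo, y] g by exact: integrableS ig.
have h2 : locally_integrable [set: R] g.
  by apply: open_integrable_locally => //; exact: openT.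
by apply: ae_imp (FTC1Ny h1 h2) => x [].
Qed.

End primitive_on_line.

Definition cut (N : R) (T : zmodType) (f : R -> T) x : T := if 0 <= x <= N then f x else 0.

Lemma cut_restrict N f : cut N f = f \_ `[0, N].
Proof.
apply/funext => x; rewrite /cut patchE; case: ifP => xN.
  by rewrite mem_set//= in_itv.
by rewrite memNset//= in_itv/= xN.
Qed.

Lemma rintegrable_cut N f : rintegrable `[0, N] f -> rintegrable setT (cut N f).
Proof.
move=> fi; rewrite cut_restrict -restrict_EFin.
by apply/(integrable_mkcond (mu := mu) (D := `[0, N])).
Qed.

Lemma cut_sqr N f : (fun x => cut N f x ^+ 2) = cut N (fun x => f x ^+ 2).
Proof. by apply/funext => x; rewrite /cut; case: ifP => //; rewrite expr0n. Qed.

Lemma cut_line N z g : 0 <= N -> rintegrable `[0, N] g ->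
  (forall x, 0 <= x <= N -> z x = \int[mu]_(t in `[0, x]) g t) -> z N = 0 ->
  cut N z = (fun x => \int[mu]_(t in `]-oo, x]) cut N g t).
Proof.
move=> N0 ig hz zN; apply/funext => x.
rewrite (cut_restrict N g) -Rintegral_mkcondr /cut.
case: ifP => [/andP[x0 xN]|xN].
  rewrite hz ?x0//; congr Rintegral; apply/seteqP; split => t /=; rewrite !in_itv/=.
    by move=> /andP[t0 tx]; rewrite t0 tx (le_trans tx).
  by move=> [-> /andP[->]].
have [x0|x0] := ltP x 0.
  rewrite (_ : _ `&` _ = set0) ?Rintegral_set0//.
  by apply/seteqP; split => t //=; rewrite !in_itv/= => -[tx /andP[t0 _]]; lra.
have Nx : N <= x by move: xN; rewrite x0 /= => /negbT; rewrite -ltNge => /ltW.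
transitivity (z N); first by rewrite zN.
rewrite hz ?lexx ?N0//; congr Rintegral; apply/seteqP; split => t /=; rewrite !in_itv/=.
  by move=> /andP[t0 tx]; rewrite t0 tx (le_trans tx).
by move=> [_].
Qed.

(** As Y p vanishes at both ends of [0, N], its extension by zero is the
    primitive over the whole line of the extension of Y p.+1. *)
Lemma cut_smooth n N (Y : nat -> R -> R) : 0 <= N -> (0 < n)%N ->
  (forall p, (p < n)%N ->
    [/\ rintegrable `[0, N] (Y p.+1), rintegrable `[0, N] (fun x => Y p.+1 x ^+ 2),
        forall x, 0 <= x <= N -> Y p x = \int[mu]_(t in `[0, x]) Y p.+1 t & Y p N = 0]) ->
  [/\ smooth_loc_AC n (cut N (Y 0%N)),
      forall k, (k < n)%N -> derive1n k (cut N (Y 0%N)) = cut N (Y k) &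
      {ae mu, forall x, derive1n n (cut N (Y 0%N)) x = cut N (Y n) x}].
Proof.
move=> N0 n0 h.
have L p : (p < n)%N -> [/\ rintegrable setT (cut N (Y p.+1)),
    rintegrable setT (fun x => cut N (Y p.+1) x ^+ 2) &
    cut N (Y p) = (fun x => \int[mu]_(t in `]-oo, x]) cut N (Y p.+1) t)].
  move=> pn; have [h1 h2 h3 h4] := h p pn; split.
  - exact: rintegrable_cut.
  - by rewrite cut_sqr; exact: rintegrable_cut.
  - exact: cut_line.
have cont p : (p < n)%N -> continuous (cut N (Y p)).
  by move=> pn; have [i1 i2 ->] := L p pn; exact: line_continuous.
have D k : (k < n)%N -> derive1n k (cut N (Y 0%N)) = cut N (Y k).
  elim: k => [//|k ih] kn; rewrite derive1nS ih 1?ltnW//.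
  have [i1 i2 ->] := L k (ltnW kn); apply/funext => x.
  by have [] := line_derive i1 x (cont _ kn).
split=> //.
- split=> [k x kn|].
    have kn' : (k.+1 < n)%N by rewrite -(prednK n0) ltnS.
    rewrite D ?(ltnW kn')//; have [i1 i2 ->] := L k (ltnW kn').
    by have [] := line_derive i1 x (cont _ kn').
  have pn : (n.-1 < n)%N by rewrite prednK.
  by rewrite D//; have [i1 i2 ->] := L _ pn; exact: line_loc_AC.
- have pn : (n.-1 < n)%N by rewrite prednK.
  have [i1 i2 e] := L _ pn; rewrite (prednK n0) in i1 i2 e.
  rewrite -[in derive1n n](prednK n0) derive1nS D// e.
  exact: line_derive_ae.
Qed.

End cut.

(** * Products with a cutoff function *)

Section leibniz.
Variable R : realType.
Local Notation C := R[i].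
Local Notation mu := (@lebesgue_measure R).

(** The p-th derivative of chi (v 0), when v q is the q-th derivative of v 0. *)
Definition leibniz (chi : {poly R}) (v : nat -> R -> C) (p : nat) (x : R) : C :=
  \sum_(q < p.+1) ((chi^`(p - q).[x])%:C * v q x *+ 'C(p, q))%C.

(** Pascal's rule. *)
Lemma primitive_leibniz (N : R) (chi : {poly R}) (v : nat -> R -> C) p : 0 <= N ->
  (forall q, (q <= p)%N -> primitive N (v q) (v q.+1)) ->
  primitive N (leibniz chi v p) (leibniz chi v p.+1).
Proof.
move=> N0 hv.
pose T (a b : nat) x : C := ((chi^`(a).[x])%:C * v b x)%C.
have pT a b : (b <= p)%N -> primitive N (T a b) (fun x => T a.+1 b x + T a b.+1 x).
  move=> bp.
  have pp := primitive_poly (chi^`(a)) N0; have pp' := primitive_poly (chi^`(a.+1)) N0.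
  have [L hL] : exists L, forall x, 0 <= x <= N -> normc ((chi^`(a)^`().[x])%:C)%C <= L.
    by eexists => x xN; rewrite -derivnS; exact: (primitive_bounded pp' xN).
  exact: (primitiveM N0 hL pp (hv b bp)).
have pS := @primitive_sum _ N _ (index_enum 'I_p.+1) xpredT
  (fun (q : 'I_p.+1) x => ('C(p, q))%:R * T (p - q)%N q x)
  (fun (q : 'I_p.+1) x => ('C(p, q))%:R * (T (p - q).+1 q x + T (p - q)%N q.+1 x)) _.
apply: (eq_primitive N0 _ _ (pS _)).
- by move=> x _; apply: eq_bigr => q _; rewrite mulr_natl.
- move=> x _; under eq_bigr do rewrite mulrDr.
  rewrite big_split /=.
  have -> : leibniz chi v p.+1 x =
      T p.+1 0%N x + \sum_(q < p) 'C(p.+1, q.+1)%:R * T (p - q)%N q.+1 x + T 0%N p.+1 x.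
    rewrite /leibniz big_ord_recl big_ord_recr addrA; congr (_ + _ + _).
    - by apply: eq_bigr => q _; rewrite mulr_natl /= /bump /= !add1n subSS.
    - by rewrite /= /bump /= !add1n subSS subnn binn mulr1n.
  rewrite [X in X + _]big_ord_recl [X in _ + X]big_ord_recr /= bin0 binn subnn !mul1r.
  rewrite subn0 addrACA -!addrA; congr (_ + _); rewrite !addrA; congr (_ + _).
  rewrite -big_split /=; apply: eq_bigr => q _; rewrite /bump /= !add1n binS natrD mulrDl.
  by rewrite subnSK// addrC.
- by move=> q _; apply: primitiveZ; apply: pT; rewrite -ltnS.
Qed.

Lemma leibniz_vanish (chi : {poly R}) (v : nat -> R -> C) p (x : R) :
  (forall k, (k <= p)%N -> chi^`(k).[x] = 0) -> leibniz chi v p x = 0.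
Proof. by move=> h; rewrite /leibniz big1// => q _; rewrite h ?leq_subr// mul0r mul0rn. Qed.

(** Commuting the cutoff with a derivative leaves terms carrying at least one
    derivative of the cutoff. *)
Lemma leibniz_remainder (chi : {poly R}) (v : nat -> R -> C) p (x B V : R) : 0 <= B -> 0 <= V ->
  (forall k, (0 < k <= p)%N -> `|chi^`(k).[x]| <= B) ->
  (forall q, (q < p)%N -> normc (v q x) <= V) ->
  normc (leibniz chi v p x - (chi.[x])%:C%C * v p x) <= B * V * 2 ^+ p.
Proof.
move=> B0 V0 hB hV; rewrite /leibniz big_ord_recr /= subnn binn mulr1n addrK.
rewrite (le_trans (ler_normc_sum _ _ _))//.
have -> : (2 : R) ^+ p = \sum_(q < p.+1) ('C(p, q))%:R.
  by rewrite -natr_sum -natrX -[in LHS](addn1 1) Pascal; congr _%:R; apply: eq_bigr => q _; rewrite !exp1n !muln1.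
rewrite big_ord_recr /= mulrDr mulr_sumr -[leLHS]addr0 lerD//.
  apply: ler_sum => q _; rewrite -mulr_natr ComplexField.Normc.normcM.
  have -> : normc ('C(p, q))%:R = ('C(p, q))%:R :> R.
    by rewrite -(rmorph_nat (real_complex R)) normc_real ger0_norm.
  rewrite ler_wpM2r// ComplexField.Normc.normcM normc_real ler_pM ?normc_ge0//.
    by apply: hB; rewrite subn_gt0 ltn_ord leq_subr.
  exact: hV.
by rewrite !mulr_ge0.
Qed.

End leibniz.

Section cutoff_polynomial.
Variable R : realType.
Implicit Types (p q : {poly R}) (a c x : R).

Lemma derivn_root_power p a n k : (k < n)%N ->
  (exists q, p = q * ('X - a%:P) ^+ n) -> p^`(k).[a] = 0.
Proof.
move=> kn [q pE].
have [q' ->] : exists q', p^`(k) = q' * ('X - a%:P) ^+ (n - k).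
  elim: k kn => [|k ih] kn; first by exists q; rewrite subn0.
  have [q' e] := ih (ltnW kn); rewrite derivnS e.
  have -> : (n - k)%N = (n - k.+1).+1 by rewrite subnSK// ltnW.
  exists (q'^`() * ('X - a%:P) + q' *+ (n - k.+1).+1).
  rewrite derivM deriv_exp derivXsubC mul1r /= exprS; ring.
rewrite hornerM horner_exp hornerXsubC subrr expr0n.
by rewrite subn_eq0 leqNgt kn mulr0.
Qed.

Lemma derivn_comp_scale p c k :
  (p \Po (c *: 'X))^`(k) = c ^+ k *: (p^`(k) \Po (c *: 'X)).
Proof.
elim: k => [|k ih]; first by rewrite expr0 scale1r.
rewrite !derivnS ih derivZ deriv_comp derivZ derivX -scalerAr mulr1 scalerA.
by rewrite -exprSr.
Qed.

(** (t (1 - t))^n at t = x / N. It vanishes to order n at 0 and N, so that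
    extension by zero preserves n derivatives, and every derivative brings a
    factor 1 / N. *)
Definition cutoff n (N : R) : {poly R} := (('X * (1 - 'X)) ^+ n) \Po (N^-1 *: 'X).

Lemma derivn_cutoff n N k x :
  (cutoff n N)^`(k).[x] = N^-1 ^+ k * (('X * (1 - 'X)) ^+ n)^`(k).[N^-1 * x].
Proof. by rewrite /cutoff derivn_comp_scale hornerZ horner_comp hornerZ hornerX. Qed.

Lemma cutoff_left n N k : (k < n)%N -> (cutoff n N)^`(k).[0] = 0.
Proof.
move=> kn; rewrite derivn_cutoff mulr0 (@derivn_root_power _ 0 n) ?mulr0//.
by exists ((1 - 'X) ^+ n); rewrite exprMn subr0 mulrC.
Qed.

Lemma cutoff_right n N k : N != 0 -> (k < n)%N -> (cutoff n N)^`(k).[N] = 0.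
Proof.
move=> N0 kn; rewrite derivn_cutoff mulVf// (@derivn_root_power _ 1 n) ?mulr0//.
exists ((- 'X) ^+ n); rewrite -exprMn; congr (_ ^+ n).
by rewrite polyC1; ring.
Qed.

Lemma cutoff_middle n N x : 0 < N -> N / 4 <= x <= 3 * N / 4 ->
  (3 / 16) ^+ n <= (cutoff n N).[x].
Proof.
move=> N0 /andP[x1 x2].
have := derivn_cutoff n N 0 x; rewrite !derivn0 expr0 mul1r => ->.
rewrite horner_exp hornerM hornerX !hornerE.
set t := N^-1 * x.
have t1 : 1 / 4 <= t by rewrite /t (mulrC N^-1) ler_pdivlMr//; lra.
have t2 : t <= 3 / 4 by rewrite /t (mulrC N^-1) ler_pdivrMr//; lra.
have h : 3 / 16 <= t * (1 - t) by nra.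
by apply: lerXn2r; rewrite ?nnegrE//; lra.
Qed.

Lemma cutoff_deriv_bound n : exists2 B : R, 0 <= B &
  forall N k x, 1 <= N -> (0 < k <= n)%N -> 0 <= x <= N -> `|(cutoff n N)^`(k).[x]| <= B / N.
Proof.
pose b k := (('X * (1 - 'X)) ^+ n)^`(k) : {poly R}.
have bB k : exists2 B : R, 0 <= B & forall t, 0 <= t <= 1 -> `|(b k).[t]| <= B.
  have pb := primitive_poly (b k) ler01.
  have h t := primitive_bounded (x := t) pb.
  eexists; last by move=> t tb; have := h t tb; rewrite normc_real; exact.
  by apply: le_trans (normc_ge0 _) (h 0 _); rewrite lexx ler01.
have [B hB] : exists B : nat -> R, forall k, 0 <= B k /\ forall t, 0 <= t <= 1 -> `|(b k).[t]| <= B k.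
  exists (fun k => s2val (cid2 (bB k))) => k.
  by split; [exact: (s2valP (cid2 (bB k)))|exact: (s2valP' (cid2 (bB k)))].
exists (\sum_(k < n.+1) B k); first by apply: sumr_ge0 => k _; have [] := hB k.
move=> N k x N1 /andP[k0 kn] /andP[x0 xN]; have N0 : 0 < N by exact: lt_le_trans N1.
rewrite derivn_cutoff normrM normrX ger0_norm ?invr_ge0 ?(ltW N0)// mulrC.
apply: ler_pM => //; first by rewrite exprn_ge0// invr_ge0 (ltW N0).
  have [_ h] := hB k.
  rewrite (le_trans (h _ _))//.
    by rewrite mulr_ge0 ?invr_ge0 ?(ltW N0)//= mulrC ler_pdivrMr ?mul1r.
  have kn' : (k < n.+1)%N by [].
  rewrite (bigD1 (Ordinal kn'))//= lerDl sumr_ge0// => i _; by have [] := hB i.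
by rewrite -[leRHS]expr1 ler_wiXn2l ?invr_ge0 ?(ltW N0)// invf_le1.
Qed.

End cutoff_polynomial.

(** * Periodic extensions *)

Section periodic_extension.
Variable R : realType.
Local Notation C := R[i].
Local Notation mu := (@lebesgue_measure R).
Local Notation RT := (measurableTypeR R).
Local Notation rintegrable D k := (mu.-integrable D (EFin \o k)).
Implicit Types (f g F G : R -> C) (k : R -> R) (z : C).

Definition per (T : Type) (f : R -> T) (x : R) : T := f (x - (Num.floor x)%:~R).

Lemma perE (T : Type) (f : R -> T) (N : nat) x : N%:R <= x < N.+1%:R -> per f x = f (x - N%:R).
Proof.
move=> h; rewrite /per (_ : Num.floor x = N%:Z)//.
by apply: floor_def; rewrite -[(N%:Z + 1)%R]/((N + 1)%N%:Z) addn1.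
Qed.

Lemma per_nat (T : Type) (f : R -> T) (N : nat) : per f N%:R = f 0.
Proof. by rewrite (@perE _ f N) ?subrr// lexx ltr_nat ltnS/=. Qed.

Lemma per_in (T : Type) (f : R -> T) x : exists2 t, 0 <= t < 1 & per f x = f t.
Proof.
exists (x - (Num.floor x)%:~R) => //.
by rewrite subr_ge0 ge_floor /= ltrBlDl -[X in _ < _ + X]/(1%:~R) -intrD floorD1_gt.
Qed.

Lemma per_bounded f (M : R) x : (forall t, 0 <= t <= 1 -> normc (f t) <= M) -> normc (per f x) <= M.
Proof. by move=> h; have [t /andP[t0 /ltW t1] ->] := per_in f x; apply: h; rewrite t0. Qed.

Lemma rintegrable_co_cc (a b : R) k : a <= b -> rintegrable `[a, b[ k -> rintegrable `[a, b] k.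
Proof.
move=> ab ik; apply/integrableP; split.
  have := measurable_int mu ik => mk.
  apply/(emeasurable_fun_itv_bndo_bndcP (BLeft a) b (EFin \o k)) => //.
rewrite -integral_itv_bndo_bndc; first by have /integrableP[] := ik.
apply: measurableT_comp => //; exact: (measurable_int mu ik).
Qed.

Lemma rintegrable_cat (a b c : R) k : a <= b -> b <= c ->
  rintegrable `[a, b] k -> rintegrable `[b, c] k -> rintegrable `[a, c] k.
Proof.
move=> ab bc i1 i2.
have e : `[a, b] `|` `[b, c] = `[a, c]%classic.
  apply/seteqP; split => x /=; rewrite !in_itv/=.
    by move=> [/andP[h1 h2]|/andP[h1 h2]]; apply/andP; split; lra.
  by move=> /andP[h1 h2]; have [xb|xb] := leP x b; [left|right]; rewrite ?h1 ?h2 ?xb ?(ltW xb).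
have mk1 := rintegrable_meas i1; have mk2 := rintegrable_meas i2.
have mk : measurable_fun `[a, c] (k : RT -> R) by rewrite -e; exact/measurable_funU.
apply: (@rintegrable_dom _ _ _ (fun x => `|(k \_ `[a, b]) x| + `|(k \_ `[b, c]) x|)) => //.
  have r1 : rintegrable setT (k \_ `[a, b]).
    by rewrite -restrict_EFin; apply/(integrable_mkcond (mu := mu) (D := `[a, b])).
  have r2 : rintegrable setT (k \_ `[b, c]).
    by rewrite -restrict_EFin; apply/(integrable_mkcond (mu := mu) (D := `[b, c])).
  have r12 : rintegrable setT (fun x : R => `|(k \_ `[a, b]) x| + `|(k \_ `[b, c]) x|).
    by apply: rintegrableD => //; exact: integrable_norm.
  exact: integrableS r12.
move=> x; rewrite -e => -[xI|xI].
  by rewrite [in leRHS](patchE _ `[a, b]) mem_set// lerDl.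
by rewrite [X in _ + `|X|]patchE mem_set// lerDr.
Qed.

Lemma cintegrable_cat (a b c : R) f : a <= b -> b <= c ->
  cintegrable `[a, b] f -> cintegrable `[b, c] f -> cintegrable `[a, c] f.
Proof. by move=> ab bc [? ?] [? ?]; split; exact: (@rintegrable_cat a b c). Qed.

Lemma per_cell f (N : nat) : cintegrable `[0, 1] f ->
  cintegrable `[N%:R, N.+1%:R] (per f) /\
  forall x, N%:R <= x <= N.+1%:R -> cint `[N%:R, x] (per f) = cint `[0, x - N%:R] f.
Proof.
move=> fi; have [] := cint_shift N%:R fi; rewrite add0r nat1r => si _.
have sub : `[N%:R : R, N.+1%:R[%classic `<=` `[N%:R, N.+1%:R]%classic.
  by apply: subset_itvl; rewrite bnd_simp.
have eqc x : `[N%:R, N.+1%:R[%classic x -> per f x = f (x - N%:R).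
  by rewrite /= in_itv/=; exact: perE.
have ip : cintegrable `[N%:R, N.+1%:R] (per f).
  have [sr sc] : cintegrable `[N%:R, N.+1%:R[ (fun x => f (x - N%:R)) by exact: cintegrableS si.
  split; apply: rintegrable_co_cc; rewrite ?ler_nat//.
    by apply: eq_integrable sr => // x; rewrite inE => /eqc /= ->.
  by apply: eq_integrable sc => // x; rewrite inE => /eqc /= ->.
split=> // x /andP[x0 x1].
have [] := cint_shift N%:R (@cintegrable_sub _ 0 (x - N%:R) 0 1 f (lexx 0) _ fi); first lra.
rewrite add0r subrK => ii <-.
have ip' : cintegrable `[N%:R, x] (per f) by exact: cintegrable_sub ip.
apply: ae_eq_cint => //; [exact: cintegrable_meas|exact: cintegrable_meas|].
exists [set N.+1%:R]; split => //; first exact: lebesgue_measure_set1.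
move=> y /= ny; apply: contrapT => yN; apply: ny; rewrite in_itv/= => /andP[y0 y1].
apply: eqc; rewrite /= in_itv/= y0 lt_neqAle (le_trans y1 x1) andbT.
by apply/eqP => e; apply: yN.
Qed.

(** The pieces fit together at the integers because F 1 = F 0. *)
Lemma primitive_per F f (N : nat) : primitive 1 F f -> F 1 = F 0 ->
  primitive N%:R (per F) (per f).
Proof.
move=> [fi hF] F10; elim: N => [|N [iN hN]].
  split; first by have [h _] := per_cell 0 fi; apply: cintegrable_sub h => //; rewrite ler01.
  move=> x x0; have -> : x = 0 by apply/eqP; rewrite eq_le andbC.
  by rewrite cint_set1 addr0.
have [iS hS] := per_cell N fi.
have i : cintegrable `[0, N.+1%:R] (per f).
  by apply: cintegrable_cat iN iS => //; rewrite ler_nat.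
split=> // x /andP[x0 x1]; have [xN|/ltW Nx] := leP x N%:R; first by rewrite hN// x0.
rewrite (@cint_split _ 0 N%:R x)//; last exact: cintegrable_sub i.
rewrite addrA -hN ?lexx ?ler0n// per_nat hS ?Nx//.
rewrite -hF; last by rewrite subr_ge0 Nx lerBlDr addrC natr1.
move: x1; rewrite le_eqVlt => /orP[/eqP ->|x1]; last by apply: perE; rewrite Nx.
by rewrite per_nat -natr1 addrAC subrr add0r F10.
Qed.

End periodic_extension.

(** * The system for the amplitudes of a Bloch wave *)

Lemma cconjX (R : realType) (z : R[i]) k : ((z ^+ k)^*)%C = ((z^*)%C) ^+ k.
Proof. exact: rmorphXn. Qed.

Section L2_facts.
Variable R : realType.
Local Notation C := R[i].
Local Notation mu := (@lebesgue_measure R).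
Local Notation RT := (measurableTypeR R).
Local Notation rintegrable D k := (mu.-integrable D (EFin \o k)).

Lemma L2_meas (D : set R) (f : R -> C) : L2 D f -> cmeas D f.
Proof. by case=> mr mi _; split. Qed.

Lemma L2_sqr (D : set RT) (f : R -> C) : measurable D -> L2 D f ->
  rintegrable D (fun x => normc (f x) ^+ 2).
Proof.
move=> mD h; have mf := L2_meas h; have [_ _ fi] := h; apply/integrableP; split.
  apply/measurable_EFinP; exact: (measurable_funX 2 (cmeas_normc mf)).
rewrite (_ : (\int[_]_(x in _) _)%E = (\int[mu]_(x in D) (normc (f x) ^+ 2)%:E)%E)//.
by apply: eq_integral => x _ /=; rewrite ger0_norm ?sqr_ge0.
Qed.

Lemma L2_integrable (a b : R) (f : R -> C) : L2 `[a, b] f -> cintegrable `[a, b] f.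
Proof.
move=> h; apply: (@cmeas_dom _ _ _ (fun x => 1 + normc (f x) ^+ 2)) => //.
- exact: L2_meas h.
- apply: (rintegrableD (k := fun=> 1)) => //; first exact: rintegrable_cst.
  exact: L2_sqr.
- move=> x _; have : 0 <= (normc (f x) - 1 / 2) ^+ 2 by exact: sqr_ge0.
  by rewrite sqrrB expr2; lra.
Qed.

End L2_facts.

Section resolvent_kernel.
Variable R : realType.
Local Notation C := R[i].

Lemma conjD_half : ((- 2^-1 : C)^*)%C = - 2^-1.
Proof. by rewrite rmorphN fmorphV rmorph_nat. Qed.

(** The two branches of the periodic Green kernel of y' - z y are bounded
    uniformly once exp z is away from the unit circle, in whichever direction. *)
Lemma green_kernel_bound (z : C) (t : R) : 0 <= t <= 1 -> 1 <= `|cRe z| ->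
  normc ((1 + cexp z / (1 - cexp z)) * cexp (z * t%:C)%C) <= 2 /\
  normc (cexp z / (1 - cexp z) * cexp (- z * t%:C)%C) <= 2.
Proof.
move=> tb z1; have /andP[t0 t1] := tb.
set E := expR (cRe z).
have E0 : 0 < E by exact: expR_gt0.
have E2 : E <= 1 / 2 \/ 2 <= E.
  have [zp|zn] := lerP 0 (cRe z).
    right; rewrite ger0_norm// in z1; rewrite (le_trans _ (expR_ge1Dx _))//; lra.
  left; rewrite ltr0_norm// in z1.
  have := expR_ge1Dx (- cRe z); rewrite expRN => h.
  have : 2 <= E^-1 by rewrite (le_trans _ h)//; lra.
  by move=> h2; have := ler_wpM2l (ltW E0) h2; rewrite mulfV ?gt_eqF//; lra.
have lb : `|1 - E| <= normc (1 - cexp z).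
  rewrite ler_norml; apply/andP; split.
    have := normcD (1 - cexp z) (- 1); rewrite addrAC subrr add0r !normc_opp normc_cexp ComplexField.Normc.normc1 -/E.
    lra.
  have := normcD (1 - cexp z) (cexp z); rewrite subrK normc_cexp ComplexField.Normc.normc1 -/E.
  lra.
have npos : 0 < normc (1 - cexp z).
  apply: lt_le_trans lb; rewrite normr_gt0 subr_eq0; apply/eqP => e1; case: E2; rewrite -e1; lra.
have nz : 1 - cexp z != 0.
  by apply/eqP => e; move: npos; rewrite e ComplexField.Normc.normc0 ltxx.
have key (u : R) : 0 <= u <= 1 -> normc (cexp (z * u%:C)%C / (1 - cexp z)) <= 2.
  move=> /andP[u0 u1]; rewrite ComplexField.Normc.normcM ComplexField.Normc.normcV normc_cexp.
  rewrite (_ : cRe (z * u%:C)%C = cRe z * u); last by rewrite cReM /= mulr0 subr0.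
  rewrite ler_pdivrMr//.
  case: E2 => hE.
    have zn : cRe z <= 0 by rewrite -expR_le1 -/E; lra.
    have : expR (cRe z * u) <= 1 by rewrite expR_le1 mulr_le0_ge0.
    move: lb; rewrite ger0_norm; lra.
  have zp : 0 <= cRe z.
    by rewrite leNgt; apply/negP => h; have : E < 1; [rewrite expR_lt1|lra].
  have : expR (cRe z * u) <= E by rewrite ler_expR ler_piMr.
  move: lb; rewrite ler0_norm; lra.
split.
  rewrite (_ : 1 + _ = (1 - cexp z)^-1); last by field.
  by rewrite mulrC; exact: key.
rewrite mulrAC -cexpD (_ : z + - z * t%:C%C = z * (1 - t)%:C%C); last by rewrite rmorphB; ring.
by apply: key; lra.
Qed.

End resolvent_kernel.

Section system.
Variable R : realType.
Local Notation C := R[i].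
Local Notation mu := (@lebesgue_measure R).
Local Notation RT := (measurableTypeR R).
Local Notation rintegrable D k := (mu.-integrable D (EFin \o k)).

Variables (n m : nat) (P : nat -> R -> 'M[C]_m) (w : C).
Hypotheses (n2 : (2 < n)%N) (oddn : odd n) (prim : n.-primitive_root w).
Hypothesis hP : forall (k : nat) (i j : 'I_m), (2 <= k <= n)%N ->
  PT_periodic_L2 (fun x => P k x i j).

Let n0 : (0 < n)%N. Proof. by apply: ltn_trans n2. Qed.
Local Notation J := ('I_n * 'I_m)%type.
Definition ord00 : 'I_n := Ordinal n0.

Implicit Types (j : J) (a b : 'I_m) (kap s x S : R).

(** kap^(2 - n) times the sum of the P_k (kap w^l)^(n - k), that is, the
    lower-order terms applied to the mode exp (i kap w^l x), scaled so that P_2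
    is multiplied by a number of modulus 1. *)
Definition potential kap (l : 'I_n) a b x : C :=
  \sum_(2 <= k < n.+1) (w ^+ l) ^+ (n - k) * ((kap^-1 ^+ (k - 2))%:C)%C * P k x a b.

(** The matrix A of the system u' = rate u + (i / kap) A u that variation of
    constants yields for y^(q) = sum_l (i kap w^l)^q exp (i z x) u_l with
    z = kap - s / (n kap). The diagonal term comes from z - kap. *)
Definition coef kap s j j' x : C :=
  - (w ^+ j.1 / n%:R) * potential kap j'.1 j.2 j'.2 x + (s / n%:R)%:C%C * (j == j')%:R.

Definition rate kap j : C := 'i%C * kap%:C%C * (w ^+ j.1 - 1).

Definition theta kap j : C :=
  if j.1 == ord00 then - 2^-1 else cexp (rate kap j) / (1 - cexp (rate kap j)).

Definition source b j : C := (j == (ord00, b))%:R.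

(** Complex conjugation of the roots of unity, on indices. *)
Definition flip j : J := (Ordinal (ltn_pmod (n - j.1) n0), j.2).

Lemma w_flip j : w ^+ (flip j).1 = ((w ^+ j.1)^*)%C.
Proof. by rewrite /= (prim_expr_mod prim) (conj_root n0 prim)// ltnW. Qed.

Lemma flip_inj : injective flip.
Proof.
move=> [l a] [l' a'] h; have e1 : w ^+ (flip (l, a)).1 = w ^+ (flip (l', a')).1 by rewrite h.
move: e1; rewrite !w_flip /= => /(can_inj (@conjcK R)) /eqP.
rewrite (eq_prim_root_expr prim) !modn_small// => /eqP/val_inj ->.
by congr (_, _); case: h.
Qed.

Lemma flip_ord00 a : flip (ord00, a) = (ord00, a).
Proof. by congr (_, _); apply: val_inj; rewrite /= subn0 modnn. Qed.

Lemma rate_flip kap j : rate kap (flip j) = - ((rate kap j)^*)%C.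
Proof.
rewrite /rate w_flip !cconjM.
have -> : ('i%C^*)%C = - 'i%C :> C by apply: ceqP; rewrite /= ?oppr0.
have -> : ((kap%:C)^*)%C = kap%:C%C :> C by apply: ceqP; rewrite /= ?oppr0.
have -> : ((w ^+ j.1 - 1)^*)%C = ((w ^+ j.1)^*)%C - 1 :> C by rewrite rmorphB rmorph1.
ring.
Qed.

Lemma flip_eq00 j : ((flip j).1 == ord00) = (j.1 == ord00).
Proof.
case: j => l a; apply/eqP/eqP => /= [h|->]; last exact: (congr1 fst (flip_ord00 a)).
have : flip (l, a) = flip (ord00, a) by rewrite flip_ord00; congr (_, _).
by move/flip_inj => [].
Qed.

Lemma source_flip b j : source b (flip j) = ((source b j)^*)%C.
Proof. by rewrite /source -{1}(flip_ord00 b) (inj_eq flip_inj) rmorph_nat. Qed.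

Lemma rate_Re kap j : cRe (rate kap j) = - (kap * cIm (w ^+ j.1)).
Proof. by rewrite /rate !cReM !cImM cReD cImD /=; ring. Qed.

Lemma theta_flip kap j : (j.1 != ord00 -> cexp (rate kap j) != 1) ->
  theta kap (flip j) = - 1 - ((theta kap j)^*)%C.
Proof.
move=> h; rewrite /theta flip_eq00; case: ifP => [_|/negbT /h e1].
  by rewrite conjD_half; field.
rewrite rate_flip; set z := rate kap j in e1 *.
have -> : ((cexp z / (1 - cexp z))^*)%C = cexp (z^*)%C / (1 - cexp (z^*)%C).
  by rewrite -cexpJ rmorphM fmorphV rmorphB rmorph1.
have e2 : cexp (z^*)%C != 1.
  by rewrite -cexpJ; apply: contra e1 => /eqP h1; rewrite -(conjcK (cexp z)) h1 rmorph1.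
have e3 : cexp (- (z^*)%C) = (cexp (z^*)%C)^-1.
  by apply: (mulIf (cexp_neq0 (z^*)%C)); rewrite cexpNK mulVf// cexp_neq0.
rewrite e3; have := cexp_neq0 (z^*)%C; move: e2; set y := cexp _ => y1 y0.
have y2 : 1 - y != 0 by rewrite subr_eq0 eq_sym.
have y3 : 1 - y^-1 != 0 by rewrite subr_eq0 eq_sym invr_eq1.
field; do ?[apply/andP; split] => //; by rewrite subr_eq0.
Qed.

Lemma P_integrable k a b : (2 <= k <= n)%N -> cintegrable `[0, 1] (fun x => P k x a b).
Proof. by move=> kn; have [h _ _] := hP a b kn; exact: L2_integrable. Qed.

Lemma P_reflect k a b : (2 <= k <= n)%N ->
  {ae mu, forall x, P k (1 - x) a b = ((P k x a b)^*)%C}.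
Proof.
move=> kn; have [_ h1 h2] := hP a b kn.
have h3 := mpres_ae (mpres_refl 0) h1.
apply: ae_imp2 h3 h2 => x; rewrite sub0r addrC => -> ->//.
Qed.

Lemma potential_reflect kap (l l' : 'I_n) a b : w ^+ l' = ((w ^+ l)^*)%C ->
  {ae mu, forall x, potential kap l' a b x = ((potential kap l a b (1 - x))^*)%C}.
Proof.
move=> hl.
have : {ae mu, forall x, forall k : 'I_n.+1, (2 <= k)%N -> P k (1 - x) a b = ((P k x a b)^*)%C}.
  apply: ae_forall_fin => k; have [k2|k2] := leqP 2 k; last by apply: aeW.
  by apply: ae_imp (@P_reflect k a b _) => //; rewrite k2 -ltnS ltn_ord.
apply: ae_imp => x h; rewrite /potential rmorph_sum !big_nat /=.
apply: eq_bigr => k /andP[k2 kn]; rewrite (h (Ordinal kn) k2) /= hl !cconjM conjcK.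
have -> : ((kap^-1 ^+ (k - 2))%:C^*)%C = (kap^-1 ^+ (k - 2))%:C%C :> C by apply: ceqP; rewrite /= ?oppr0.
by rewrite (cconjX (w ^+ l)).
Qed.

Lemma coef_flip kap s j j' :
  {ae mu, forall x, `[0, 1]%classic x -> coef kap s (flip j) (flip j') x = ((coef kap s j j' (1 - x))^*)%C}.
Proof.
apply: ae_imp (@potential_reflect kap j'.1 (flip j').1 j.2 j'.2 (w_flip j')) => x h _.
rewrite /coef h w_flip (inj_eq flip_inj).
have -> (u v t : C) : ((u * v + t)^*)%C = (u^*)%C * (v^*)%C + (t^*)%C by rewrite rmorphD rmorphM.
congr (_ * _ + _).
  by rewrite rmorphN fmorph_div rmorph_nat.
rewrite cconjM rmorph_nat; congr (_ * _).
by apply: ceqP; rewrite /= ?oppr0.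
Qed.

Definition weight x : R := \sum_(k < n.+1 | (2 <= k)%N) \sum_a \sum_b normc (P k x a b).

Lemma weight_integrable : rintegrable `[0, 1] weight.
Proof.
apply: rintegrable_sum => // k k2; apply: rintegrable_sum => // a _; apply: rintegrable_sum => // b _.
by apply: cintegrable_normc => //; apply: P_integrable; rewrite k2 -ltnS ltn_ord.
Qed.

Lemma P_weight k a b x : (2 <= k <= n)%N -> normc (P k x a b) <= weight x.
Proof.
move=> /andP[k2 kn]; have kn' : (k < n.+1)%N by [].
have s0 (k' : nat) : 0 <= \sum_a \sum_b normc (P k' x a b).
  by apply: sumr_ge0 => ? _; apply: sumr_ge0 => ? _; exact: normc_ge0.
rewrite /weight (bigD1 (Ordinal kn'))//= (bigD1 a)//= (bigD1 b)//= -!addrA lerDl.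
by rewrite !addr_ge0// sumr_ge0// => *; rewrite ?sumr_ge0// => *; exact: normc_ge0.
Qed.

Lemma potential_bound kap l a b x : 1 <= `|kap| -> normc (potential kap l a b x) <= weight x.
Proof.
move=> k1; have e (F : nat -> R) : \sum_(2 <= k < n.+1) F k = \sum_(k < n.+1 | (2 <= k)%N) F k.
  by rewrite big_geq_mkord.
rewrite /potential /weight (le_trans (ler_normc_sum _ _ _))// e.
apply: ler_sum => k _; rewrite 2!ComplexField.Normc.normcM normcX (normc_root n0 prim) expr1n mul1r.
rewrite normc_real normrX normfV -[leRHS]mul1r ler_pM ?normc_ge0//.
  by rewrite exprn_ile1// invf_le1// (lt_le_trans ltr01).
rewrite (bigD1 a)//= (bigD1 b)//= -!addrA lerDl.
by rewrite !addr_ge0// sumr_ge0// => *; rewrite ?sumr_ge0// => *; exact: normc_ge0.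
Qed.

Lemma potential_integrable kap l a b : cintegrable `[0, 1] (potential kap l a b).
Proof.
rewrite (_ : potential kap l a b = (fun x => \sum_(k <- index_iota 2 n.+1 | k \in index_iota 2 n.+1)
   (w ^+ l) ^+ (n - k) * ((kap^-1 ^+ (k - 2))%:C)%C * P k x a b)); last first.
  by apply/funext => x; rewrite /potential big_seq.
apply: cintegrable_sum => // k; rewrite mem_index_iota => kn.
by apply: cintegrableZ => //; exact: P_integrable.
Qed.

Lemma coef_integrable kap s j j' : cintegrable `[0, 1] (coef kap s j j').
Proof.
apply: cintegrableD => //; last exact: cintegrable_cst.
by apply: cintegrableZ => //; exact: potential_integrable.
Qed.

Lemma normc_invn : normc (n%:R^-1 : C) = n%:R^-1.
Proof. by rewrite ComplexField.Normc.normcV -(rmorph_nat (real_complex R)) normc_real ger0_norm. Qed.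

Lemma n_ge1 : 1 <= n%:R :> R. Proof. by rewrite ler1n. Qed.

Lemma coef_bound kap s S j j' x : 1 <= `|kap| -> `|s| <= S -> normc (coef kap s j j' x) <= weight x + S.
Proof.
move=> k1 sS; rewrite (le_trans (normcD _ _))// lerD//.
  rewrite ComplexField.Normc.normcM normc_opp ComplexField.Normc.normcM (normc_root n0 prim) mul1r normc_invn.
  rewrite -[leRHS]mul1r ler_pM ?normc_ge0 ?invr_ge0//; last exact: potential_bound.
  by rewrite invf_le1 ?n_ge1// ltr0n.
rewrite ComplexField.Normc.normcM normc_real.
have h : `|s / n%:R| <= S.
  rewrite normrM normfV (ger0_norm (ler0n _ _)) ler_pdivrMr ?ltr0n// (le_trans sS)//.
  by rewrite ler_peMr ?n_ge1// (le_trans _ sS).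
case: eqP => _; first by rewrite ComplexField.Normc.normc1 mulr1.
by rewrite ComplexField.Normc.normc0 mulr0 (le_trans _ h).
Qed.

(** The modes of the non-real roots of unity grow or decay by a factor at least
    e over a period, which bounds their Green kernels. *)
Definition large kap := 1 <= `|kap| /\
  forall l : 'I_n, l != ord00 -> 1 <= `|kap * cIm (w ^+ l)|.

Lemma large_eventually : exists K : R, forall kap, K <= `|kap| -> large kap.
Proof.
exists (1 + \sum_(l < n) `|cIm (w ^+ l)|^-1) => kap h.
have s0 l : 0 <= `|cIm (w ^+ l)|^-1 :> R by rewrite invr_ge0.
split; first by rewrite (le_trans _ h)// lerDl sumr_ge0.
move=> l l0; have im0 : cIm (w ^+ l) != 0.
  apply: (root_nonreal n0 prim oddn); rewrite ltn_ord andbT lt0n.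
  by apply: contra l0 => /eqP l0; apply/eqP/val_inj.
rewrite normrM -ler_pdivrMr ?normr_gt0// div1r (le_trans _ h)//.
by rewrite (bigD1 l)//= addrCA lerDl addr_ge0// sumr_ge0.
Qed.

Lemma rate_ord00 kap a : rate kap (ord00, a) = 0.
Proof. by rewrite /rate expr0 subrr mulr0. Qed.

Lemma large_rate kap j : large kap -> j.1 != ord00 -> 1 <= `|cRe (rate kap j)|.
Proof. by move=> [_ h] /h; rewrite rate_Re normrN. Qed.

Lemma theta_bounds kap j t : large kap -> 0 <= t <= 1 ->
  normc ((1 + theta kap j) * cexp (rate kap j * t%:C)%C) <= 2 /\
  normc (theta kap j * cexp (- rate kap j * t%:C)%C) <= 2.
Proof.
move=> hk tb; rewrite /theta; case: ifP => [/eqP j0|/negbT j0]; last first.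
  exact: green_kernel_bound tb (large_rate hk j0).
have -> : rate kap j = 0 by case: j j0 => l a /= ->; exact: rate_ord00.
rewrite oppr0 !mul0r cexp0 !mulr1 normc_opp.
have -> : (1 - 2^-1 : C) = 2^-1 by field.
have h : normc (2^-1 : C) <= 2.
  by rewrite ComplexField.Normc.normcV -(rmorph_nat (real_complex R)) normc_real ger0_norm//; lra.
by [].
Qed.

Lemma cexp_rate_neq1 kap j : large kap -> j.1 != ord00 -> cexp (rate kap j) != 1.
Proof.
move=> hk j0; apply/eqP => h; have := congr1 (@normc R) h.
rewrite normc_cexp ComplexField.Normc.normc1 -(@expR0 R) => /expR_inj h0.
by have := large_rate hk j0; rewrite h0 normr0 ler10.
Qed.

(** |kap^-1| times this number bounds the Lipschitz constant of the integral
    operator. *)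
Definition total S : R := 4 * #|{: J}|%:R * \int[mu]_(x in `[0, 1]) (weight x + S).

Lemma weightS_integrable S : rintegrable `[0, 1] (fun x => weight x + S).
Proof.
apply: (rintegrableD (k' := fun=> S)) => //; first exact: weight_integrable.
exact: rintegrable_cst.
Qed.

(** The bound 4 is the one given by [fredholm_solution] for sources of norm at
    most 1. *)
Definition solves kap s b (U : J -> R -> C) :=
  [/\ admissible U, PTsym flip U,
    forall j x, 0 <= x <= 1 ->
      U j x = Phi (rate kap) (theta kap) (source b) (coef kap s) kap^-1 U j x &
    forall j x, 0 <= x <= 1 -> normc (U j x) <= 4].

Section fixed_parameters.
Variables (kap S : R).
Hypotheses (hk : large kap) (small : `|kap^-1| * total S <= 1 / 2).

Let cm s j j' : cmeas `[0, 1] (coef kap s j j').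
Proof. exact/cintegrable_meas/coef_integrable. Qed.
Let cb s : `|s| <= S -> forall j j' x, 0 <= x <= 1 -> normc (coef kap s j j' x) <= weight x + S.
Proof. by move=> sS j j' x _; apply: coef_bound => //; have [] := hk. Qed.
Let k1 j t (tb : 0 <= t <= 1) := (theta_bounds j hk tb).1.
Let k2 j t (tb : 0 <= t <= 1) := (theta_bounds j hk tb).2.

Lemma solves_exists s b : `|s| <= S -> exists U, solves kap s b U.
Proof.
move=> sS.
have hr := rate_flip kap.
have ht j : theta kap (flip j) = - 1 - ((theta kap j)^*)%C.
  by apply: theta_flip; exact: cexp_rate_neq1.
have hs j : normc (source b j) <= 1.
  rewrite /source; case: eqP => _; first by rewrite ComplexField.Normc.normc1.
  by rewrite ComplexField.Normc.normc0.
have [U [h1 h2 h3 h4]] := fredholm_solution (cm s) (weightS_integrable S) (cb sS) k1 k2 hr ht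
  (source_flip b) flip_inj (coef_flip kap s) hs small.
by exists U; split=> // j x xb; have := h4 j x xb; rewrite mulr1.
Qed.

Lemma solves_near_source s b U j x : `|s| <= S -> solves kap s b U -> 0 <= x <= 1 ->
  normc (U j x - source b j) <= `|kap^-1| * total S * 4.
Proof.
move=> sS [h1 h2 h3 h4] xb; rewrite h3//.
exact: (Phi_bound _ _ (cm s) (weightS_integrable S) (cb sS) k1 k2 _ h1 h4 xb).
Qed.

(** Subtracting the two integral equations turns any bound e of the difference
    into e / 2 + O(|s - s'|), so [halving_stable] applies. *)
Lemma solves_lipschitz s s' b U U' j x : `|s| <= S -> `|s'| <= S ->
  solves kap s b U -> solves kap s' b U' -> 0 <= x <= 1 ->
  normc (U j x - U' j x) <= 2 * (`|kap^-1| * (4 * #|{: J}|%:R * `|s - s'|) * 4).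
Proof.
move=> sS s'S [h1 h2 h3 h4] [h1' h2' h3' h4'] xb.
pose D (p : J * R) := 0 <= p.2 <= 1.
apply: (@halving_stable R _ D (fun p => normc (U p.1 p.2 - U' p.1 p.2)) _ 8 _ _ (j, x)) => //.
  move=> [i y] /= yb; rewrite (le_trans (normcB _ _))//.
  by have := h4 i y yb; have := h4' i y yb; lra.
move=> e he [i y] /= yb.
have {}he i' y' : 0 <= y' <= 1 -> normc (U i' y' - U' i' y') <= e by exact: (he (i', y')).
have e0 : 0 <= e := le_trans (normc_ge0 _) (he i y yb).
rewrite h3// h3'// -(subrK (Phi (rate kap) (theta kap) (source b) (coef kap s) kap^-1 U' i y)
  (Phi _ _ _ _ _ U i y)) -addrA (le_trans (normcD _ _))// lerD//.
  rewrite (PhiB _ _ _ _ (cm s) (weightS_integrable S) (cb sS))//.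
  rewrite (le_trans (Phi_bound _ _ (cm s) (weightS_integrable S) (cb sS) k1 k2 _ _ he yb))//.
    exact: admissibleB.
  by apply: le_trans (ler_wpM2r e0 small) _; lra.
(* The two coefficient matrices differ by a constant multiple of the identity. *)
pose A'' (j j' : J) (x : R) : C := ((s - s') / n%:R)%:C%C * (j == j')%:R.
have aA : forall j j' x, 0 <= x <= 1 -> normc (A'' j j' x) <= `|s - s'|.
  move=> j1 j2 z _; rewrite /A'' ComplexField.Normc.normcM normc_real.
  have h : `|(s - s') / n%:R| <= `|s - s'|.
    by rewrite normrM normfV (ger0_norm (ler0n _ _)) ler_pdivrMr ?ltr0n// ler_peMr// n_ge1.
  case: eqP => _; first by rewrite ComplexField.Normc.normc1 mulr1.
  by rewrite ComplexField.Normc.normc0 mulr0.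
have mA : forall j j', cmeas `[0, 1] (A'' j j') by move=> *; exact: cmeas_cst.
have iA := rintegrable_cst 0 1 `|s - s'|.
have -> : Phi (rate kap) (theta kap) (source b) (coef kap s) kap^-1 U' i y -
    Phi (rate kap) (theta kap) (source b) (coef kap s') kap^-1 U' i y =
    Phi (rate kap) (theta kap) (source b) A'' kap^-1 U' i y - source b i.
  rewrite /Phi.
  have -> : green (rate kap) (theta kap) A'' U' i y =
      green (rate kap) (theta kap) (coef kap s) U' i y - green (rate kap) (theta kap) (coef kap s') U' i y.
    have eA j1 j2 z : A'' j1 j2 z = coef kap s j1 j2 z - coef kap s' j1 j2 z.
      by rewrite /A'' /coef mulrBl rmorphB /=; ring.
    exact: (@greenB_coef _ _ _ _ _ _ _ _ _ _ _ (weightS_integrable S) (cm s) (cb sS) (cm s') (cb s'S) eA h1' yb).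
  ring.
rewrite (le_trans (Phi_bound _ _ mA iA aA k1 k2 _ h1' h4' yb))//.
by rewrite Rint_cst ?ler01// subr0 mulr1.
Qed.

(** For a solution U, the jump of the component (ord00, a) over a period is
    i / kap times this number. *)
Definition mean s (U : J -> R -> C) a : C := cint `[0, 1] (rhs (coef kap s) U (ord00, a)).

(** The symmetry of U identifies the integrand at 1 - x with its conjugate at x,
    the indices (ord00, a) being fixed by flip. *)
Lemma mean_real s b U a : `|s| <= S -> solves kap s b U -> cIm (mean s U a) = 0.
Proof.
move=> sS [h1 h2 h3 h4].
have ir := rhs_integrable (cm s) (weightS_integrable S) (cb sS) (ord00, a) h1.
have e : mean s U a = ((mean s U a)^*)%C.
  have [] := cint_refl 1 ir; rewrite subrr subr0 => cr cre.
  transitivity (cint `[0, 1] (fun x => ((rhs (coef kap s) U (ord00, a) (1 - x))^*)%C)).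
    apply: ae_eq_cint => //; [exact: cintegrable_meas|exact/cmeasJ/cintegrable_meas|].
    by have := rhs_PT flip_inj (coef_flip kap s) (ord00, a) h2; rewrite flip_ord00.
  by rewrite cintJ// cre.
have := congr1 (@complex.Im R) e.
case: (mean s U a) => p q /= h; lra.
Qed.

(** Up to O(1 / kap) the solution U is its constant source, so the mean is that
    of one entry of the coefficient matrix, to which P_k contributes
    with a factor kap^(2 - k). *)
Lemma mean_close s b U a : `|s| <= S -> solves kap s b U ->
  `|n%:R * cRe (mean s U a) - (s *+ (a == b) - cRe (Cmatrix P a b))| <=
  `|kap^-1| * (n%:R * (2 * (#|{: J}|%:R * (total S * 4) * \int[mu]_(x in `[0, 1]) (weight x + S))) +
     n.+1%:R * (2 * \int[mu]_(x in `[0, 1]) weight x)).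
Proof.
move=> sS sol; have [h1 h2 h3 h4] := sol.
pose V j x := U j x - source b j.
have aS : admissible (fun j (_ : R) => source b j).
  split; first by move=> j; exact: cmeas_cst.
  exists 1 => j x _; rewrite /source; case: eqP => _; first by rewrite ComplexField.Normc.normc1.
  by rewrite ComplexField.Normc.normc0.
have aV : admissible V by exact: admissibleB.
have iV := rhs_integrable (cm s) (weightS_integrable S) (cb sS) (ord00, a) aV.
have rE x : rhs (coef kap s) U (ord00, a) x =
    coef kap s (ord00, a) (ord00, b) x + rhs (coef kap s) V (ord00, a) x.
  rewrite /rhs /V; under [in RHS]eq_bigr do rewrite mulrBr.
  rewrite sumrB; have -> : \sum_j coef kap s (ord00, a) j x * source b j = coef kap s (ord00, a) (ord00, b) x.
    rewrite (bigD1 (ord00, b))//= big1 ?addr0; first by rewrite /source eqxx mulr1.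
    by move=> j /negbTE jb; rewrite /source jb mulr0.
  by rewrite addrCA subrr addr0.
have mE : mean s U a = cint `[0, 1] (coef kap s (ord00, a) (ord00, b)) +
    cint `[0, 1] (rhs (coef kap s) V (ord00, a)).
  by rewrite -cintD//; [apply: eq_cint => x _; exact: rE|exact: coef_integrable].
have bV : normc (cint `[0, 1] (rhs (coef kap s) V (ord00, a))) <=
    `|kap^-1| * (2 * (#|{: J}|%:R * (total S * 4) * \int[mu]_(x in `[0, 1]) (weight x + S))).
  set M := `|kap^-1| * total S * 4.
  have iK := rintegrableZ (#|{: J}|%:R * M) (measurable_itv `[0, 1]) (weightS_integrable S).
  rewrite (le_trans (cint_bound (measurable_itv _) iV iK _))//.
    move=> x; rewrite /= in_itv/= => xb; apply: (rhs_bound (cb sS)) => //.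
    by move=> j y yb; exact: (solves_near_source j sS sol yb).
  rewrite RintegralZl//; last exact: weightS_integrable.
  by rewrite /M; lra.
pose tail : C := \sum_(3 <= k < n.+1) ((kap^-1 ^+ (k - 2))%:C)%C * cint `[0, 1] (fun x => P k x a b).
have btail : normc tail <= `|kap^-1| * (n.+1%:R * (2 * \int[mu]_(x in `[0, 1]) weight x)).
  rewrite (le_trans (ler_normc_sum _ _ _))//.
  have w0 : 0 <= \int[mu]_(x in `[0, 1]) weight x.
    apply: Rintegral_ge0 => x _; apply: sumr_ge0 => k _; apply: sumr_ge0 => ? _.
    by apply: sumr_ge0 => ? _; exact: normc_ge0.
  rewrite (le_trans (y := \sum_(3 <= k < n.+1) `|kap^-1| * (2 * \int[mu]_(x in `[0, 1]) weight x)))//.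
    rewrite !big_nat; apply: ler_sum => k /andP[k3 kn].
    rewrite ComplexField.Normc.normcM normc_real ler_pM ?normc_ge0//.
      rewrite normrX -[leRHS]expr1 ler_wiXn2l//; last by rewrite subn_gt0.
      by rewrite normfV invf_le1; [have [] := hk|apply: lt_le_trans ltr01 _; have [] := hk].
    have k2' : (2 <= k <= n)%N by rewrite (ltnW k3) -ltnS.
    apply: (cint_bound (measurable_itv _) (P_integrable _ _ k2') weight_integrable) => x _.
    exact: P_weight.
  rewrite sumr_const_nat -[leLHS]mulr_natl mulrCA ler_wpM2l// ler_wpM2r ?mulr_ge0// ler_nat.
  by rewrite leq_subLR leq_addl.
have cE : n%:R * cint `[0, 1] (coef kap s (ord00, a) (ord00, b)) =
    ((s *+ (a == b))%:C)%C - Cmatrix P a b - tail.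
  rewrite cintD//; [|by apply: cintegrableZ => //; exact: potential_integrable|exact: cintegrable_cst].
  have -> : cint `[0, 1] (fun x => - (w ^+ (ord00, a).1 / n%:R) *
      potential kap (ord00, b).1 (ord00, a).2 (ord00, b).2 x) =
      - (w ^+ 0 / n%:R) * cint `[0, 1] (potential kap ord00 a b).
    exact: (cintZ _ (measurable_itv _) (potential_integrable kap ord00 a b)).
  have -> : cint `[0, 1] (potential kap ord00 a b) = Cmatrix P a b + tail.
    have pE x : potential kap ord00 a b x = P 2%N x a b +
        \sum_(k <- index_iota 3 n.+1 | k \in index_iota 3 n.+1) ((kap^-1 ^+ (k - 2))%:C)%C * P k x a b.
      rewrite /potential big_ltn; last by rewrite ltnS ltnW.
      rewrite /= subnn !expr0 expr1n !mul1r; congr (_ + _).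
      by rewrite big_seq; apply: eq_bigr => k _; rewrite expr1n mul1r.
    rewrite (@eq_cint _ _ _ _ (fun x _ => pE x)).
    have Pi k : k \in index_iota 3 n.+1 -> cintegrable `[0, 1] (fun x => P k x a b).
      by rewrite mem_index_iota => /andP[k3 kn]; apply: P_integrable; rewrite (ltnW k3) -ltnS.
    rewrite cintD//; last 2 first.
    - by apply: P_integrable; rewrite leqnn ltnW.
    - by apply: cintegrable_sum => // k kI; apply: cintegrableZ => //; exact: Pi.
    rewrite cint_sum//; last by move=> k kI; apply: cintegrableZ => //; exact: Pi.
    congr (_ + _); first by rewrite mxE.
    by rewrite /tail [RHS]big_seq; apply: eq_bigr => k kI; rewrite cintZ//; exact: Pi.
  have -> : cint `[0, 1] (fun=> (s / n%:R)%:C%C * ((ord00, a) == (ord00, b) :> J)%:R) =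
      (s / n%:R)%:C%C * (a == b)%:R.
    rewrite xpair_eqE eqxx /=; apply: ceqP; rewrite /= Rint_cst ?ler01//; lra.
  rewrite expr0 mulrDr.
  have -> : n%:R * ((s / n%:R)%:C%C * (a == b)%:R) = ((s *+ (a == b))%:C)%C :> C.
    rewrite mulrA -(rmorph_nat (real_complex R)) -rmorphM /= mulrCA mulfV ?mulr1; last by rewrite pnatr_eq0 -lt0n.
    by case: (a == b); rewrite ?mulr1 ?mulr0.
  by field; rewrite pnatr_eq0 -lt0n.
have key : n%:R * mean s U a - (((s *+ (a == b))%:C)%C - Cmatrix P a b) =
    n%:R * cint `[0, 1] (rhs (coef kap s) V (ord00, a)) - tail.
  by rewrite mE mulrDr cE; ring.
have -> : n%:R * cRe (mean s U a) - (s *+ (a == b) - cRe (Cmatrix P a b)) =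
    cRe (n%:R * mean s U a - (((s *+ (a == b))%:C)%C - Cmatrix P a b)).
  by rewrite !(cReD, cReN) cReM -(rmorph_nat (real_complex R)) /=; ring.
rewrite key (le_trans (normc_Re _))// (le_trans (normcB _ _))// mulrDr lerD//.
rewrite ComplexField.Normc.normcM -(rmorph_nat (real_complex R)) normc_real (ger0_norm (ler0n _ _)).
by rewrite mulrCA ler_wpM2l.
Qed.

End fixed_parameters.

End system.

(** * Bloch waves with real quasimomentum *)

Section bloch.
Variable R : realType.
Local Notation C := R[i].
Local Notation mu := (@lebesgue_measure R).
Local Notation rintegrable D k := (mu.-integrable D (EFin \o k)).

Variables (n m : nat) (P : nat -> R -> 'M[C]_m) (w : C) (lam : R).
Hypotheses (n2 : (2 < n)%N) (oddn : odd n) (prim : n.-primitive_root w).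
Hypothesis hP : forall (k : nat) (i j : 'I_m), (2 <= k <= n)%N ->
  PT_periodic_L2 (fun x => P k x i j).
Hypothesis odd_lam : odd (mup (lam%:C)%C (char_poly (Cmatrix P))).

Local Notation J := ('I_n * 'I_m)%type.
Local Notation o := (ord00 n2).
Local Notation Coef := (coef P w).
Local Notation Potential := (potential P w).
Local Notation Rate := (rate (m := m) w).
Local Notation Theta := (theta (m := m) w n2).
Local Notation Source := (@source R n m n2).
Local Notation Solves := (solves P w n2).
Local Notation Mean := (mean P w n2).
Local Notation Total := (total n P).
Local Notation Large := (large w n2).

Implicit Types (j : J) (a b : 'I_m) (kap s x : R).

Let S : R := `|lam| + 1.

Let le_S s : `|s - lam| <= 1 -> `|s| <= S.
Proof.
by move=> h; rewrite /S -(subrK lam s) addrC (le_trans (ler_normD _ _))// lerD2l.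
Qed.

Lemma inv_small kap (Y e : R) : 0 < e -> 0 < `|kap| -> Y / e <= `|kap| -> `|kap^-1| * Y <= e.
Proof.
by move=> e0 k0; rewrite ler_pdivrMr// => h; rewrite normfV mulrC ler_pdivrMr// mulrC.
Qed.

Lemma Cmatrix_real : Cmatrix P = map_mx (fun x : R => x%:C%C) (map_mx (@complex.Re R) (Cmatrix P)).
Proof.
apply/matrixP => a b; rewrite !mxE; apply: ceqP => //.
have k2 : (2 <= 2 <= n)%N by rewrite leqnn ltnW.
have pi := P_integrable hP a b k2.
have [] := cint_refl 1 pi; rewrite subrr subr0 => cr cre.
have e : cint `[0, 1] (fun x => P 2%N x a b) = ((cint `[0, 1] (fun x => P 2%N x a b))^*)%C.
  rewrite -[LHS]cre -cintJ//; apply: ae_eq_cint => //.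
  - exact: cintegrable_meas.
  - exact/cmeasJ/cintegrable_meas.
  - by apply: ae_imp (P_reflect hP a b k2) => x h _; exact: h.
have := congr1 (@complex.Im R) e; rewrite /cint01 /cint /=; lra.
Qed.

Lemma mean_lipschitz kap : Large kap -> `|kap^-1| * Total S <= 1 / 2 ->
  exists L, forall s s' b U U' a, `|s| <= S -> `|s'| <= S ->
    Solves kap s b U -> Solves kap s' b U' ->
    normc (Mean kap s U a - Mean kap s' U' a) <= L * `|s - s'|.
Proof.
move=> hk small.
set L0 := 2 * (`|kap^-1| * (4 * #|{: J}|%:R) * 4).
pose W := \int[mu]_(x in `[0, 1]) (weight n P x + S).
exists (2 * (#|{: J}|%:R * L0 * W + 4)) => s s' b U U' a sS s'S sol sol'.
have [h1 h2 h3 h4] := sol; have [h1' h2' h3' h4'] := sol'.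
have wi := weightS_integrable hP S.
have k1 : 1 <= `|kap| by have [] := hk.
have cm t j j' : cmeas `[0, 1] (Coef kap t j j').
  exact: cintegrable_meas (coef_integrable w hP kap t j j').
have cb t : `|t| <= S -> forall j j' x, 0 <= x <= 1 -> normc (Coef kap t j j' x) <= weight n P x + S.
  by move=> tS j j' x _; exact: coef_bound.
have i1 := rhs_integrable (cm s) wi (cb s sS) (o, a) h1.
have i2 := rhs_integrable (cm s') wi (cb s' s'S) (o, a) h1'.
rewrite /mean -cintB//.
have dE x : rhs (Coef kap s) U (o, a) x - rhs (Coef kap s') U' (o, a) x =
    rhs (Coef kap s) (fun j x => U j x - U' j x) (o, a) x + ((s - s') / n%:R)%:C%C * U' (o, a) x.
  rewrite /rhs; under [in RHS]eq_bigr do rewrite mulrBr.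
  rewrite sumrB.
  have <- : \sum_j' Coef kap s (o, a) j' x * U' j' x - \sum_j' Coef kap s' (o, a) j' x * U' j' x =
      ((s - s') / n%:R)%:C%C * U' (o, a) x.
    rewrite -sumrB (bigD1 (o, a))//= big1 ?addr0.
      by rewrite /coef eqxx !mulrBl rmorphB /=; ring.
    by move=> j ja; rewrite /coef eq_sym (negbTE ja) !mulr0 !addr0 subrr.
  by rewrite addrA subrK.
have bd : forall j x, 0 <= x <= 1 -> normc (U j x - U' j x) <= L0 * `|s - s'|.
  move=> j x xb; have := solves_lipschitz (m := m) prim hP hk small j sS s'S sol sol' xb.
  by rewrite /L0 => /le_trans; apply; lra.
pose kk x := #|{: J}|%:R * (L0 * `|s - s'|) * (weight n P x + S) + 4 * `|s - s'|.
have ikk : rintegrable `[0, 1] kk.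
  apply: (rintegrableD (k' := fun=> 4 * `|s - s'|)) => //; last exact: rintegrable_cst.
  exact: (rintegrableZ (#|{: J}|%:R * (L0 * `|s - s'|)) (measurable_itv _) wi).
have iD : cintegrable `[0, 1] (fun x => rhs (Coef kap s) U (o, a) x - rhs (Coef kap s') U' (o, a) x).
  rewrite (_ : (fun _ => _) = (fun x => rhs (Coef kap s) U (o, a) x + (-1) * rhs (Coef kap s') U' (o, a) x)).
    by apply: cintegrableD => //; exact: cintegrableZ.
  by apply/funext => x; rewrite mulN1r.
rewrite (le_trans (cint_bound (measurable_itv _) iD ikk _))//.
  move=> x; rewrite /= in_itv/= => xb; rewrite dE (le_trans (normcD _ _))// lerD//.
    exact: (rhs_bound (cb s sS)).
  rewrite ComplexField.Normc.normcM mulrC ler_pM ?normc_ge0 ?h4'// normc_real.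
  by rewrite normrM normfV (ger0_norm (ler0n _ _)) ler_pdivrMr ?ltr0n ?ler_peMr ?ler1n// (ltn_trans _ n2).
rewrite /kk RintegralD//; last 2 first.
- exact: (rintegrableZ (#|{: J}|%:R * (L0 * `|s - s'|)) (measurable_itv _) wi).
- exact: rintegrable_cst.
have -> : \int[mu]_(x in `[0, 1]) (4 * `|s - s'|) = 4 * `|s - s'| by rewrite Rint_cst ?ler01// subr0 mulr1.
rewrite RintegralZl// -/W.
lra.
Qed.

(** The matrix of the n (Mean U_b)_a is real, Lipschitz in s, and close to
    s - C for large kap, so the odd multiplicity of lam forces its determinant to
    vanish for some s near lam. *)
Lemma singular_parameter (eps : R) : 0 < eps -> exists K, forall kap, K <= `|kap| ->
  [/\ Large kap, `|kap^-1| * Total S <= 1 / 2, `|kap^-1| * Total S * 4 <= eps &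
   exists s (U : 'I_m -> J -> R -> C) (c : 'I_m -> R),
    [/\ `|s| <= S, forall b, Solves kap s b (U b), exists a, c a != 0 &
      forall a, \sum_b (c b)%:C%C * Mean kap s (U b) a = 0]].
Proof.
move=> eps0; pose C0 := map_mx (@complex.Re R) (Cmatrix P).
have odd0 : odd (mup lam (char_poly C0)).
  by rewrite -mup_map_real -Cmatrix_real.
have [eta eta0 hN] := odd_eigenvalue_persists odd0.
have [K1 hK1] := large_eventually n2 oddn prim.
set X := n%:R * (2 * (#|{: J}|%:R * (Total S * 4) * \int[mu]_(x in `[0, 1]) (weight n P x + S))) +
     n.+1%:R * (2 * \int[mu]_(x in `[0, 1]) weight n P x).
exists (`|K1| + `|Total S / (1 / 2)| + `|Total S * 4 / eps| + `|X / eta|) => kap hk.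
have [q1 q2] : K1 <= `|kap| /\ Total S / (1 / 2) <= `|kap|.
  have := ler_norm K1; have := ler_norm (Total S / (1 / 2)); have := normr_ge0 K1.
  have := normr_ge0 (Total S / (1 / 2)); have := normr_ge0 (Total S * 4 / eps); have := normr_ge0 (X / eta).
  by split; lra.
have [q3 q4] : Total S * 4 / eps <= `|kap| /\ X / eta <= `|kap|.
  have := ler_norm (Total S * 4 / eps); have := ler_norm (X / eta); have := normr_ge0 K1.
  have := normr_ge0 (Total S / (1 / 2)); have := normr_ge0 (Total S * 4 / eps); have := normr_ge0 (X / eta).
  by split; lra.
have lk : Large kap by exact: hK1.
have k0 : 0 < `|kap| by apply: lt_le_trans ltr01 _; have [] := lk.
have small : `|kap^-1| * Total S <= 1 / 2 by apply: inv_small => //; lra.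
have [L hL] := mean_lipschitz lk small.
(* Any choice of solutions will do: [mean_lipschitz] compares arbitrary ones. *)
have sol s b : {U | `|s| <= S -> Solves kap s b U}.
  apply: cid; case: (boolP (`|s| <= S)) => sS; last by exists (fun _ _ => 0).
  by have [U hU] := solves_exists prim hP lk small b sS; exists U.
pose Us s b := sval (sol s b).
have HU s b : `|s| <= S -> Solves kap s b (Us s b) by exact: (svalP (sol s b)).
pose N s : 'M[R]_m := \matrix_(a, b) (n%:R * cRe (Mean kap s (Us s b) a)).
have [s sl dN] : exists2 s, `|s - lam| <= 1 & \det (N s) = 0.
  apply: hN.
    move=> s a b sl; rewrite !mxE; have sS := le_S sl.
    have := mean_close prim hP lk a sS (HU s b sS); rewrite [Cmatrix P a b]mxE.
    move/le_trans; apply.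
    exact: inv_small.
  exists (n%:R * L) => s s' a b sl s'l; rewrite !mxE -mulrBr normrM (ger0_norm (ler0n _ _)) -mulrA ler_wpM2l//.
  rewrite -cReN -cReD (le_trans (normc_Re _))//.
  by apply: (hL s s' b) => //; [exact: le_S|exact: le_S|apply: HU; exact: le_S|apply: HU; exact: le_S].
split=> //; first by rewrite -mulrA; exact: inv_small.
exists s, (Us s); have sS := le_S sl.
have /eqP : \det ((N s)^T) = 0 by rewrite det_tr.
move=> /det0P[c c0 cN]; exists (fun b => c 0 b); split=> //.
- by move=> b; exact: HU.
- apply: contrapT => h; move/eqP: c0; apply; apply/rowP => a; rewrite mxE; apply/eqP.
  by apply: contraT => ca; exfalso; apply: h; exists a.
move=> a; have := congr1 (fun M : 'rV[R]_m => M 0 a) cN; rewrite !mxE => h.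
have nn0 : (n%:R : R) != 0 by rewrite pnatr_eq0 -lt0n (ltn_trans _ n2).
have {}h : \sum_b c 0 b * cRe (Mean kap s (Us s b) a) = 0.
  apply: (mulfI nn0); rewrite mulr0 -[RHS]h mulr_sumr; apply: eq_bigr => b _; rewrite !mxE; ring.
have im b : cIm (Mean kap s (Us s b) a) = 0 by exact: (mean_real prim hP lk a sS (HU s b sS)).
apply: ceqP; rewrite ?cRe_sum ?cIm_sum.
  by rewrite -[RHS]h; apply: eq_bigr => b _; rewrite cReM im mulr0 subr0.
by rewrite big1// => b _; rewrite cImM im mulr0 mul0r addr0.
Qed.

Section wave.
Variables (kap s : R) (U : 'I_m -> J -> R -> C) (c : 'I_m -> R).
Hypotheses (lk : Large kap) (sS : `|s| <= S) (hU : forall b, Solves kap s b (U b)).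
Hypothesis hc : forall a, \sum_b (c b)%:C%C * Mean kap s (U b) a = 0.

Let k0 : kap != 0.
Proof. by rewrite -normr_gt0; apply: lt_le_trans ltr01 _; have [] := lk. Qed.
Let cm j j' : cmeas `[0, 1] (Coef kap s j j').
Proof. exact: cintegrable_meas (coef_integrable w hP kap s j j'). Qed.
Let cb : forall j j' x, 0 <= x <= 1 -> normc (Coef kap s j j' x) <= weight n P x + S.
Proof. by move=> j j' x _; apply: coef_bound => //; have [] := lk. Qed.
Let wi := weightS_integrable hP S.

Definition cell j x : C := \sum_b (c b)%:C%C * U b j x.

Lemma rhs_cell j x : rhs (Coef kap s) cell j x = \sum_b (c b)%:C%C * rhs (Coef kap s) (U b) j x.
Proof.
rewrite /rhs /cell; under eq_bigr do rewrite mulr_sumr.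
rewrite exchange_big; apply: eq_bigr => b _; rewrite mulr_sumr.
by apply: eq_bigr => j' _; rewrite mulrCA.
Qed.

Lemma rate_source b j : Rate kap j * Source b j = 0.
Proof.
rewrite /source; case: eqP => [->|]; last by rewrite mulr0.
by rewrite rate_ord00 mul0r.
Qed.

Lemma cell_primitive j :
  primitive 1 (cell j) (fun x => Rate kap j * cell j x + 'i%C * kap^-1%:C%C * rhs (Coef kap s) cell j x).
Proof.
have pb b : primitive 1 (fun x => (c b)%:C%C * U b j x)
    (fun x => (c b)%:C%C * (Rate kap j * U b j x + 'i%C * kap^-1%:C%C * rhs (Coef kap s) (U b) j x)).
  have [h1 h2 h3 h4] := hU b; apply: primitiveZ.
  apply: (eq_primitive ler01 _ _ (Phi_primitive (Rate kap) (Theta kap) (Source b) kap^-1 cm wi cb j h1)).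
    by move=> x xb; rewrite -h3.
  by move=> x xb; rewrite -h3// mulrBr rate_source subr0.
apply: (eq_primitive ler01 _ _ (primitive_sum (index_enum 'I_m) (P := xpredT) (fun b _ => pb b))) => // x _.
rewrite rhs_cell /cell !mulr_sumr -big_split /=; apply: eq_bigr => b _; ring.
Qed.

(** For l <> 0 the value of theta makes each U b periodic. For l = 0 the jumps
    of the U b are their means, whose combination hc annihilates. *)
Lemma cell_periodic j : cell j 1 = cell j 0.
Proof.
pose I b := cint `[0, 1] (fun s0 : R => cexp (- Rate kap j * s0%:C)%C * rhs (Coef kap s) (U b) j s0).
have e1 b : U b j 1 = Source b j + 'i%C * kap^-1%:C%C * (cexp (Rate kap j) * (1 + Theta kap j) * I b).
  have [h1 h2 h3 h4] := hU b; rewrite h3 ?lexx ?ler01//.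
  exact: (Phi_right (Rate kap) (Theta kap) (Source b) kap^-1 cm wi cb j h1).
have e0 b : U b j 0 = Source b j + 'i%C * kap^-1%:C%C * (Theta kap j * I b).
  have [h1 h2 h3 h4] := hU b; rewrite h3 ?lexx ?ler01//.
  exact: (Phi_left (Rate kap) (Theta kap) (Source b) kap^-1 cm wi cb j h1).
rewrite /cell; under eq_bigr do rewrite e1; under [RHS]eq_bigr do rewrite e0.
have [j0|j0] := eqVneq j.1 o; last first.
  have h : cexp (Rate kap j) * (1 + Theta kap j) = Theta kap j.
    have := cexp_rate_neq1 lk j0; rewrite /theta (negbTE j0) => h.
    by field; rewrite subr_eq0 eq_sym.
  by rewrite h.
have jE : j = (o, j.2) by rewrite -j0 -surjective_pairing.
have r0 : Rate kap j = 0 by rewrite jE rate_ord00.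
have t0 : Theta kap j = - 2^-1 by rewrite /theta j0 eqxx.
have IE b : I b = Mean kap s (U b) j.2.
  by apply: eq_cint => x _; rewrite r0 oppr0 mul0r cexp0 mul1r -jE.
apply/eqP; rewrite -subr_eq0 -sumrB; apply/eqP.
transitivity ('i%C * kap^-1%:C%C * \sum_b (c b)%:C%C * Mean kap s (U b) j.2); last by rewrite hc mulr0.
rewrite mulr_sumr; apply: eq_bigr => b _; rewrite r0 t0 IE cexp0; field; by rewrite ?fmorph_eq0 ?k0.
Qed.

Definition flux a x : C := \sum_(r < n) \sum_b Potential kap r a b x * cell (r, b) x.

Lemma rhs_flux j x : rhs (Coef kap s) cell j x =
  - (w ^+ j.1 / n%:R) * flux j.2 x + (s / n%:R)%:C%C * cell j x.
Proof.
rewrite /rhs (eq_bigr (fun j' => - (w ^+ j.1 / n%:R) * (Potential kap j'.1 j.2 j'.2 x * cell j' x) +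
    (s / n%:R)%:C%C * ((j == j')%:R * cell j' x))); last by move=> j' _; rewrite /coef; ring.
rewrite big_split /= -!mulr_sumr; congr (_ * _ + _ * _).
  by rewrite /flux pair_big; apply: eq_bigr => -[r b].
rewrite (bigD1 j)//= eqxx mul1r big1 ?addr0// => j' jj'.
by rewrite eq_sym (negbTE jj') mul0r.
Qed.

Let z : C := (kap - s / (n%:R * kap))%:C%C.

Definition mode j x : C := cexp ('i%C * z * x%:C)%C * per (cell j) x.
Definition forcing a x : C := cexp ('i%C * z * x%:C)%C * per (flux a) x.

(** The q-th derivative of the Bloch wave, for q <= n. Differentiating a mode
    produces a multiple of w^l forcing; in the sum weighted by (w^l)^q these terms
    cancel for q.+1 < n, by the vanishing of the power sums of the roots of unity,
    and they survive for q.+1 = n only. *)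
Definition wave (q : nat) a x : C :=
  \sum_(l < n) ('i%C * kap%:C%C * w ^+ l) ^+ q * mode (l, a) x -
  (q == n)%:R * ('i%C ^+ n * (kap ^+ (n - 2))%:C%C) * forcing a x.

Lemma normc_plane x : normc (cexp ('i%C * z * x%:C)%C) = 1.
Proof. by rewrite normc_cexp !cReM !cImM /= -expR0; congr expR; ring. Qed.

Lemma mode_primitive j (N : nat) : primitive N%:R (mode j)
  (fun x => 'i%C * kap%:C%C * w ^+ j.1 * mode j x - 'i%C * kap^-1%:C%C * (w ^+ j.1 / n%:R) * forcing j.2 x).
Proof.
have N0 : 0 <= N%:R :> R by [].
have pc := primitive_per N (cell_primitive j) (cell_periodic j).
have := primitiveM (L := normc ('i%C * z)) N0 _ (primitive_cexp ('i%C * z) N0) pc.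
move=> h; apply: (eq_primitive N0 _ _ (h _)) => //; last first.
  by move=> x _; rewrite ComplexField.Normc.normcM normc_plane mulr1.
move=> x _; rewrite /mode /forcing /per rhs_flux /rate.
have -> : z = kap%:C%C - (s / n%:R)%:C%C * kap^-1%:C%C.
  rewrite /z rmorphB -rmorphM /=; congr (_ - _%:C%C); field.
  by rewrite k0 pnatr_eq0 -lt0n (ltn_trans _ n2).
ring.
Qed.

Lemma wave_primitive q a (N : nat) : (q < n)%N -> primitive N%:R (wave q a) (wave q.+1 a).
Proof.
move=> qn; have N0 : 0 <= N%:R :> R by [].
have n0 : (0 < n)%N by apply: ltn_trans n2.
have ps := primitive_sum (index_enum 'I_n) (P := xpredT)
  (fun l _ => primitiveZ (('i%C * kap%:C%C * w ^+ l) ^+ q) (mode_primitive (l, a) N)).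
apply: (eq_primitive N0 _ _ ps) => x _; rewrite /wave.
  by rewrite (ltn_eqF qn) !mul0r subr0.
under eq_bigr do rewrite mulrBr; rewrite sumrB; congr (_ - _).
  by apply: eq_bigr => l _; rewrite mulrA -exprSr.
rewrite (eq_bigr (fun l : 'I_n => ('i%C * kap%:C%C) ^+ q * ('i%C * kap^-1%:C%C / n%:R) * forcing a x * (w ^+ l) ^+ q.+1)); last first.
  by move=> l _ /=; rewrite exprMn exprS; ring.
rewrite -mulr_sumr; have [qe|qe] := eqVneq q.+1 n; last first.
  rewrite (root_power_sum prim) ?mulr0 ?mul0r//.
  by rewrite /= ltn_neqAle qe.
rewrite qe (root_power_sumn prim) mul1r.
have nE : n = q.+1 by []. 
have -> : (kap ^+ (n - 2))%:C%C = (kap^-1)%:C%C * kap%:C%C ^+ q :> C.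
  rewrite -rmorphXn -rmorphM /=; congr (_%:C)%C.
  have -> : q = (n - 2).+1 by lia.
  by rewrite exprS mulrA mulVf// mul1r.
rewrite -[in 'i%C ^+ n]qe exprS exprMn; field.
by rewrite pnatr_eq0 -lt0n n0 andbT fmorph_eq0.
Qed.

(** The term of order n in forcing cancels the lower-order terms at every point,
    since both are built from the same periodic representatives. *)
Lemma wave_equation a x :
  (- 'i%C) ^+ n * wave n a x +
  \sum_(2 <= k < n.+1) (- 'i%C) ^+ (n - k) * (\sum_b per (P k) x a b * wave (n - k) b x) =
  (kap ^+ n)%:C%C * wave 0 a x.
Proof.
have n0 : (0 < n)%N by apply: ltn_trans n2.
have ii q : (- 'i%C) ^+ q * 'i%C ^+ q = 1 :> C by rewrite -exprMn mulNr -expr2 sqr_i opprK expr1n.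
have wn (l : 'I_n) : (w ^+ l) ^+ n = 1 by rewrite -exprM mulnC exprM (prim_expr_order prim) expr1n.
have e1 : (- 'i%C) ^+ n * wave n a x = (kap ^+ n)%:C%C * wave 0 a x - (kap ^+ (n - 2))%:C%C * forcing a x.
  rewrite /wave eqxx mul1r mulrBr [in RHS]eq_sym (gtn_eqF n0) !mul0r subr0; congr (_ - _).
    rewrite !mulr_sumr; apply: eq_bigr => l _; rewrite expr0 mul1r !exprMn wn mulr1 !mulrA ii mul1r.
    by rewrite rmorphXn.
  by rewrite !mulrA ii mul1r.
rewrite e1 -addrA -[RHS]addr0; congr (_ + _); rewrite addrC; apply/eqP; rewrite subr_eq0; apply/eqP.
rewrite /forcing /per /flux mulrCA !mulr_sumr.
set y := x - _.
rewrite [RHS](eq_bigr (fun r : 'I_n => \sum_b \sum_(2 <= k < n.+1)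
    (kap ^+ (n - k))%:C%C * (w ^+ r) ^+ (n - k) * P k y a b * mode (r, b) x)); last first.
  move=> r _; rewrite !mulr_sumr; apply: eq_bigr => b _.
  rewrite /potential !(mulr_suml, mulr_sumr); apply: eq_big_nat => k /andP[k2 kn].
  have -> : (kap ^+ (n - k))%:C%C = (kap ^+ (n - 2))%:C%C * (kap^-1 ^+ (k - 2))%:C%C :> C.
    rewrite -rmorphM /=; congr (_%:C)%C; rewrite exprVn.
    have -> : (n - 2 = (n - k) + (k - 2))%N by lia.
    by rewrite exprD mulfK// expf_neq0.
  by rewrite /mode /per -/y; ring.
under [RHS]eq_bigr do rewrite exchange_big /=.
rewrite [RHS]exchange_big /=; apply: eq_big_nat => k /andP[k2 kn].
rewrite [RHS]exchange_big /= mulr_sumr; apply: eq_bigr => b _.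
have kn0 : (n - k == n)%N = false by apply/negbTE; lia.
rewrite /wave kn0 !mul0r subr0 !mulr_sumr; apply: eq_bigr => l _.
rewrite !exprMn rmorphXn /=.
rewrite [LHS](_ : _ = ((- 'i%C) ^+ (n - k) * 'i%C ^+ (n - k)) * (kap%:C%C ^+ (n - k) * (w ^+ l) ^+ (n - k) * P k y a b * mode (l, b) x)).
  by rewrite ii mul1r.
by ring.
Qed.

Lemma cell_bounded j x : 0 <= x <= 1 -> normc (cell j x) <= 4 * \sum_b `|c b|.
Proof.
move=> xb; rewrite /cell (le_trans (ler_normc_sum _ _ _))// mulr_sumr; apply: ler_sum => b _.
have [_ _ _ h4] := hU b.
by rewrite ComplexField.Normc.normcM normc_real mulrC ler_wpM2r// h4.
Qed.

Lemma wave_bounded q a x : (q < n)%N ->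
  normc (wave q a x) <= n%:R * ((1 + `|kap|) ^+ n * (4 * \sum_b `|c b|)).
Proof.
move=> qn; rewrite /wave (ltn_eqF qn) !mul0r subr0 (le_trans (ler_normc_sum _ _ _))//.
rewrite -[X in X%:R * _](card_ord n) mulr_natl -sumr_const; apply: ler_sum => l _.
rewrite ComplexField.Normc.normcM ler_pM ?normc_ge0//.
  rewrite normcX !ComplexField.Normc.normcM normc_i mul1r normc_real (normc_root (ltn_trans (isT : (0 < 2)%N) n2) prim) mulr1.
  rewrite (@le_trans _ _ ((1 + `|kap|) ^+ q))//; first by rewrite lerXn2r ?nnegrE ?addr_ge0// lerDr.
  by rewrite ler_weXn2l ?(ltnW qn)// lerDl.
rewrite ComplexField.Normc.normcM normc_plane mul1r; apply: per_bounded => t tb; exact: cell_bounded.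
Qed.

(** Each U b is close to its constant source, so the wave is close to a constant
    vector c times a plane wave. *)
Lemma wave_lower a x :
  `|c a| - n%:R * ((\sum_b `|c b|) * (`|kap^-1| * Total S * 4)) <= normc (wave 0 a x).
Proof.
have n0 : (0 == n)%N = false by apply/negbTE; lia.
set y := x - (Num.floor x)%:~R; have [t tb yE] : exists2 t : R, 0 <= t <= 1 & forall f : R -> C, per f x = f t.
  exists y => //; have [yt ytb /= ye] := per_in (@idfun R) x; rewrite /y -[x - _]/(per (@idfun R) x) ye.
  by have /andP[-> /ltW] := ytb.
have -> : wave 0 a x = cexp ('i%C * z * x%:C)%C * \sum_(l < n) cell (l, a) t.
  rewrite /wave n0 !mul0r subr0 mulr_sumr; apply: eq_bigr => l _.
  by rewrite expr0 mul1r /mode yE.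
rewrite ComplexField.Normc.normcM normc_plane mul1r.
have -> : \sum_(l < n) cell (l, a) t = (c a)%:C%C +
    \sum_(l < n) \sum_b (c b)%:C%C * (U b (l, a) t - Source b (l, a)).
  have -> : (c a)%:C%C = \sum_(l < n) \sum_b (c b)%:C%C * Source b (l, a) :> C.
    rewrite (bigD1 o)//= [X in _ + X]big1 ?addr0; last first.
      by move=> l lo; rewrite big1// => b _; rewrite /source xpair_eqE (negbTE lo) mulr0.
    rewrite (bigD1 a)//= big1 ?addr0; first by rewrite /source eqxx mulr1.
    by move=> b ba; rewrite /source xpair_eqE eqxx eq_sym (negbTE ba) mulr0.
  rewrite -big_split; apply: eq_bigr => l _ /=; rewrite -big_split; apply: eq_bigr => b _ /=.
  by rewrite -mulrDr addrC subrK.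
set E := (X in normc (_ + X)); have hE : normc E <= n%:R * ((\sum_b `|c b|) * (`|kap^-1| * Total S * 4)).
  rewrite /E (le_trans (ler_normc_sum _ _ _))//.
  rewrite -[X in X%:R * _](card_ord n) mulr_natl -sumr_const; apply: ler_sum => l _.
  rewrite (le_trans (ler_normc_sum _ _ _))// mulr_suml; apply: ler_sum => b _.
  rewrite ComplexField.Normc.normcM normc_real ler_wpM2l//.
  exact: (solves_near_source prim hP lk (l, a) sS (hU b) tb).
have := normcD ((c a)%:C%C + E) (- E); rewrite addrK normc_opp normc_real; lra.
Qed.
End wave.

(** The modes have constant modulus up to a bounded periodic factor, and a
    component in which c has maximal modulus stays away from 0. *)
Theorem bloch_wave : exists K, forall kap, K <= `|kap| ->
  exists (v : nat -> 'I_m -> R -> C) V d a0,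
  [/\ forall q a (N : nat), (q < n)%N -> primitive N%:R (v q a) (v q.+1 a),
     0 <= V /\ forall q a x, (q < n)%N -> normc (v q a x) <= V,
     0 < d /\ forall x, d <= normc (v 0 a0 x) &
     forall a x, (- 'i%C) ^+ n * v n a x +
       \sum_(2 <= k < n.+1) (- 'i%C) ^+ (n - k) * (\sum_b per (P k) x a b * v (n - k)%N b x) =
       (kap ^+ n)%:C%C * v 0 a x].
Proof.
have n0 : (0 < n)%N by apply: ltn_trans n2.
(* The error in [wave_lower] is at most n m eps times the largest |c b|. *)
pose eps : R := (2 * n%:R * m.+1%:R)^-1.
have eps0 : 0 < eps by rewrite invr_gt0 !mulr_gt0// ltr0n.
have [K hK] := singular_parameter eps0; exists K => kap /hK[lk _ small [s [U [c [sS hU [a ca] hc]]]]].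
have [a0 _ amax] := @arg_maxP _ _ _ a xpredT (fun a => `|c a|) isT.
exists (wave kap s U c), (n%:R * ((1 + `|kap|) ^+ n * (4 * \sum_b `|c b|))), (`|c a0| / 2), a0.
have c0 : 0 < `|c a0| by apply: lt_le_trans (amax a isT); rewrite normr_gt0.
split.
- by move=> q b N qn; apply: wave_primitive.
- split; last by move=> q b x qn; apply: wave_bounded.
  by rewrite !mulr_ge0// ?exprn_ge0 ?addr_ge0// sumr_ge0.
- split; first by rewrite divr_gt0.
  move=> x; have low := wave_lower c lk sS hU a0 x; apply: le_trans low.
  have : n%:R * ((\sum_b `|c b|) * (`|kap^-1| * Total S * 4)) <= n%:R * (m.+1%:R * `|c a0| * eps).
    have zb : is_true (0 <= (0 : R) <= 1).
      by rewrite lexx ler01.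
    rewrite ler_wpM2l//; apply: ler_pM => //; first by rewrite sumr_ge0.
      exact: le_trans (normc_ge0 _) (solves_near_source prim hP lk (o, a0) sS (hU a0) zb).
    rewrite (@le_trans _ _ (m%:R * `|c a0|))//.
      by rewrite -[X in X%:R * _](card_ord m) mulr_natl -sumr_const; apply: ler_sum => b _; exact: amax.
    by rewrite ler_wpM2r// ler_nat.
  have -> : n%:R * (m.+1%:R * `|c a0| * eps) = `|c a0| / 2.
    have : (m.+1%:R : R) != 0 by rewrite pnatr_eq0.
    have : (n%:R : R) != 0 by rewrite pnatr_eq0 -lt0n.
    by rewrite /eps; move: (m.+1%:R : R) (n%:R : R) => M N M0 N0; field; rewrite M0 N0.
  lra.
- by move=> b x; apply: wave_equation.
Qed.

End bloch.

(** * Square-integrable periodic functions *)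

Section periodic_coefficients.
Variable R : realType.
Local Notation C := R[i].
Local Notation mu := (@lebesgue_measure R).
Local Notation RT := (measurableTypeR R).
Local Notation rintegrable D k := (mu.-integrable D (EFin \o k)).

(** The coefficients are periodic off a null set only; its integer translates
    are countably many, so one null set serves for all cells. *)
Lemma per_ae (p : R -> C) : {ae mu, forall x, p (x + 1) = p x} ->
  {ae mu, forall x, 0 <= x -> p x = per p x}.
Proof.
move=> hp; have h (q : nat) : {ae mu, forall x, p (x + q%:R) = p x}.
  elim: q => [|q ih]; first by apply: aeW => x; rewrite addr0.
  apply: ae_imp2 (mpres_ae (mpres_shift q%:R) hp) ih => x h1 h2.
  by rewrite -h2 -h1 -natr1 addrA.
have h' : {ae mu, forall x, forall q : nat, p x = p (x - q%:R)}.
  apply/ae_foralln => q; apply: ae_imp (mpres_ae (mpres_shift (- q%:R)) (h q)) => x.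
  by rewrite subrK.
apply: ae_imp h' => x hx x0; have [q qx] : exists q : nat, Num.floor x = q%:Z.
  by exists `|Num.floor x|%N; rewrite gez0_abs// floor_ge0.
by rewrite /per qx; exact: hx.
Qed.

(** Once its mean is subtracted, f has a periodic primitive. *)
Lemma per_mean (f : R -> C) (N : nat) : cintegrable `[0, 1] f ->
  cintegrable `[0, N%:R] (per f) /\ cint `[0, N%:R] (per f) = N%:R * cint `[0, 1] f.
Proof.
move=> fi; have N0 : 0 <= N%:R :> R by [].
set z := cint `[0, 1] f.
have zi (a b : R) : cintegrable `[a, b] (fun=> - z) by exact: cintegrable_cst.
have gi : cintegrable `[0, 1] (fun x => f x + - z) by exact: cintegrableD.
have zE b : 0 <= b -> cint `[0, b] (fun=> - z) = - (b%:C%C * z).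
  move=> b0; apply: ceqP; rewrite /= ?cReN ?cImN ?cReM ?cImM /= !Rint_cst//; ring.
pose G x := cint `[0, x] (fun x => f x + - z).
have pG : primitive 1 G (fun x => f x + - z).
  by split=> // x _; rewrite /G cint_set1 add0r.
have G1 : G 1 = G 0.
  by rewrite /G cint_set1 cintD// zE// mul1r subrr.
have [gN hG] := primitive_per N pG G1.
have eN : per f = (fun x => per (fun x => f x + - z) x + z).
  by apply/funext => x; rewrite /per subrK.
have fN : cintegrable `[0, N%:R] (per f).
  by rewrite eN; apply: cintegrableD => //; exact: cintegrable_cst.
split=> //; have NN : is_true (0 <= (N%:R : R) <= N%:R) by rewrite N0 lexx.
have := hG _ NN; rewrite !per_nat -[in per G 0](mulr0n 1) per_nat => /eqP.
rewrite -subr_eq0 opprD addrA subrr add0r oppr_eq0 => /eqP.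
rewrite (_ : per _ = (fun x => per f x + - z))//.
rewrite cintD// zE// => /eqP; rewrite subr_eq0 => /eqP ->.
by rewrite (rmorph_nat (real_complex R)).
Qed.

Lemma per_Rmean (k : R -> R) (N : nat) : rintegrable `[0, 1] k ->
  rintegrable `[0, N%:R] (per k) /\
  \int[mu]_(x in `[0, N%:R]) per k x = N%:R * \int[mu]_(x in `[0, 1]) k x.
Proof.
move=> ki; have ci : cintegrable `[0, 1] (fun x => (k x)%:C%C).
  by split=> //; exact: rintegrable_cst.
have [[h1 h2] h3] := per_mean N ci; split=> //.
have := congr1 (@complex.Re R) h3.
by rewrite -(rmorph_nat (real_complex R)) cReM /= mul0r subr0.
Qed.

Definition square_integrable (D : set RT) (k : R -> R) :=
  measurable_fun D (k : RT -> R) /\ rintegrable D (fun x => k x ^+ 2).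

Lemma square_integrableD D k k' : measurable D -> square_integrable D k ->
  square_integrable D k' -> square_integrable D (fun x => k x + k' x).
Proof.
move=> mD [mk ik] [mk' ik']; split; first exact: measurable_funD.
apply: (@rintegrable_dom _ _ _ (fun x => 2 * k x ^+ 2 + 2 * k' x ^+ 2)) => //.
- by apply: measurable_funX; exact: measurable_funD.
- by apply: rintegrableD => //; exact: rintegrableZ.
- move=> x _; rewrite ger0_norm ?sqr_ge0//.
  have : 0 <= (k x - k' x) ^+ 2 by exact: sqr_ge0.
  by rewrite !expr2; nra.
Qed.

Lemma square_integrable_sum (a b : R) (I : Type) (s : seq I) (Q : pred I) (F : I -> R -> R) :
  (forall i, Q i -> square_integrable `[a, b] (F i)) ->
  square_integrable `[a, b] (fun x => \sum_(i <- s | Q i) F i x).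
Proof.
move=> h; elim: s => [|i s ih].
  rewrite (_ : (fun x => _) = (fun=> 0)); last by apply/funext => x; rewrite big_nil.
  by split; [exact: measurable_cst|exact: rintegrable_cst].
have [Qi|Qi] := boolP (Q i).
  rewrite (_ : (fun x => _) = (fun x => F i x + \sum_(j <- s | Q j) F j x)).
    by apply: square_integrableD => //; exact: h.
  by apply/funext => x; rewrite big_cons Qi.
rewrite (_ : (fun x => _) = (fun x => \sum_(j <- s | Q j) F j x))//.
by apply/funext => x; rewrite big_cons (negbTE Qi).
Qed.

Lemma square_integrable_dom (D : set RT) (f : R -> C) (k : R -> R) (M : R) : measurable D ->
  cmeas D f -> rintegrable D (fun x => k x ^+ 2) ->
  (forall x, D x -> normc (f x) <= M * k x) -> rintegrable D (fun x => normc (f x) ^+ 2).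
Proof.
move=> mD mf ik h; apply: (@rintegrable_dom _ _ _ (fun x => M ^+ 2 * k x ^+ 2)) => //.
- exact: (measurable_funX 2 (cmeas_normc mf)).
- exact: rintegrableZ.
- move=> x /h hx; rewrite ger0_norm ?sqr_ge0// -exprMn lerXn2r ?nnegrE ?normc_ge0//.
  exact: le_trans (normc_ge0 _) hx.
Qed.

Lemma Rintegral_cut (N : R) (k : R -> R) : \int[mu]_x cut N k x = \int[mu]_(x in `[0, N]) k x.
Proof. by rewrite cut_restrict [RHS]Rintegral_mkcond. Qed.

Lemma L2_cut (N : R) (f : R -> C) : cmeas `[0, N] f ->
  rintegrable `[0, N] (fun x => normc (f x) ^+ 2) -> L2 setT (cut N f).
Proof.
move=> [mr mi] fi; split.
- have -> : (fun x => cRe (cut N f x)) = cut N (fun x => cRe (f x)).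
    by apply/funext => x; rewrite /cut; case: ifP.
  by rewrite cut_restrict; apply/(measurable_restrictT _ _).1.
- have -> : (fun x => cIm (cut N f x)) = cut N (fun x => cIm (f x)).
    by apply/funext => x; rewrite /cut; case: ifP.
  by rewrite cut_restrict; apply/(measurable_restrictT _ _).1.
- have := rintegrable_cut fi.
  have <- : (fun x => normc (cut N f x) ^+ 2) = cut N (fun x => normc (f x) ^+ 2).
    by apply/funext => x; rewrite /cut; case: ifP => // _; rewrite ComplexField.Normc.normc0 expr0n.
  move=> /integrableP[_]; congr (_ < _)%E; apply: eq_integral => x _ /=.
  by rewrite ger0_norm// sqr_ge0.
Qed.

End periodic_coefficients.

(** * Approximate eigenfunctions *)

Section approximate_eigenfunctions.
Variable R : realType.
Local Notation C := R[i].
Local Notation mu := (@lebesgue_measure R).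
Local Notation RT := (measurableTypeR R).
Local Notation rintegrable D k := (mu.-integrable D (EFin \o k)).

Variables (n m : nat) (P : nat -> R -> 'M[C]_m) (kap : R).
Hypothesis n0 : (0 < n)%N.
Hypothesis hP : forall (k : nat) (i j : 'I_m), (2 <= k <= n)%N ->
  PT_periodic_L2 (fun x => P k x i j).
Variables (v : nat -> 'I_m -> R -> C) (V d : R) (a0 : 'I_m).
Hypothesis hv : forall q a (N : nat), (q < n)%N -> primitive N%:R (v q a) (v q.+1 a).
Hypotheses (V0 : 0 <= V) (hV : forall q a x, (q < n)%N -> normc (v q a x) <= V).
Hypotheses (d0 : 0 < d) (hd : forall x, d <= normc (v 0%N a0 x)).
Hypothesis ode : forall a x, (- 'i%C) ^+ n * v n a x +
  \sum_(2 <= k < n.+1) (- 'i%C) ^+ (n - k) * (\sum_b per (P k) x a b * v (n - k)%N b x) =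
  (kap ^+ n)%:C%C * v 0%N a x.

Let dominant x := 1 + weight n P x.

Let dominant_ge1 x : 1 <= dominant x.
Proof.
rewrite lerDl /weight; do 3!(apply: sumr_ge0 => ? _); exact: normc_ge0.
Qed.

Lemma dominant_square_integrable : rintegrable `[0, 1] (fun x => dominant x ^+ 2).
Proof.
suff [] : square_integrable `[0, 1] dominant by [].
apply: square_integrableD => //; first by split; [exact: measurable_cst|exact: rintegrable_cst].
apply: square_integrable_sum => k k2; apply: square_integrable_sum => a _.
apply: square_integrable_sum => b _.
have kn : (2 <= k <= n)%N by rewrite k2 -ltnS ltn_ord.
have [h _ _] := hP a b kn.
by split; [exact: (cmeas_normc (L2_meas h))|exact: L2_sqr].
Qed.

Lemma order_term_bound (a : 'I_m) y (r : nat -> 'I_m -> C) (B : R) : 0 <= B ->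
  (forall k b, (2 <= k <= n)%N -> normc (r k b) <= B) ->
  normc (\sum_(2 <= k < n.+1) (- 'i%C) ^+ (n - k) * (\sum_b P k y a b * r k b)) <= weight n P y * B.
Proof.
move=> B0 h; rewrite (le_trans (ler_normc_sum _ _ _))// big_geq_mkord /weight mulr_suml.
apply: ler_sum => k k2.
rewrite ComplexField.Normc.normcM normcX normc_opp normc_i expr1n mul1r.
rewrite (le_trans (ler_normc_sum _ _ _))// [X in _ <= X * _](bigD1 a)//= mulrDl -[leLHS]addr0 lerD//.
  rewrite mulr_suml; apply: ler_sum => b _; rewrite ComplexField.Normc.normcM ler_wpM2l ?normc_ge0//.
  by apply: h; rewrite (k2 : (1 < k)%N) -ltnS ltn_ord.
by rewrite mulr_ge0// sumr_ge0// => ? _; rewrite sumr_ge0// => ? _; exact: normc_ge0.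
Qed.

Lemma normc_ipow q : normc ((- 'i%C : C) ^+ q) = 1.
Proof. by rewrite normcX normc_opp normc_i expr1n. Qed.

(** The n-th derivative is unbounded, but the equation expresses it by the
    bounded lower ones and the coefficients. *)
Lemma wave_dominated q a x : (q <= n)%N -> normc (v q a x) <= (`|kap ^+ n| + 1) * V * per dominant x.
Proof.
move=> qn; have h1 : 1 <= per dominant x by exact: dominant_ge1.
have c0 : 0 <= `|kap ^+ n| by [].
have [->|qn'] := eqVneq q n; last first.
  have := hV a x (_ : (q < n)%N); rewrite ltn_neqAle qn' qn => /(_ isT) h.
  have : V <= (`|kap ^+ n| + 1) * V by rewrite ler_peMl// lerDr.
  have : (`|kap ^+ n| + 1) * V <= (`|kap ^+ n| + 1) * V * per dominant x.
    by rewrite ler_peMr// mulr_ge0// addr_ge0.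
  lra.
have := ode a x => /(congr1 (fun z => z - \sum_(2 <= k < n.+1) (- 'i%C) ^+ (n - k) *
   (\sum_b per (P k) x a b * v (n - k)%N b x))); rewrite addrK => /(congr1 (@normc R)).
rewrite ComplexField.Normc.normcM normc_ipow mul1r => ->.
rewrite (le_trans (normcB _ _))//.
have -> : (`|kap ^+ n| + 1) * V * per dominant x = `|kap ^+ n| * V + `|kap ^+ n| * V * (per dominant x - 1) + V + per (weight n P) x * V.
  by rewrite /per /dominant; ring.
rewrite lerD//.
  rewrite ComplexField.Normc.normcM normc_real (@le_trans _ _ (`|kap ^+ n| * V))//.
    by rewrite ler_wpM2l// hV.
  by rewrite -addrA lerDl addr_ge0// !mulr_ge0// subr_ge0.
by apply: order_term_bound => // k b kn; apply: hV; lia.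
Qed.

Section truncation.
Variable N : nat.
Hypothesis N1 : (0 < N)%N.
Let chi := cutoff n (N%:R : R).
Let NR : 0 <= N%:R :> R. Proof. by []. Qed.

Definition truncated p a := leibniz chi (fun q => v q a) p.

(** The differential expression applied to the truncated wave. *)
Definition image a x : C := (- 'i%C) ^+ n * truncated n a x +
  \sum_(2 <= k < n.+1) (- 'i%C) ^+ (n - k) * (\sum_b per (P k) x a b * truncated (n - k) b x).

Lemma truncated_primitive p a : (p < n)%N -> primitive N%:R (truncated p a) (truncated p.+1 a).
Proof.
move=> pn; apply: primitive_leibniz => // q qp; apply: hv; exact: leq_ltn_trans pn.
Qed.

Lemma truncated_left p a : (p < n)%N -> truncated p a 0 = 0.
Proof.
by move=> pn; apply: leibniz_vanish => k kp; apply: cutoff_left; exact: leq_ltn_trans pn.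
Qed.

Lemma truncated_right p a : (p < n)%N -> truncated p a N%:R = 0.
Proof.
move=> pn; apply: leibniz_vanish => k kp; apply: cutoff_right; last exact: leq_ltn_trans pn.
by rewrite pnatr_eq0 -lt0n.
Qed.

Lemma truncated_meas p a : (p <= n)%N -> cmeas `[0, N%:R] (truncated p a).
Proof.
move=> pn; have [->|p0] := eqVneq p n.
  have nn : (n.-1 < n)%N by rewrite prednK.
  by have [+ _] := truncated_primitive a nn; rewrite prednK// => /cintegrable_meas.
by apply: cmeas_primitive (truncated_primitive a _) => //; rewrite ltn_neqAle p0.
Qed.

Lemma truncated_dominated p a : (p <= n)%N ->
  exists2 M, 0 <= M & forall x, 0 <= x <= N%:R -> normc (truncated p a x) <= M * per dominant x.
Proof.
move=> pn.
pose b k : R := normc ((chi^`(k)).[0])%:C%C + 2 * \int[mu]_(t in `[0, N%:R]) normc ((chi^`(k)^`()).[t])%:C%C.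
have hb k x : 0 <= x <= N%:R -> `|(chi^`(k)).[x]| <= b k.
  by move=> xb; have := primitive_bounded (primitive_poly (chi^`(k)) NR) xb; rewrite normc_real.
have b0 k : 0 <= b k by apply: le_trans (hb k 0 _); rewrite ?lexx.
exists (\sum_(q < p.+1) b (p - q)%N * ((`|kap ^+ n| + 1) * V) *+ 'C(p, q)).
  by apply: sumr_ge0 => q _; rewrite mulrn_wge0// !mulr_ge0// addr_ge0.
move=> x xb; rewrite /truncated /leibniz (le_trans (ler_normc_sum _ _ _))// mulr_suml.
apply: ler_sum => q _; rewrite -mulrnAl -[in leLHS]mulr_natr ComplexField.Normc.normcM.
rewrite ComplexField.Normc.normcM -(rmorph_nat (real_complex R)) !normc_real (ger0_norm (ler0n _ _)).
rewrite mulrAC mulr_natr mulrnAl lerMn2r; apply/orP; right.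
rewrite -mulrA ler_pM ?normc_ge0//; first exact: hb.
by apply: wave_dominated; rewrite (leq_trans _ pn)// -ltnS.
Qed.

Lemma dominant_sqr_N : rintegrable `[0, N%:R] (fun x => per dominant x ^+ 2).
Proof. by have [h _] := per_Rmean N dominant_square_integrable. Qed.

Lemma truncated_sqr p a : (p <= n)%N -> rintegrable `[0, N%:R] (fun x => normc (truncated p a x) ^+ 2).
Proof.
move=> pn; have [M M0 hM] := truncated_dominated a pn.
have tm := truncated_meas a pn.
by apply: (square_integrable_dom _ tm dominant_sqr_N) => // x; rewrite /= in_itv/=; exact: hM.
Qed.

Lemma image_meas a : cmeas `[0, N%:R] (image a).
Proof.
apply: cmeasD; first by apply: cmeasZ; exact: truncated_meas.
rewrite (_ : (fun x => _) = (fun x => \sum_(k <- index_iota 2 n.+1 | k \in index_iota 2 n.+1)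
   (- 'i%C) ^+ (n - k) * (\sum_b per (P k) x a b * truncated (n - k) b x))); last first.
  by apply/funext => x; rewrite big_seq.
apply: cmeas_sum => k; rewrite mem_index_iota => kn; apply: cmeasZ; apply: cmeas_sum => b _.
apply: cmeasM; last by apply: truncated_meas; exact: leq_subr.
have [h _] := per_mean N (P_integrable hP a b kn).
exact: cintegrable_meas h.
Qed.

Lemma truncated0 a x : truncated 0 a x = (chi.[x])%:C%C * v 0%N a x.
Proof. by rewrite /truncated /leibniz big_ord1 /= mulr1n. Qed.

Definition approx x : 'cV[C]_m := \col_a cut N%:R (truncated 0 a) x.
Definition approx_image x : 'cV[C]_m := \col_a cut N%:R (image a) x.

(** On the middle half of [0, N] the cutoff is at least (3 / 16)^n. *)
Lemma approx_lower :
  ((3 / 16) ^+ n * d) ^+ 2 * (N%:R / 2) <= \int[mu]_x (\sum_j normc (approx x j 0) ^+ 2).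
Proof.
have -> : (fun x => \sum_j normc (approx x j 0) ^+ 2) = cut N%:R (fun x => \sum_j normc (truncated 0 j x) ^+ 2).
  apply/funext => x; under eq_bigr do rewrite mxE.
  by rewrite /cut; case: ifP => // _; rewrite big1// => j _; rewrite ComplexField.Normc.normc0 expr0n.
have si : rintegrable `[0, N%:R] (fun x => \sum_j normc (truncated 0 j x) ^+ 2).
  by apply: rintegrable_sum => // j _; exact: truncated_sqr.
have s0 x : 0 <= \sum_j normc (truncated 0 j x) ^+ 2 by apply: sumr_ge0 => j _; exact: sqr_ge0.
have Np : 0 < N%:R :> R by rewrite ltr0n.
have [q1 q2 q3] : [/\ 0 <= (N%:R : R) / 4, (N%:R : R) / 4 <= 3 * N%:R / 4 & 3 * (N%:R : R) / 4 <= N%:R] by split; lra.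
rewrite Rintegral_cut (@Rintegral_split _ 0 (N%:R / 4) N%:R)//; last exact: le_trans q3.
have si' : rintegrable `[N%:R / 4, N%:R] (fun x => \sum_j normc (truncated 0 j x) ^+ 2).
  by apply: rintegrable_sub si => //; lra.
rewrite (@Rintegral_split _ (N%:R / 4) (3 * N%:R / 4) N%:R)//.
have si'' : rintegrable `[N%:R / 4, 3 * N%:R / 4] (fun x => \sum_j normc (truncated 0 j x) ^+ 2).
  by apply: rintegrable_sub si' => //; lra.
have -> : ((3 / 16) ^+ n * d) ^+ 2 * (N%:R / 2) = \int[mu]_(x in `[N%:R / 4, 3 * N%:R / 4]) (((3 / 16) ^+ n * d) ^+ 2).
  rewrite Rint_cst; last lra.
  by congr (_ * _); field.
have i1 : 0 <= \int[mu]_(x in `[0, N%:R / 4]) \sum_j normc (truncated 0 j x) ^+ 2 by apply: Rintegral_ge0.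
have i2 : 0 <= \int[mu]_(x in `[3 * N%:R / 4, N%:R]) \sum_j normc (truncated 0 j x) ^+ 2 by apply: Rintegral_ge0.
have i3 : \int[mu]_(x in `[N%:R / 4, 3 * N%:R / 4]) (((3 / 16) ^+ n * d) ^+ 2) <=
    \int[mu]_(x in `[N%:R / 4, 3 * N%:R / 4]) \sum_j normc (truncated 0 j x) ^+ 2.
  apply: Rint_le => //; first exact: rintegrable_cst.
  move=> x; rewrite /= in_itv/= => xb; rewrite (bigD1 a0)//= -[leLHS]addr0 lerD//; last first.
    by apply: sumr_ge0 => j _; exact: sqr_ge0.
  have c0 : 0 <= (3 / 16) ^+ n :> R by rewrite exprn_ge0//; lra.
  have cm := cutoff_middle n Np xb.
  rewrite lerXn2r ?nnegrE ?normc_ge0 ?mulr_ge0 ?(ltW d0)//.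
  rewrite truncated0 ComplexField.Normc.normcM normc_real ler_pM ?(ltW d0)//.
  exact: le_trans (ler_norm _).
apply: (le_trans i3); rewrite -[leLHS]add0r lerD// lerDl; exact: i2.
Qed.

Variable B : R.
Hypotheses (B0 : 0 <= B) (hB : forall k x, (0 < k <= n)%N -> 0 <= x <= N%:R -> `|chi^`(k).[x]| <= B / N%:R).

(** By the equation for v, the terms in which no derivative falls on the cutoff
    cancel. *)
Lemma residual_bound a x : 0 <= x <= N%:R ->
  normc (image a x - (kap ^+ n)%:C%C * truncated 0 a x) <= B / N%:R * V * 2 ^+ n * per dominant x.
Proof.
move=> xb; pose rem p b := truncated p b x - (chi.[x])%:C%C * v p b x.
have BN : 0 <= B / N%:R by rewrite divr_ge0.
have hrem p b : (p <= n)%N -> normc (rem p b) <= B / N%:R * V * 2 ^+ n.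
  move=> pn; apply: (@le_trans _ _ (B / N%:R * V * 2 ^+ p)).
    apply: leibniz_remainder => // [k /andP[k0 kp]|q qp].
      by apply: hB => //; rewrite k0 (leq_trans kp).
    by apply: hV; exact: leq_trans pn.
  by rewrite ler_wpM2l ?mulr_ge0// ler_weXn2l ?ler1n.
have -> : image a x - (kap ^+ n)%:C%C * truncated 0 a x = (- 'i%C) ^+ n * rem n a +
    \sum_(2 <= k < n.+1) (- 'i%C) ^+ (n - k) * (\sum_b per (P k) x a b * rem (n - k)%N b).
  rewrite truncated0 mulrCA -ode mulrDr mulr_sumr opprD addrACA -sumrB; congr (_ + _).
    by rewrite /rem; ring.
  apply: eq_bigr => k _; rewrite mulrCA -mulrBr mulr_sumr -sumrB; congr (_ * _).
  by apply: eq_bigr => b _; rewrite /rem; ring.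
rewrite (le_trans (normcD _ _))//.
have -> : B / N%:R * V * 2 ^+ n * per dominant x = B / N%:R * V * 2 ^+ n + per (weight n P) x * (B / N%:R * V * 2 ^+ n).
  by rewrite /per /dominant; ring.
rewrite lerD//; first by rewrite ComplexField.Normc.normcM normc_ipow mul1r hrem.
apply: order_term_bound => [|k b kn]; first by rewrite !mulr_ge0.
by apply: hrem; exact: leq_subr.
Qed.

Lemma image_sqr a : rintegrable `[0, N%:R] (fun x => normc (image a x) ^+ 2).
Proof.
have [M M0 hM] := truncated_dominated a (leq0n n).
apply: (square_integrable_dom (M := B / N%:R * V * 2 ^+ n + `|kap ^+ n| * M) _ (image_meas a) dominant_sqr_N) => // x.
rewrite /= in_itv/= => xb; rewrite mulrDl -[X in normc X](subrK ((kap ^+ n)%:C%C * truncated 0 a x)).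
rewrite (le_trans (normcD _ _))// lerD//; first exact: residual_bound.
by rewrite ComplexField.Normc.normcM normc_real -mulrA ler_wpM2l// hM.
Qed.

Lemma truncated_smooth_Re a p : (p < n)%N ->
  [/\ rintegrable `[0, N%:R] (fun x => cRe (truncated p.+1 a x)),
      rintegrable `[0, N%:R] (fun x => cRe (truncated p.+1 a x) ^+ 2),
      forall x, 0 <= x <= N%:R -> cRe (truncated p a x) = \int[mu]_(t in `[0, x]) cRe (truncated p.+1 a t) &
      cRe (truncated p a N%:R) = 0].
Proof.
move=> pn; have [[ir ii] h] := truncated_primitive a pn; split=> //.
- apply: (@rintegrable_dom _ _ _ (fun x => normc (truncated p.+1 a x) ^+ 2)) => //.
  + by apply: measurable_funX; exact: rintegrable_meas ir.
  + exact: truncated_sqr.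
  + by move=> x _; rewrite ger0_norm ?sqr_ge0// normc_sqr lerDl sqr_ge0.
- by move=> x /h ->; rewrite truncated_left// add0r.
- by rewrite truncated_right.
Qed.

Lemma truncated_smooth_Im a p : (p < n)%N ->
  [/\ rintegrable `[0, N%:R] (fun x => cIm (truncated p.+1 a x)),
      rintegrable `[0, N%:R] (fun x => cIm (truncated p.+1 a x) ^+ 2),
      forall x, 0 <= x <= N%:R -> cIm (truncated p a x) = \int[mu]_(t in `[0, x]) cIm (truncated p.+1 a t) &
      cIm (truncated p a N%:R) = 0].
Proof.
move=> pn; have [[ir ii] h] := truncated_primitive a pn; split=> //.
- apply: (@rintegrable_dom _ _ _ (fun x => normc (truncated p.+1 a x) ^+ 2)) => //.
  + by apply: measurable_funX; exact: rintegrable_meas ii.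
  + exact: truncated_sqr.
  + by move=> x _; rewrite ger0_norm ?sqr_ge0// normc_sqr lerDr sqr_ge0.
- by move=> x /h ->; rewrite truncated_left// add0r.
- by rewrite truncated_right.
Qed.

Lemma reC_approx a : reC approx a = cut N%:R (fun x => cRe (truncated 0 a x)).
Proof. by apply/funext => x; rewrite /reC mxE /cut; case: ifP. Qed.

Lemma imC_approx a : imC approx a = cut N%:R (fun x => cIm (truncated 0 a x)).
Proof. by apply/funext => x; rewrite /imC mxE /cut; case: ifP. Qed.

Lemma cut_complex (f : R -> C) x : (cut N%:R (fun x => cRe (f x)) x +i* cut N%:R (fun x => cIm (f x)) x)%C = cut N%:R f x :> C.
Proof. by rewrite /cut; case: ifP => // _; case: (f x). Qed.

Lemma approx_domain : opT n P approx approx_image.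
Proof.
have sRe a := cut_smooth NR n0 (@truncated_smooth_Re a).
have sIm a := cut_smooth NR n0 (@truncated_smooth_Im a).
split.
- move=> a; rewrite (_ : (fun x => _) = cut N%:R (truncated 0 a)).
    by apply: L2_cut; [exact: truncated_meas|exact: truncated_sqr].
  by apply/funext => x; rewrite mxE.
- move=> a; rewrite reC_approx imC_approx.
  by have [h1 _ _] := sRe a; have [h2 _ _] := sIm a; split.
- move=> a; rewrite (_ : (fun x => _) = cut N%:R (image a)).
    by apply: L2_cut; [exact: image_meas|exact: image_sqr].
  by apply/funext => x; rewrite mxE.
have dlow k x : (k < n)%N -> vderiv k approx x = \col_a cut N%:R (truncated k a) x.
  move=> kn; apply/colP => a; rewrite !mxE reC_approx imC_approx -cut_complex.
  have [_ h1 _] := sRe a; have [_ h2 _] := sIm a.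
  by rewrite (h1 k kn) (h2 k kn).
have dtop : {ae mu, forall x, vderiv n approx x = \col_a cut N%:R (truncated n a) x}.
  have : {ae mu, forall x, forall a : 'I_m, (derive1n n (reC approx a) x +i* derive1n n (imC approx a) x)%C = cut N%:R (truncated n a) x}.
    apply: ae_forall_fin => a; have [_ _ h1] := sRe a; have [_ _ h2] := sIm a.
    by apply: ae_imp2 h1 h2 => x e1 e2; rewrite reC_approx imC_approx e1 e2 cut_complex.
  by apply: ae_imp => x h; apply/colP => a; rewrite !mxE h.
have hper : {ae mu, forall x, forall k : 'I_n.+1, forall ab : 'I_m * 'I_m, (2 <= k)%N -> 0 <= x -> P k x ab.1 ab.2 = per (P k) x ab.1 ab.2}.
  apply: ae_forall_fin => k; apply: ae_forall_fin => -[a b] /=.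
  have [k2|k2] := boolP (2 <= k)%N; last by apply: aeW.
  have kn : (2 <= k <= n)%N by rewrite k2 -ltnS ltn_ord.
  have [_ h _] := hP a b kn.
  by apply: ae_imp (per_ae h) => x e _ x0; exact: e.
apply: ae_imp2 dtop hper => x e1 e2; apply/colP => a.
rewrite /diff_expr e1 mxE [RHS]mxE mxE mxE summxE /cut.
case: ifP => [/andP[x0 xN]|xb]; last first.
  rewrite mulr0 add0r big_nat_cond big1// => k /andP[/andP[k2 kn] _].
  rewrite dlow ?mxE; last lia.
  by rewrite big1 ?mulr0// => b _; rewrite mxE /cut xb mulr0.
rewrite /image; congr (_ + _); apply: eq_big_nat => k /andP[k2 kn].
rewrite dlow; last lia.
rewrite mxE mxE; congr (_ * _); apply: eq_bigr => b _.
by rewrite mxE /cut x0 xN (e2 (Ordinal kn) (a, b) k2 x0).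
Qed.

(** The square of the defect is O(1 / N^2) in mean on each of the N cells. *)
Lemma approx_upper :
  \int[mu]_x (\sum_j normc ((approx_image x - (kap ^+ n)%:C%C *: approx x) j 0) ^+ 2) <=
  m%:R * (B * V * 2 ^+ n) ^+ 2 * \int[mu]_(x in `[0, 1]) dominant x ^+ 2.
Proof.
have Np : 0 < N%:R :> R by rewrite ltr0n.
pose E j x := image j x - (kap ^+ n)%:C%C * truncated 0 j x.
have -> : (fun x => \sum_j normc ((approx_image x - (kap ^+ n)%:C%C *: approx x) j 0) ^+ 2) =
    cut N%:R (fun x => \sum_j normc (E j x) ^+ 2).
  apply/funext => x; under eq_bigr do rewrite !mxE.
  rewrite /cut; case: ifP => // _; rewrite big1// => j _.
  by rewrite mulr0 subrr ComplexField.Normc.normc0 expr0n.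
have mE j : cmeas `[0, N%:R] (E j).
  apply: cmeasD; first exact: image_meas.
  by apply: cmeasN; apply: cmeasZ; exact: truncated_meas.
have hE j x : `[0, N%:R]%classic x -> normc (E j x) <= B / N%:R * V * 2 ^+ n * per dominant x.
  by rewrite /= in_itv/=; exact: residual_bound.
have [iD eD] := per_Rmean N dominant_square_integrable.
rewrite Rintegral_cut (@le_trans _ _ (\int[mu]_(x in `[0, N%:R]) (m%:R * (B / N%:R * V * 2 ^+ n) ^+ 2 * per dominant x ^+ 2)))//.
  apply: Rint_le => //.
  - apply: rintegrable_sum => // j _.
    by apply: (square_integrable_dom _ (mE j) dominant_sqr_N) => // x; exact: hE.
  - exact: (rintegrableZ (m%:R * (B / N%:R * V * 2 ^+ n) ^+ 2)).
  move=> x xb; rewrite -mulrA -[X in X%:R * _](card_ord m) mulr_natl -sumr_const.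
  apply: ler_sum => j _; rewrite -exprMn lerXn2r ?nnegrE ?normc_ge0 ?hE//.
  exact: le_trans (normc_ge0 _) (hE j x xb).
rewrite RintegralZl// eD.
have D0 : 0 <= \int[mu]_(x in `[0, 1]) dominant x ^+ 2 by apply: Rintegral_ge0 => x _; exact: sqr_ge0.
have -> : m%:R * (B / N%:R * V * 2 ^+ n) ^+ 2 * (N%:R * \int[mu]_(x in `[0, 1]) dominant x ^+ 2) =
   m%:R * (B * V * 2 ^+ n) ^+ 2 * (\int[mu]_(x in `[0, 1]) dominant x ^+ 2) / N%:R.
  by field; rewrite gt_eqF.
by rewrite ler_pdivrMr// ler_peMr ?mulr_ge0 ?sqr_ge0// ler1n.
Qed.

End truncation.

(** The norms of the truncated waves grow like the square root of N, while their
    defects stay bounded. *)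
Lemma bloch_in_spectrum : spectrum (opT n P) (kap ^+ n)%:C%C.
Proof.
move=> [_ _ [K hK]].
have [B B0 hB] := cutoff_deriv_bound R n.
set A := m%:R * (B * V * 2 ^+ n) ^+ 2 * \int[mu]_(x in `[0, 1]) dominant x ^+ 2.
set c := ((3 / 16) ^+ n * d) ^+ 2.
have c0 : 0 < c by rewrite exprn_gt0// mulr_gt0// exprn_gt0//; lra.
have key N : (0 < N)%N -> c * (N%:R / 2) <= K ^+ 2 * A.
  move=> N1; have hB' k x : (0 < k <= n)%N -> 0 <= x <= N%:R -> `|(cutoff n (N%:R : R))^`(k).[x]| <= B / N%:R.
    by move=> kn xb; apply: hB => //; rewrite ler1n.
  have low := approx_lower N1; have up := approx_upper N1 B0 hB'.
  have := hK _ _ (approx_domain N1 B0 hB'); rewrite /L2norm.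
  move: low up; set x := (\int[mu]_x _); set y := (\int[mu]_x _) => low up le_xy.
  have y0 : 0 <= y by apply: Rintegral_ge0 => t _; apply: sumr_ge0 => j _; exact: sqr_ge0.
  have x0 : 0 <= x by apply: le_trans low; rewrite mulr_ge0 ?(ltW c0)// divr_ge0.
  apply: (le_trans low); rewrite -(sqr_sqrtr x0) (@le_trans _ _ ((K * Num.sqrt y) ^+ 2))//.
    by rewrite lerXn2r ?nnegrE ?sqrtr_ge0// (le_trans _ le_xy)// sqrtr_ge0.
  by rewrite exprMn sqr_sqrtr// ler_wpM2l// sqr_ge0.
have A0 : 0 <= A.
  by rewrite !mulr_ge0 ?sqr_ge0//; apply: Rintegral_ge0 => t _; exact: sqr_ge0.
pose X := 2 * (K ^+ 2 * A) / c.
have X0 : 0 <= X by rewrite divr_ge0 ?(ltW c0)// mulr_ge0// mulr_ge0// sqr_ge0.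
have hX := archi_boundP X0.
have N1 : (0 < Num.bound X)%N by rewrite -(ltr0n R) (le_lt_trans X0).
have := key _ N1; move: hX; rewrite /X ltr_pdivrMr//; lra.
Qed.

End approximate_eigenfunctions.

Lemma odd_root (R : realType) n (lam : R) : odd n -> exists kap, kap ^+ n = lam.
Proof.
move=> on; have n0 : (0 < n)%N by case: n on.
have nn0 : n%:R != 0 :> R by rewrite pnatr_eq0 -lt0n.
exists (Num.sg lam * (`|lam| `^ n%:R^-1)).
rewrite exprMn -(powR_mulrn n (powR_ge0 _ _)) -powRrM mulVf// powRr1//.
rewrite [RHS]numEsg; congr (_ * _).
have [->|l0] := eqVneq lam 0; first by rewrite sgr0 expr0n; case: n on n0 {nn0}.
by rewrite -(odd_double_half n) on exprS -mul2n exprM sqr_sg l0 expr1n mulr1.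
Qed.

Theorem theorem4 (R : realType) (n m : nat) (P : nat -> R -> 'M[R[i]]_m)
    (mu : R) (hn : (2 < n)%N) (odd_n : odd n) (hm : (1 <= m)%N)
    (hP : forall (k : nat) (i j : 'I_m), (2 <= k <= n)%N ->
       PT_periodic_L2 (fun x => P k x i j))
    (hmu : eigenvalue (Cmatrix P) (mu%:C)%C)
    (odd_mu : odd (mup (mu%:C)%C (char_poly (Cmatrix P)))) :
  exists2 H : R, 0 <= H &
    [set (lambda%:C)%C | lambda in `]-oo, - H] `|` `[H, +oo[] `<=`
      spectrum (opT n P).
Proof.
have n0 : (0 < n)%N by apply: ltn_trans hn.
have [w prim] := exists_prim_root R n0.
have [K hK] := bloch_wave hn odd_n prim hP odd_mu.
exists (`|K| ^+ n); first by rewrite exprn_ge0.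
move=> _ [lam hlam <-].
have lamK : `|K| ^+ n <= `|lam|.
  case: hlam => /=; rewrite in_itv/= ?andbT => h; last by apply: le_trans (ler_norm _).
  by rewrite -(normrN lam); apply: le_trans (ler_norm _); rewrite lerNr.
have [kap kapn] := odd_root lam odd_n.
have kapK : K <= `|kap|.
  apply: le_trans (ler_norm _) _; move: lamK; rewrite -kapn normrX.
  by rewrite ler_pXn2r ?nnegrE.
have [v [V [d [a0 [hv [V0 hV] [d0 hd] ode]]]]] := hK kap kapK.
rewrite -kapn.
exact: (bloch_in_spectrum n0 hP hv V0 hV d0 hd ode).
Qed.
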